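(* Let $\{c_n\}_{n\ge1}$ be a non-decreasing sequence of positive reals with $N_c(T)\sim T$ as $T\to\infty$, let $\xi_T=\sum_{n\ge1}\delta_{c_n-t}$ with $t$ uniform on $(0,T]$, and let $\xi$ be a stationary simple point process on $\mathbb{R}$ with intensity $1$. Then the following are equivalent: (i) $\xi_T\to\xi$ in distribution as $T\to\infty$; (ii) for every positive integer $K$, if $n$ is chosen uniformly at random from $\{1,\dots,N\}$, then as $N\to\infty$ the random vector $(c_{n+1}-c_n,\dots,c_{n+K}-c_n)$ converges in distribution to $(x_1(\xi^0),\dots,x_K(\xi^0))$.
   Context: $N_c(T)=|\{n:c_n\in(0,T]\}|$. A point process on $\mathbb{R}$ is a random locally finite, non-negative-integer-valued Borel measure on $\mathbb{R}$ with the vague topology (generated by $\nu\mapsto\int f\,d\nu$, $f\in C_c(\mathbb{R})$); convergence in distribution means convergence of $\mathbb{E}F$ for bounded continuous $F$. $\xi$ is simple if almost surely $\xi(\{x\})\le1$ for all $x$. For $s\in\mathbb{R}$, $\theta^s\nu(B)=\nu(B+s)$; $\xi$ is stationary if $\theta^s\xi\overset{d}{=}\xi$ for all $s$, with intensity $I_\xi$ given by $\mathbb{E}\,\xi(B)=I_\xi|B|$. For stationary $\xi$ with $I_\xi\in(0,\infty)$ the Palm process $\xi^0$ is defined by $\mathbb{P}(\xi^0\in E)=\frac1{I_\xi}\mathbb{E}\int_0^1\mathbf 1_E(\theta^s\xi)\,d\xi(s)$; it is almost surely infinite in both directions. For $\nu$ with $\nu(-\infty,0)=\nu(0,\infty)=\infty$,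 $x_k(\nu)=\inf\{x>0:\nu(0,x]\ge k\}$ for $k>0$ (the $k$-th atom to the right of the origin, counted with multiplicity). *)

(* Defs.v *)
From HB Require Import structures.
From mathcomp Require Import all_boot all_order all_algebra.
From mathcomp Require Import all_classical all_reals all_analysis.
From mathcomp Require Import measurable_realfun.
Set Implicit Arguments. Unset Strict Implicit. Unset Printing Implicit Defensive.
Import Order.TTheory GRing.Theory Num.Theory.
Import numFieldNormedType.Exports.
Local Open Scope classical_set_scope.
Local Open Scope ring_scope.

Section PointProcesses.
Variable R : realType.

Definition rawmeas := set R -> \bar R.

Definition is_counting_measure (nu : {measure set R -> \bar R}) : Prop :=
  forall B : set R, measurable B -> (exists r : R, B `<=` `[- r, r]) ->
    exists k : nat, nu B = (k%:R)%:E.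

Definition shift (s : R) (nu : rawmeas) : rawmeas :=
  fun B => nu ((fun x => x + s) @` B).

Definition eval_generators : set (set rawmeas) :=
  [set E | exists (B : set R) (A : set (\bar R)),
      [/\ measurable B, measurable A & E = (fun nu : rawmeas => nu B) @^-1` A]].

Definition meas_event (E : set rawmeas) : Prop := <<s eval_generators >> E.

Definition point_process d (Omega : measurableType d) (xi : Omega -> {measure set R -> \bar R}) : Prop :=
  (forall w, is_counting_measure (xi w)) /\
  (forall B : set R, measurable B -> measurable_fun setT (fun w => xi w B)).

Definition simple_pp d (Omega : measurableType d) (P : probability Omega R)
  (xi : Omega -> {measure set R -> \bar R}) : Prop :=
  {ae P, forall w, forall x : R, (xi w [set x] <= 1%:E)%E}.

Definition stationary_pp d (Omega : measurableType d) (P : probability Omega R)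
  (xi : Omega -> {measure set R -> \bar R}) : Prop :=
  forall (s : R) (E : set rawmeas), meas_event E ->
    P [set w | E (shift s (xi w))] = P [set w | E (xi w : rawmeas)].

Definition has_intensity d (Omega : measurableType d) (P : probability Omega R)
  (xi : Omega -> {measure set R -> \bar R}) (I : R) : Prop :=
  forall B : set R, measurable B ->
    (\int[P]_w xi w B = I%:E * (@lebesgue_measure R) B)%E.

Definition is_palm_version d (Omega : measurableType d) (P : probability Omega R)
  (xi : Omega -> {measure set R -> \bar R}) (I : R)
  d0 (Omega0 : measurableType d0) (P0 : probability Omega0 R)
  (xi0 : Omega0 -> {measure set R -> \bar R}) : Prop :=
  (forall B : set R, measurable B -> measurable_fun setT (fun w => xi0 w B)) /\
  forall E : set rawmeas, meas_event E ->
    P0 [set w | E (xi0 w : rawmeas)] =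
    ((I^-1)%:E * \int[P]_w (\int[xi w]_(s in `]0%R, 1%R]) (\1_E (shift s (xi w)) : R)%:E))%E.

Definition xk (k : nat) (nu : rawmeas) : R :=
  inf [set x : R | 0 < x /\ ((k%:R)%:E <= nu `]0%R, x]%classic)%E].

Definition Cc (f : R -> R) : Prop :=
  continuous f /\ exists r : R, forall x, r < `|x| -> f x = 0.

(** F is continuous on the space of locally finite counting measures for the
    vague topology (the initial topology of nu |-> int f dnu, f in C_c(R)). *)
Definition vague_continuous (F : {measure set R -> \bar R} -> R) : Prop :=
  forall nu, is_counting_measure nu -> forall eps : R, 0 < eps ->
    exists (fs : seq (R -> R)) (delta : R),
      [/\ (forall f, f \in fs -> Cc f), 0 < delta &
        forall mu, is_counting_measure mu ->
          (forall f, f \in fs ->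
             `| fine (\int[mu]_x (f x)%:E) - fine (\int[nu]_x (f x)%:E) | < delta) ->
          `| F mu - F nu | < eps].

Definition bounded_on_counting (F : {measure set R -> \bar R} -> R) : Prop :=
  exists M : R, forall nu, is_counting_measure nu -> `| F nu | <= M.

Definition Ncount (c : nat -> R) (T : R) : \bar R :=
  counting [set n : nat | c n \in `]0%R, T]].

Definition xiT (c : nat -> R) (t : R) : {measure set R -> \bar R} :=
  mseries (fun n => \d_(c n - t)) 0.

End PointProcesses.

(* Main.v *)
Require Import Defs.
From HB Require Import structures.
From mathcomp Require Import all_boot all_order all_algebra.
From mathcomp Require Import all_classical all_reals all_analysis.
From mathcomp Require Import measurable_realfun.
From mathcomp Require Import ring lra zify.
Set Implicit Arguments.
Unset Strict Implicit.
Unset Printing Implicit Defensive.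
Import Order.TTheory GRing.Theory Num.Theory.
Import numFieldNormedType.Exports.
Local Open Scope classical_set_scope.
Local Open Scope ring_scope.

(** Every quantity is reduced to counts [nu ]a, b]], which are natural numbers:
    a vaguely continuous [F] is the limit of lower approximations depending only
    on the counts in a fine grid of cells.

    (i) => (ii).  Time averages of functions of counts converge, by sandwiching
    indicators between trapezoids.  The time set where [xi_t] has a point in
    ]-h, 0] splits into windows ]c_n, c_n + h], on which the points of [xi_t] to
    the right of 0 are within h of the gaps seen from c_n; dividing by h and
    letting h -> 0 turns time averages into averages over n, and the same limit
    on the side of [xi] is the Palm expectation.

    (ii) => (i).  For a function [u] of the cell counts in ]-A, A], remove the
    points from left to right.  Removing the point s changes [u] by [jump s v],
    where v lists the K next points seen from s, as long as fewer than K points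
    lie in ]s, s + 2 A].  Integrating over s gives a Lipschitz function [jbar] of
    v; the time average of [u] is the average of [jbar] over the gap vectors, its
    expectation under [xi] is the Palm expectation of [jbar], and the two errors
    are governed by P(xi^0 ]0, 2 A + 1] >= K), which vanishes as K grows. *)

(** * Countable-valued maps and real integrals *)

(** Three obstacles shape the details. First, [xi0] is given only through its law: its values need
    not be counting measures. Everything about it is therefore read off conditions [k <= nu ]0, x]],
    meaningful for any measure, and that it has infinitely many points on the right, finitely many
    in each ]0, b], is proved almost surely. Second, [c] may have ties and clusters, as simplicity
    is assumed of [xi] alone. In (i) => (ii) the window of an index is cut short at the next one;
    the total loss is the deficit of the hit time against h per index, bounded in the limit by the
    expected number of points of [xi] that a grid of mesh h fails to isolate. Third, the Palm law
    arises by weighting the law of [xi] with the count in ]-h, 0] and dividing by h, and this limit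
    is taken for a fixed finite pattern. Hence gap vectors are discretised on a fixed mesh, and
    Lipschitz functions absorb the change of mesh. For general test functions lower bounds suffice,
    applied to a function and, up to a constant, to its negative; this replaces any tightness
    argument. *)

Section CountableValued.
Context d (T : measurableType d).

(** Measurability for the discrete sigma-algebra, stated on atoms: it passes to any function of the
    value ([cmeas_comp]), so functions of counts need no regularity. *)
Definition cmeas (C : countType) (Z : T -> C) : Prop :=
  forall a, measurable (Z @^-1` [set a]).

Lemma cmeas_preimage (C : countType) (Z : T -> C) (A : set C) :
  cmeas Z -> measurable (Z @^-1` A).
Proof.
move=> mZ; rewrite (_ : _ @^-1` _ =
    \bigcup_n (if unpickle n is Some a then
      (if `[< A a >] then Z @^-1` [set a] else set0) else set0)).
  apply: bigcupT_measurable => n; case: (unpickle n) => // a.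
  by case: ifP => // _; exact: mZ.
apply/seteqP; split => [w /= Aw|w [n _]].
  by exists (pickle (Z w)) => //; rewrite pickleK asboolT.
by case: (unpickle n) => // a; case: asboolP => // Aa /= ->.
Qed.

Lemma cmeas_comp (C C' : countType) (u : C -> C') (Z : T -> C) :
  cmeas Z -> cmeas (u \o Z).
Proof. by move=> mZ a; rewrite comp_preimage; exact: cmeas_preimage. Qed.

Lemma cmeas_pair (C C' : countType) (Z : T -> C) (Z' : T -> C') :
  cmeas Z -> cmeas Z' -> cmeas (fun w => (Z w, Z' w)).
Proof.
move=> mZ mZ' [a b].
rewrite (_ : _ @^-1` _ = Z @^-1` [set a] `&` Z' @^-1` [set b]).
  exact: measurableI.
by apply/seteqP; split => w /= [-> ->].
Qed.

Lemma cmeas_ffun (I : finType) (C : countType) (Z : I -> T -> C) :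
  (forall i, cmeas (Z i)) -> cmeas (fun w => [ffun i => Z i w]).
Proof.
move=> mZ a.
rewrite (_ : _ @^-1` _ = \bigcap_(i in [set: I]) (Z i @^-1` [set a i])).
  by apply: fin_bigcap_measurable => // i _; exact: mZ.
apply/seteqP; split => [w /= <- i _ /=|w h /=]; first by rewrite ffunE.
by apply/ffunP => i; rewrite ffunE; exact: h.
Qed.

Lemma cmeas_measurable (C : countType) d' (T' : measurableType d')
    (u : C -> T') (Z : T -> C) :
  cmeas Z -> measurable_fun setT (u \o Z).
Proof.
move=> mZ _ Y _; rewrite setTI comp_preimage; exact: cmeas_preimage.
Qed.

End CountableValued.

Section EqualLaw.
Context (R : realType) (C : countType).
Context d1 (T1 : measurableType d1) d2 (T2 : measurableType d2).
Variables (mu1 : {measure set T1 -> \bar R}) (mu2 : {measure set T2 -> \bar R}).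
Variables (Z1 : T1 -> C) (Z2 : T2 -> C).
Hypotheses (mZ1 : cmeas Z1) (mZ2 : cmeas Z2).
Hypothesis eqZ : forall a, mu1 (Z1 @^-1` [set a]) = mu2 (Z2 @^-1` [set a]).

Let ext (u : C -> \bar R) (n : nat) : \bar R :=
  if unpickle n is Some a then u a else 0%E.

Let extE u a : ext u (pickle a) = u a.
Proof. by rewrite /ext pickleK. Qed.

(** Coding [C] by [pickle] turns both maps into measurable maps to [nat]; their image measures agree
    on atoms, hence everywhere by countable additivity. *)
Lemma ge0_eq_law_integral (u : C -> \bar R) : (forall a, 0 <= u a)%E ->
  (\int[mu1]_w u (Z1 w) = \int[mu2]_w u (Z2 w))%E.
Proof.
move=> u0.
have m1 : measurable_fun setT (pickle \o Z1 : T1 -> nat) by exact: cmeas_measurable.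
have m2 : measurable_fun setT (pickle \o Z2 : T2 -> nat) by exact: cmeas_measurable.
have e0 n : (0 <= ext u n)%E by rewrite /ext; case: unpickle.
have me : measurable_fun setT (ext u) by [].
transitivity (\int[mu1]_w ((ext u) \o (pickle \o Z1)) w)%E.
  by apply: eq_integral => w _ /=; rewrite extE.
transitivity (\int[mu2]_w ((ext u) \o (pickle \o Z2)) w)%E; last first.
  by apply: eq_integral => w _ /=; rewrite extE.
have := @ge0_integral_pushforward _ _ _ _ _ _ m1 mu1 setT (ext u) measurableT me.
rewrite preimage_setT => <- //.
have := @ge0_integral_pushforward _ _ _ _ _ _ m2 mu2 setT (ext u) measurableT me.
rewrite preimage_setT => <- //.
apply: eq_measure_integral => A mA _ /=.
(* The test [pickle a == n] makes the union disjoint: several codes may unpickle to the same [a]. *)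
have pE T (Z : T -> C) : (pickle \o Z) @^-1` A =
    \bigcup_n (if unpickle n is Some a then
      (if (n \in A) && (pickle a == n) then Z @^-1` [set a] else set0) else set0).
  apply/seteqP; split => [w /= Aw|w [n _]].
    by exists (pickle (Z w)) => //; rewrite pickleK eqxx andbT mem_set.
  case E: (unpickle n) => [a|//]; case: ifP => // /andP[/set_mem nA /eqP an] /= ->.
  by rewrite an.
rewrite /pushforward !pE !measure_bigcup//.
- apply: eq_eseriesr => n _; case: (unpickle n) => [a|]; last by rewrite !measure0.
  by case: ifP => // _; rewrite !measure0.
- by move=> n _; case: unpickle => // a; case: ifP.
- move=> i j _ _ [w []]; case: (unpickle i) => // a; case: ifP => // /andP[_ /eqP <-].
  by case: (unpickle j) => // b; case: ifP => // /andP[_ /eqP <-] /= -> ->.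
- by move=> n _; case: unpickle => // a; case: ifP.
- move=> i j _ _ [w []]; case: (unpickle i) => // a; case: ifP => // /andP[_ /eqP <-].
  by case: (unpickle j) => // b; case: ifP => // /andP[_ /eqP <-] /= -> ->.
Qed.

Lemma eq_law_Rintegral (u : C -> R) :
  Rintegral mu1 setT (fun w => u (Z1 w)) = Rintegral mu2 setT (fun w => u (Z2 w)).
Proof.
rewrite /Rintegral; congr fine.
rewrite integralE [RHS]integralE; congr (_ - _)%E.
  under eq_integral do rewrite funeposE.
  under [RHS]eq_integral do rewrite funeposE.
  apply: (ge0_eq_law_integral (u := fun a => maxe (u a)%:E 0%E)) => a.
  by rewrite le_max lexx orbT.
under eq_integral do rewrite funenegE.
under [RHS]eq_integral do rewrite funenegE.
apply: (ge0_eq_law_integral (u := fun a => maxe (- (u a)%:E)%E 0%E)) => a.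
by rewrite le_max lexx orbT.
Qed.

End EqualLaw.

Section RealIntegral.
Context (R : realType) d (T : measurableType d).
Variables (mu : {measure set T -> \bar R}) (D : set T).
Hypothesis mD : measurable D.

Definition integ (f : T -> R) : Prop := mu.-integrable D (EFin \o f).

Lemma integD f g : integ f -> integ g -> integ (fun x => f x + g x).
Proof.
move=> fi gi; have := integrableD mD fi gi.
by apply: eq_integrable => // x _ /=; rewrite EFinD.
Qed.

Lemma integN f : integ f -> integ (fun x => - f x).
Proof.
move=> fi; have := integrableN fi.
by apply: eq_integrable => // x _ /=; rewrite EFinN.
Qed.

Lemma integB f g : integ f -> integ g -> integ (fun x => f x - g x).
Proof. by move=> fi gi; apply: integD => //; exact: integN. Qed.

Lemma integZ k f : integ f -> integ (fun x => k * f x).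
Proof.
move=> fi; have := integrableZl mD k fi.
by apply: eq_integrable => // x _ /=; rewrite EFinM.
Qed.

Lemma integ_abs f : integ f -> integ (fun x => `|f x|).
Proof. exact: integrable_norm. Qed.

Lemma integ_sum (I : Type) (s : seq I) (h : I -> T -> R) :
  (forall i, integ (h i)) -> integ (fun x => \sum_(i <- s) h i x).
Proof.
move=> hi; have := @integrable_sum _ _ _ mu D mD I s xpredT (fun i => EFin \o h i).
move=> /(_ (fun i _ => hi i)).
by apply: eq_integrable => // x _ /=; rewrite sumEFin.
Qed.

Lemma integ_le (f g : T -> R) : measurable_fun D f -> integ g ->
  (forall x, D x -> `|f x| <= g x) -> integ f.
Proof.
move=> mf gi fg; apply: (le_integrable mD _ _ gi).
  exact/measurable_EFinP.
by move=> x Dx /=; rewrite lee_fin (le_trans (fg x Dx))// ler_norm.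
Qed.

Lemma integ_cst k : (mu D < +oo)%E -> integ (fun _ => k).
Proof.
by move=> fD; apply: measurable_bounded_integrable => //; exact: bounded_cst.
Qed.

Lemma integ_bounded (f : T -> R) M : (mu D < +oo)%E -> measurable_fun D f ->
  (forall x, D x -> `|f x| <= M) -> integ f.
Proof. by move=> fD mf fM; apply: (integ_le mf _ fM); exact: integ_cst. Qed.

Lemma RintegralN f : integ f ->
  Rintegral mu D (fun x => - f x) = - Rintegral mu D f.
Proof.
move=> fi; rewrite -mulN1r -RintegralZl//.
by apply: eq_Rintegral => x _; rewrite mulN1r.
Qed.

Lemma Rintegral_sum (I : Type) (s : seq I) (h : I -> T -> R) :
  (forall i, integ (h i)) ->
  Rintegral mu D (fun x => \sum_(i <- s) h i x) =
  \sum_(i <- s) Rintegral mu D (h i).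
Proof.
move=> hi; elim: s => [|i s IH].
  rewrite big_nil; under eq_Rintegral do rewrite big_nil.
  by rewrite Rintegral_cst// mul0r.
rewrite big_cons -IH -(RintegralD mD (hi i) (integ_sum s hi)).
by apply: eq_Rintegral => x _; rewrite big_cons.
Qed.

Lemma Rintegral_dist (f g h : T -> R) : integ f -> integ g -> integ h ->
  (forall x, D x -> `|f x - g x| <= h x) ->
  `|Rintegral mu D f - Rintegral mu D g| <= Rintegral mu D h.
Proof.
move=> fi gi hi fgh; rewrite -RintegralB//.
apply: (le_trans (le_normr_Rintegral _ _)) => //; first exact: integB.
apply: le_Rintegral => //; apply: integ_abs; exact: integB.
Qed.

Lemma Rintegral_dominated_cvg (f_ : nat -> T -> R) (f g : T -> R) :
  (forall n, measurable_fun D (f_ n)) -> measurable_fun D f ->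
  {ae mu, forall x, D x -> f_ ^~ x @ \oo --> f x} -> integ g ->
  (forall n x, D x -> `|f_ n x| <= g x) ->
  Rintegral mu D (f_ n) @[n --> \oo] --> Rintegral mu D f.
Proof.
move=> mf_ mf ff gi fg.
have m1 n : measurable_fun D (EFin \o f_ n) by exact/measurable_EFinP.
have m2 : measurable_fun D (EFin \o f) by exact/measurable_EFinP.
have c1 : {ae mu, forall x, D x -> (EFin \o f_ n) x @[n --> \oo] --> (EFin \o f) x}.
  by apply: filterS ff => x hx Dx; apply: cvg_EFin; [exact: nearW|exact: hx].
have c2 : {ae mu, forall x n, D x -> (`|(EFin \o f_ n) x| <= (EFin \o g) x)%E}.
  by apply: aeW => x n Dx; rewrite lee_fin; exact: fg.
have [fi _ h] := dominated_convergence mD m1 m2 c1 gi c2.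
apply: fine_cvg; rewrite fineK//; exact: integrable_fin_num.
Qed.

End RealIntegral.

(** * Counts of points in intervals *)

Section Counting.
Context (R : realType).
Implicit Types (nu : {measure set R -> \bar R}) (a b x s e : R).

(* Junk value 0 when [nu ]a, b]] is infinite; for counting measures see [ptsE]. *)
Definition pts (nu : set R -> \bar R) (a b : R) : nat :=
  Num.truncn (fine (nu `]a, b]%classic)).

Lemma itv_bounded a b : exists r : R, `]a, b]%classic `<=` `[- r, r].
Proof.
exists (`|a| + `|b|) => x /=; rewrite !in_itv/= => /andP[ax xb].
have := ler_norm b; have := ler_norm (- a); rewrite normrN.
have := normr_ge0 a; have := normr_ge0 b; lra.
Qed.

Lemma ptsE nu a b : is_counting_measure nu ->
  nu `]a, b]%classic = (pts nu a b)%:R%:E.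
Proof.
move=> /(_ `]a, b]%classic (measurable_itv _) (itv_bounded a b))[k].
by rewrite /pts => ->; rewrite natrK.
Qed.

Lemma pts_cat nu a b c : is_counting_measure nu -> a <= b -> b <= c ->
  pts nu a c = (pts nu a b + pts nu b c)%N.
Proof.
move=> cn ab bc; apply/eqP; rewrite -(eqr_nat R); apply/eqP/EFin_inj.
rewrite natrD EFinD -!ptsE// -measureU//.
  by rewrite -itv_bndbnd_setU// bnd_simp.
apply/seteqP; split => // y [/=]; rewrite !in_itv/=; lra.
Qed.

Lemma pts_ge nu a b : b <= a -> pts nu a b = 0%N.
Proof.
move=> ba; rewrite /pts set_itv_ge ?measure0//= ?truncn0//.
by rewrite bnd_simp -leNgt.
Qed.

Lemma pts_le nu a b a' b' : is_counting_measure nu -> a' <= a -> b <= b' ->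
  (pts nu a b <= pts nu a' b')%N.
Proof.
move=> cn aa bb; rewrite -(ler_nat R) -lee_fin -!ptsE//.
apply: le_measure; rewrite ?inE//.
by move=> y /=; rewrite !in_itv/=; lra.
Qed.

(** Continuity from above gives convergence, and a convergent sequence of natural numbers is
    eventually equal to its limit. *)
Lemma counting_nonincreasing_cst nu (F : (set R)^nat) :
  is_counting_measure nu -> (forall n, measurable (F n)) ->
  (exists r : R, F 0%N `<=` `[- r, r]) -> nonincreasing_seq F ->
  exists n, nu (F n) = nu (\bigcap_n F n).
Proof.
move=> cn mF [r Fr] dF.
have bF n : exists r : R, F n `<=` `[- r, r].
  by exists r; apply: subset_trans Fr; apply/subsetPset/dF.
have [k0 k0E] := cn _ (mF 0%N) (bF 0%N).
have mI : measurable (\bigcap_n F n) by exact: bigcapT_measurable.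
have [k kE] := cn (\bigcap_n F n) mI
  (ex_intro _ r (subset_trans (bigcap_inf (i := 0%N) I) Fr)).
have F0fin : (nu (F 0%N) < +oo)%E by rewrite k0E ltry.
have cv := nonincreasing_cvg_mu F0fin mF mI dF.
have /choice[f fE] n := cn _ (mF n) (bF n).
have : (f n)%:R @[n --> \oo] --> (k%:R : R).
  have /fine_cvgP[_] : nu (F n) @[n --> \oo] --> (k%:R : R)%:E by rewrite -kE.
  by apply: cvg_trans; apply: near_eq_cvg; near=> n; rewrite /= fE.
move=> /cvgrPdist_lt /(_ 1 ltr01)[n _ /(_ n (leqnn n))] /= h.
exists n; rewrite kE fE; congr (_%:E).
have : (k < f n + 1)%N by rewrite -(ltr_nat R) natrD; move: h; rewrite ltr_norml; lra.
have : (f n < k + 1)%N by rewrite -(ltr_nat R) natrD; move: h; rewrite ltr_norml; lra.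
by move=> ? ?; congr (_%:R); lia.
Unshelve. all: by end_near.
Qed.

Lemma pts_right0 nu s : is_counting_measure nu ->
  exists2 e, 0 < e & pts nu s (s + e) = 0%N.
Proof.
move=> cn; pose F n : set R := `]s, s + n.+1%:R^-1]%classic.
have [|||n] := @counting_nonincreasing_cst nu F cn.
- by move=> n; exact: measurable_itv.
- exact: itv_bounded.
- move=> m n mn; apply/subsetPset => y; rewrite /F/= !in_itv/= => /andP[-> /le_trans]/=.
  by apply; rewrite lerD2l lef_pV2 ?posrE// ler_nat.
rewrite (_ : \bigcap_n F n = set0) ?measure0 => [h|].
  by exists n.+1%:R^-1; rewrite ?invr_gt0// /pts -/(F n) h truncn0.
rewrite -subset0 => y h.
have sy : s < y by have := h 0%N I; rewrite /F /= in_itv/= => /andP[].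
have ys : 0 < y - s by rewrite subr_gt0.
have := h (Num.truncn (y - s)^-1) I; rewrite /F/= in_itv/= sy/= => ysn.
have := truncnS_gt (y - s)^-1; rewrite -ltf_pV2 ?posrE ?invr_gt0// invrK; move: ysn; move: (_%:R^-1) => t; lra.
Qed.

Lemma pts_at nu x : is_counting_measure nu -> (nu [set x] <= 1%:E)%E ->
  exists2 e, 0 < e & (pts nu (x - e) (x + e) <= 1)%N.
Proof.
move=> cn nx; pose F n : set R := `]x - n.+1%:R^-1, x + n.+1%:R^-1]%classic.
have [|||n] := @counting_nonincreasing_cst nu F cn.
- by move=> n; exact: measurable_itv.
- exact: itv_bounded.
- move=> m n mn; apply/subsetPset => y; rewrite /F/= !in_itv/= => /andP[h1 h2].
  have : n.+1%:R^-1 <= m.+1%:R^-1 :> R by rewrite lef_pV2 ?posrE// ler_nat.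
  move: (n.+1%:R^-1) (m.+1%:R^-1) h1 h2 => u v; lra.
rewrite (_ : \bigcap_n F n = [set x]) => [h|].
  exists n.+1%:R^-1; rewrite ?invr_gt0//.
  by rewrite -(ler_nat R) -lee_fin -ptsE//; rewrite /F in h; rewrite h.
apply/seteqP; split => [y h|y -> m _]; last first.
  by rewrite /F /= in_itv/= lerDl invr_ge0 ler0n andbT ltrBlDr ltrDl invr_gt0.
apply/eqP; apply: contraT => yx.
have yx0 : 0 < `|y - x| by rewrite normr_gt0 subr_eq0.
have := h (Num.truncn (`|y - x|)^-1) I; rewrite /F/= in_itv/= => ysn.
have := truncnS_gt (`|y - x|)^-1; rewrite -ltf_pV2 ?posrE ?invr_gt0// invrK; move: ysn; move: (_%:R^-1) => t.
by case: (ler0P (y - x)); lra.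
Qed.

(** Compactness makes the radius of [pts_at] uniform in s. Simplicity of [xi] enters the proof
    through this lemma alone, in [epsN_cvg0]. *)
Lemma simple_cells nu a b : is_counting_measure nu ->
  (forall x, (nu [set x] <= 1%:E)%E) ->
  exists2 e, 0 < e & forall s d, a <= s <= b -> d <= e -> (pts nu s (s + d) <= 1)%N.
Proof.
move=> cn sn.
have := (@segment_compact R a b); rewrite compact_near_coveringP.
move=> /(_ R (0^'+) (fun e s => (pts nu s (s + e) <= 1)%N)) []; last first.
  move=> e /= e0 h; exists (e / 2); first by rewrite divr_gt0.
  move=> s d /andP[as_ sb] de; apply: (@leq_trans (pts nu s (s + e / 2))).
    by apply: pts_le => //; lra.
  apply: h => //=.
  - by rewrite /ball_/= sub0r normrN gtr0_norm; move: e0 => /=; lra.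
  - by move: e0 => /=; lra.
  - by rewrite in_itv/= as_ sb.
move=> x _; have [e e0 xe] := pts_at cn (sn x).
near=> s d => /=.
apply: leq_trans xe; apply: pts_le => //.
  have : `|x - s| < e / 2 by near: s; apply: cvgr_dist_lt => //; lra.
  by rewrite ltr_norml; lra.
have : d < e / 2 by near: d; apply: nbhs_right_lt; lra.
have : `|x - s| < e / 2 by near: s; apply: cvgr_dist_lt => //; lra.
by rewrite ltr_norml; lra.
Unshelve. all: by end_near.
Qed.

Lemma shift_itv s (nu : set R -> \bar R) a b :
  Defs.shift s nu `]a, b]%classic = nu `]a + s, b + s]%classic.
Proof.
rewrite /Defs.shift; congr nu; apply/seteqP; split => [y [x /=]|y /=].
  by rewrite !in_itv/= => h <-; lra.
by rewrite in_itv/= => h; exists (y - s); rewrite ?subrK// in_itv/=; lra.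
Qed.

Lemma cmeas_pts d (T : measurableType d) (xi : T -> {measure set R -> \bar R}) a b :
  point_process xi -> cmeas (fun w => pts (xi w) a b).
Proof.
move=> [cn mxi] k.
rewrite (_ : _ @^-1` _ = (fun w => xi w `]a, b]%classic) @^-1` [set (k%:R : R)%:E]).
  by rewrite -[X in measurable X]setTI; apply: mxi => //; exact: emeasurable_set1.
apply/seteqP; split => w /=; rewrite ptsE//; first by move->.
by case=> /eqP; rewrite eqr_nat => /eqP.
Qed.

End Counting.

(** * Stationarity of finite families of counts *)

Section Stationarity.
Context (R : realType) d (Omega : measurableType d) (P : probability Omega R).
Variable xi : Omega -> {measure set R -> \bar R}.
Hypotheses (xi_pp : point_process xi) (xi_stat : stationary_pp P xi).

Definition fam (I : finType) (a b : I -> R) (nu : set R -> \bar R) : {ffun I -> nat} :=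
  [ffun i => pts nu (a i) (b i)].

Lemma cmeas_fam (I : finType) (a b : I -> R) d' (T : measurableType d')
    (eta : T -> {measure set R -> \bar R}) :
  point_process eta -> cmeas (fun w => fam a b (eta w)).
Proof. by move=> eta_pp; apply: cmeas_ffun => i; exact: cmeas_pts. Qed.

Lemma meas_event_fin (I : finType) (E : I -> set (rawmeas R)) :
  (forall i, meas_event (E i)) -> meas_event [set nu | forall i, E i nu].
Proof.
move=> mE.
have := @fin_bigcap_measurable _ (g_sigma_algebraType (@eval_generators R)) I setT E.
move=> /(_ finite_finset (fun i _ => mE i)).
rewrite (_ : \bigcap_(_ in _) _ = [set nu | forall i, E i nu])//.
by apply/seteqP; split => [nu h i|nu h i _]; exact: h.
Qed.

Lemma meas_event_eval (B : set R) (A : set (\bar R)) :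
  measurable B -> measurable A -> meas_event [set nu : rawmeas R | A (nu B)].
Proof. by move=> mB mA; apply: sub_sigma_algebra; exists B, A. Qed.

Lemma fam_law_shift (I : finType) (a b : I -> R) s (v : {ffun I -> nat}) :
  P ((fun w => fam (fun i => a i + s) (fun i => b i + s) (xi w)) @^-1` [set v]) =
  P ((fun w => fam a b (xi w)) @^-1` [set v]).
Proof.
(* Written with values of the measure: events are generated by evaluations, and [pts] determines
   these on counting measures only. *)
pose E := [set nu : rawmeas R | forall i, nu `]a i, b i]%classic = (v i)%:R%:E].
have mE : meas_event E.
  apply: meas_event_fin => i.
  exact: (@meas_event_eval _ [set (v i)%:R%:E] (measurable_itv _) (emeasurable_set1 _)).
have := xi_stat s mE.
have famE (nu : {measure set R -> \bar R}) (a' b' : I -> R) : is_counting_measure nu ->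
    (fam a' b' nu = v) <-> (forall i, nu `]a' i, b' i]%classic = (v i)%:R%:E).
  move=> cn; split => [<- i|h]; first by rewrite ffunE ptsE.
  by apply/ffunP => i; rewrite ffunE /pts h /= natrK.
rewrite (_ : [set w | E (Defs.shift s (xi w))] =
    (fun w => fam (fun i => a i + s) (fun i => b i + s) (xi w)) @^-1` [set v]).
  move=> ->; congr (P _); apply/seteqP; split => w /= h; apply/famE => //;
  exact: xi_pp.1.
apply/seteqP; split => w /= h.
  by apply/famE => [|i]; [exact: xi_pp.1|rewrite -shift_itv; exact: h].
by move=> i; rewrite shift_itv; exact: ((famE _ _ _ (xi_pp.1 w)).1 h i).
Qed.

Lemma fam_Rintegral_shift (I : finType) (a b : I -> R) s (u : {ffun I -> nat} -> R) :
  Rintegral P setT (fun w => u (fam (fun i => a i + s) (fun i => b i + s) (xi w))) =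
  Rintegral P setT (fun w => u (fam a b (xi w))).
Proof.
have := @eq_law_Rintegral R _ _ _ _ _ P P _ _ (cmeas_fam (fun i => a i + s) (fun i => b i + s) xi_pp) (cmeas_fam a b xi_pp). apply.
by move=> v; exact: fam_law_shift.
Qed.

End Stationarity.

(** * Expected counts and the separation of points by a grid *)

Section Intensity.
Context (R : realType) d (Omega : measurableType d) (P : probability Omega R).
Variable xi : Omega -> {measure set R -> \bar R}.
Hypotheses (xi_pp : point_process xi) (xi_stat : stationary_pp P xi).
Hypotheses (xi_simple : simple_pp P xi) (xi_int : has_intensity P xi 1).

Lemma Pfin : (P setT < +oo)%E.
Proof. by rewrite probability_setT ltry. Qed.

Lemma measurable_pts a b : measurable_fun setT (fun w => (pts (xi w) a b)%:R : R).
Proof.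
exact: (@cmeas_measurable _ _ _ _ _ (fun k : nat => k%:R : R) _ (cmeas_pts a b xi_pp)).
Qed.

Lemma expectation_ptsE a b : a <= b ->
  (\int[P]_w ((pts (xi w) a b)%:R : R)%:E = (b - a)%:E)%E.
Proof.
move=> ab; transitivity (\int[P]_w xi w `]a, b]%classic)%E.
  by apply: eq_integral => w _; rewrite ptsE//; exact: xi_pp.1.
rewrite xi_int// mul1e lebesgue_measure_itv/= lte_fin.
by case: ltP => // ba; congr (_%:E); lra.
Qed.

Lemma integ_pts a b : integ P setT (fun w => (pts (xi w) a b)%:R : R).
Proof.
have [ab|/ltW ba] := leP a b; last first.
  rewrite (_ : (fun _ => _) = fun=> 0); first exact: integ_cst measurableT _ Pfin.
  by apply/funext => w; rewrite pts_ge.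
apply/integrableP; split; first by apply/measurable_EFinP; exact: measurable_pts.
under eq_integral do rewrite /= ger0_norm ?ler0n//.
by rewrite expectation_ptsE// ltry.
Qed.

Lemma Rintegral_pts a b : a <= b ->
  Rintegral P setT (fun w => (pts (xi w) a b)%:R : R) = b - a.
Proof. by move=> ab; rewrite /Rintegral expectation_ptsE. Qed.

Definition mesh (n : nat) : R := n.+1%:R^-1.

Lemma mesh_gt0 n : 0 < mesh n. Proof. by rewrite invr_gt0. Qed.

Lemma mesh_mul n : n.+1%:R * mesh n = 1.
Proof. by rewrite mulfV. Qed.

Lemma mesh_cvg0 : mesh n @[n --> \oo] --> (0 : R).
Proof. exact: cvg_harmonic. Qed.

Definition gpt (n j : nat) : R := j%:R * mesh n.

Lemma gptS n j : gpt n j.+1 = gpt n j + mesh n.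
Proof. by rewrite /gpt -natr1 mulrDl mul1r. Qed.

Lemma gpt_ge0 n j : 0 <= gpt n j.
Proof. by rewrite mulr_ge0// ltW// mesh_gt0. Qed.

Lemma gpt_le n i j : (i <= j)%N -> gpt n i <= gpt n j.
Proof. by move=> ij; rewrite ler_pM2r ?mesh_gt0// ler_nat. Qed.

Lemma sum_pts_grid (nu : {measure set R -> \bar R}) n s m : is_counting_measure nu ->
  (\sum_(j < m) pts nu (s + gpt n j) (s + gpt n j.+1))%N = pts nu s (s + gpt n m).
Proof.
move=> cn; elim: m => [|m IH]; first by rewrite big_ord0 pts_ge// /gpt mul0r addr0.
rewrite big_ord_recr/= IH -pts_cat//.
  by rewrite lerDl /gpt mulr_ge0// ltW// mesh_gt0.
by rewrite lerD2l gpt_le.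
Qed.

(** The points that a cell fails to isolate. *)
Definition mult2 (k : nat) : nat := if (2 <= k)%N then k else 0.

Lemma mult2_le k : (mult2 k <= k)%N.
Proof. by rewrite /mult2; case: ifP. Qed.

Lemma integ_le_pts (f : Omega -> R) M a b : measurable_fun setT f ->
  (forall w, `|f w| <= M * (pts (xi w) a b)%:R) -> integ P setT f.
Proof.
move=> mf fM; by apply: (integ_le measurableT mf (integZ measurableT M (integ_pts a b))) => //.
Qed.

Lemma grid_stationary n m (I : finType) (a b : I -> R) (u : {ffun I -> nat} -> R) :
  (forall j : nat, integ P setT
    (fun w => u (fam (fun i => a i + gpt n j.+1) (fun i => b i + gpt n j.+1) (xi w)))) ->
  Rintegral P setT (fun w => \sum_(j < m)
    u (fam (fun i => a i + gpt n j.+1) (fun i => b i + gpt n j.+1) (xi w))) =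
  m%:R * Rintegral P setT (fun w => u (fam a b (xi w))).
Proof.
move=> iu; rewrite (@Rintegral_sum _ _ _ P setT measurableT 'I_m _ (fun (j : 'I_m) w => u
  (fam (fun i => a i + gpt n j.+1) (fun i => b i + gpt n j.+1) (xi w))))//.
under eq_bigr do rewrite (fam_Rintegral_shift xi_pp xi_stat).
by rewrite sumr_const card_ord mulr_natl.
Qed.

(** By stationarity ([epsN_sum]), the expected number of points of ]0, 1] that share their cell of
    mesh 1/(n+1) with another point. *)
Definition epsN (n : nat) : R :=
  n.+1%:R * Rintegral P setT (fun w => (mult2 (pts (xi w) (- mesh n) 0))%:R : R).

Lemma measurable_mult2 a b :
  measurable_fun setT (fun w => (mult2 (pts (xi w) a b))%:R : R).
Proof.
exact: (@cmeas_measurable _ _ _ _ _ (fun k : nat => (mult2 k)%:R : R) _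
  (cmeas_pts a b xi_pp)).
Qed.

Lemma integ_mult2 a b : integ P setT (fun w => (mult2 (pts (xi w) a b))%:R : R).
Proof.
apply: (@integ_le_pts _ 1 a b); first exact: measurable_mult2.
by move=> w; rewrite mul1r ger0_norm// ler_nat mult2_le.
Qed.

Lemma epsN_sum n : epsN n = Rintegral P setT
  (fun w => \sum_(j < n.+1) (mult2 (pts (xi w) (gpt n j) (gpt n j.+1)))%:R).
Proof.
have e j : - mesh n + gpt n j.+1 = gpt n j by rewrite gptS; lra.
have := @grid_stationary n n.+1 unit (fun=> - mesh n) (fun=> 0)
  (fun v => (mult2 (v tt))%:R).
rewrite /epsN => h; rewrite [LHS](_ : _ = n.+1%:R * Rintegral P setT
  (fun w => (mult2 (fam (fun=> - mesh n) (fun=> 0) (xi w) tt))%:R : R)); last first.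
  by congr (_ * _); apply: eq_Rintegral => w _; rewrite ffunE.
rewrite -h => [|j].
  by apply: eq_Rintegral => w _; apply: eq_bigr => j _; rewrite ffunE e add0r.
rewrite (_ : (fun _ => _) = fun w => (mult2 (pts (xi w) (gpt n j) (gpt n j.+1)))%:R : R).
  exact: integ_mult2.
by apply/funext => w; rewrite ffunE e add0r.
Qed.

Lemma gpt_full n : gpt n n.+1 = 1.
Proof. exact: mesh_mul. Qed.

(** For almost every realisation the sum in [epsN_sum] is eventually 0, since a fine grid separates
    the points; the count in ]0, 1] dominates. *)
Lemma epsN_cvg0 : epsN n @[n --> \oo] --> (0 : R).
Proof.
rewrite (_ : epsN = fun n => Rintegral P setT (fun w =>
  \sum_(j < n.+1) (mult2 (pts (xi w) (gpt n j) (gpt n j.+1)))%:R : R)); last first.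
  by apply/funext => n; exact: epsN_sum.
rewrite [X in _ --> X](_ : 0 = Rintegral P setT (fun=> 0 : R)); last first.
  by rewrite Rintegral_cst// mul0r.
apply: (Rintegral_dominated_cvg measurableT _ _ _ (integ_pts 0 1)).
- by move=> n; apply: measurable_sum => j; exact: measurable_mult2.
- exact: measurable_cst.
- apply: filterS xi_simple => w sw _.
  have [e e0 he] := simple_cells 0 1 (xi_pp.1 w) sw.
  apply: cvg_near_cst.
  have := mesh_cvg0 => /cvgr_dist_lt/(_ _ e0); apply: filterS => n.
  rewrite sub0r normrN gtr0_norm ?mesh_gt0// => ne.
  apply: big1 => j _; rewrite gptS /mult2 ltnNge (he _ _ _ (ltW ne))//.
  by rewrite gpt_ge0/= -(gpt_full n) gpt_le// ltnW.
- move=> n w _; rewrite ger0_norm ?sumr_ge0//.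
  have := sum_pts_grid n 0 n.+1 (xi_pp.1 w); rewrite gpt_full !add0r => <-.
  by rewrite natr_sum; apply: ler_sum => j _; rewrite !add0r ler_nat mult2_le.
Qed.

End Intensity.

(** * Finite patterns of the points to the right of the origin *)

Section Patterns.
Context (R : realType) (dl : R) (q K : nat).

(** Comparisons with thresholds instead of counts: the pattern takes finitely many values, and it
    makes sense where [nu] is infinite or not integer-valued, so that it applies to [xi0]. *)
Definition pat (nu : set R -> \bar R) : {ffun 'I_q * 'I_K -> bool} :=
  [ffun p : 'I_q * 'I_K => (p.2.+1%:R%:E <= nu `]0%R, (p.1.+1%:R * dl)%R]%classic)%E].

Definition patc (A : {ffun 'I_q -> nat}) : {ffun 'I_q * 'I_K -> bool} :=
  [ffun p : 'I_q * 'I_K => (p.2 < A p.1)%N].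

Definition famp (nu : set R -> \bar R) : {ffun 'I_q -> nat} :=
  fam (fun=> 0) (fun i : 'I_q => i.+1%:R * dl) nu.

Lemma pat_counting (nu : {measure set R -> \bar R}) :
  is_counting_measure nu -> pat nu = patc (famp nu).
Proof.
by move=> cn; apply/ffunP => p; rewrite !ffunE ptsE// lee_fin ler_nat.
Qed.

Lemma pat_shift s (nu : {measure set R -> \bar R}) : is_counting_measure nu ->
  pat (Defs.shift s nu) =
  patc (fam (fun=> 0 + s) (fun i : 'I_q => i.+1%:R * dl + s) nu).
Proof.
by move=> cn; apply/ffunP => p; rewrite !ffunE shift_itv ptsE// lee_fin ler_nat.
Qed.

Lemma emeasurable_ge_eq (x : \bar R) (b : bool) : measurable [set y : \bar R | (x <= y)%E = b].
Proof.
have m1 : measurable [set y : \bar R | (x <= y)%E].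
  have := @emeasurable_itv R `[x, +oo[%O.
  by rewrite (_ : [set` _] = [set y : \bar R | (x <= y)%E])//;
    apply/seteqP; split => y /=; rewrite in_itv/= andbT.
case: b => //.
rewrite (_ : [set y | _] = ~` [set y : \bar R | (x <= y)%E]).
  exact: measurableC.
by apply/seteqP; split => y /= => [->//|/negP/negbTE].
Qed.

Lemma meas_event_pat e : meas_event [set nu : rawmeas R | pat nu = e].
Proof.
rewrite (_ : [set nu | _] = [set nu : rawmeas R | forall p : 'I_q * 'I_K,
   (p.2.+1%:R%:E <= nu `]0%R, (p.1.+1%:R * dl)%R]%classic)%E = e p]).
  apply: (@meas_event_fin R ('I_q * 'I_K)%type (fun p => [set nu : rawmeas R |
   (p.2.+1%:R%:E <= nu `]0%R, (p.1.+1%:R * dl)%R]%classic)%E = e p])) => p.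
  apply: (@meas_event_eval R _ [set y : \bar R | (p.2.+1%:R%:E <= y)%E = e p]) => //.
  exact: emeasurable_ge_eq.
apply/seteqP; split => nu /= => [<- p|h]; first by rewrite ffunE.
by apply/ffunP => p; rewrite ffunE.
Qed.

Lemma cmeas_pat d (T : measurableType d) (eta : T -> {measure set R -> \bar R}) :
  (forall B, measurable B -> measurable_fun setT (fun w => eta w B)) ->
  cmeas (fun w => pat (eta w)).
Proof.
move=> meta; apply: cmeas_ffun => p b.
rewrite (_ : _ @^-1` _ = (fun w => eta w `]0%R, (p.1.+1%:R * dl)%R]%classic) @^-1`
   [set y : \bar R | (p.2.+1%:R%:E <= y)%E = b])//.
rewrite -[X in measurable X]setTI; apply: meta => //; exact: emeasurable_ge_eq.
Qed.

Hypothesis dl0 : 0 <= dl.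

(** Intervals open on the left and closed on the right make counts right-continuous under shifts: a
    short move to the right carries neither end across a point. *)
Lemma pat_shift_right (nu : {measure set R -> \bar R}) (s : R) : is_counting_measure nu ->
  exists2 e, 0 < e & forall t : R, s <= t < s + e ->
    pat (Defs.shift t nu) = pat (Defs.shift s nu).
Proof.
move=> cn.
have h (i : 'I_q) : \forall e \near 0^'+, forall t : R, s <= t < s + e ->
    pts nu (0 + t) (i.+1%:R * dl + t) = pts nu (0 + s) (i.+1%:R * dl + s).
  have [e1 e10 h1] := pts_right0 s cn.
  have [e2 e20 h2] := pts_right0 (i.+1%:R * dl + s) cn.
  near=> e => t /andP[st te].
  have ee1 : e < e1 by near: e; exact: nbhs_right_lt.
  have ee2 : e < e2 by near: e; exact: nbhs_right_lt.
  have x0 : 0 <= i.+1%:R * dl by rewrite mulr_ge0.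
  have k1 : pts nu s t = 0%N.
    by apply/eqP; rewrite -leqn0 -h1; apply: pts_le => //; lra.
  have k2 : pts nu (i.+1%:R * dl + s) (i.+1%:R * dl + t) = 0%N.
    by apply/eqP; rewrite -leqn0 -h2; apply: pts_le => //; lra.
  rewrite !add0r -[LHS]add0n -k1 -pts_cat//; last by lra.
  rewrite (@pts_cat _ _ _ (i.+1%:R * dl + s))//; [|by lra|by lra].
  by rewrite k2 addn0.
have [e /= e0 he] := filter_forall _ h.
exists (e / 2); first by rewrite divr_gt0.
move=> t st; rewrite !pat_shift//; congr patc; apply/ffunP => i; rewrite !ffunE.
apply: (he (e / 2)) => //=; last by lra.
by rewrite sub0r normrN gtr0_norm; lra.
Unshelve. all: by end_near.
Qed.

Lemma grid_cell n s : 0 < s <= 1 ->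
  exists j : 'I_n.+1, gpt R n j < s <= gpt R n j.+1.
Proof.
move=> /andP[s0 s1].
have ex : exists j, s <= gpt R n j by exists n.+1; rewrite gpt_full.
case: (ex_minnP ex) => j sj jm.
have j0 : (0 < j)%N by case: j sj {jm} => //; rewrite /gpt mul0r; lra.
have jn : (j.-1 < n.+1)%N by have := jm n.+1; rewrite gpt_full => /(_ s1); lia.
exists (Ordinal jn) => /=; rewrite prednK// sj andbT ltNge; apply/negP => /jm.
lia.
Qed.

Variable u : {ffun 'I_q * 'I_K -> bool} -> R.

(** Samples at the right end of each cell, the side on which [pat_shift_right] gives continuity. *)
Definition stepf (nu : set R -> \bar R) n (s : R) : R :=
  \sum_(j < n.+1) u (pat (Defs.shift (gpt R n j.+1) nu)) *
     \1_(`]gpt R n j, gpt R n j.+1]%classic) s.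

Lemma stepfE (nu : set R -> \bar R) n s (j : 'I_n.+1) : gpt R n j < s <= gpt R n j.+1 ->
  stepf nu n s = u (pat (Defs.shift (gpt R n j.+1) nu)).
Proof.
move=> sj; rewrite /stepf (bigD1 j)//= indicE mem_set ?mulr1; last by rewrite /= in_itv.
rewrite big1 ?addr0// => i ij; rewrite indicE memNset ?mulr0//= in_itv/= => /andP[h1 h2].
move: ij; rewrite -val_eqE neq_ltn/= => /orP[ij|ji].
  by have := gpt_le R n ij; lra.
by have := gpt_le R n ji; lra.
Qed.

Lemma stepf_cvg (nu : {measure set R -> \bar R}) s : is_counting_measure nu ->
  0 < s <= 1 ->
  stepf nu ^~ s @ \oo --> u (pat (Defs.shift s nu)).
Proof.
move=> cn s01; have [e e0 he] := pat_shift_right s cn.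
apply: cvg_near_cst.
have := @mesh_cvg0 R => /cvgr_dist_lt/(_ _ e0); apply: filterS => n.
rewrite sub0r normrN gtr0_norm ?mesh_gt0// => ne.
have [j sj] := grid_cell n s01; rewrite (stepfE _ sj) he//.
by move: sj; rewrite gptS; lra.
Qed.

Lemma measurable_stepf (nu : set R -> \bar R) n D : measurable_fun D (stepf nu n).
Proof.
apply: measurable_sum => j; apply: measurable_funM; first exact: measurable_cst.
exact: measurable_indic.
Qed.

Lemma measurable_pat_shift (nu : {measure set R -> \bar R}) : is_counting_measure nu ->
  measurable_fun (`]0, 1]%classic : set R) (fun s : R => u (pat (Defs.shift s nu))).
Proof.
move=> cn; apply: (@measurable_fun_cvg _ _ _ _ (stepf nu)) => [n|s].
  exact: measurable_stepf.
by rewrite /= in_itv/=; exact: stepf_cvg.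
Qed.

Definition ubnd : R := \sum_e `|u e|.

Lemma ubndP e : `|u e| <= ubnd.
Proof. by rewrite /ubnd (bigD1 e)//= lerDl sumr_ge0. Qed.

Lemma stepf_bound nu n s : 0 < s <= 1 -> `|stepf nu n s| <= ubnd.
Proof. by move=> /(grid_cell n)[j sj]; rewrite (stepfE _ sj) ubndP. Qed.

Lemma Rintegral_stepf (nu : {measure set R -> \bar R}) n : is_counting_measure nu ->
  Rintegral nu `]0%R, 1%R] (stepf nu n) =
  \sum_(j < n.+1) u (pat (Defs.shift (gpt R n j.+1) nu)) *
    (pts nu (gpt R n j) (gpt R n j.+1))%:R.
Proof.
move=> cn.
have f01 : (nu `]0%R, 1%R]%classic < +oo)%E by rewrite ptsE// ltry.
have ii (j : 'I_n.+1) : integ nu `]0%R, 1%R]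
    (\1_(`]gpt R n j, gpt R n j.+1]%classic) : R -> R).
  apply: (@integ_bounded _ _ _ _ _ _ _ 1) => //.
  by move=> x _; rewrite indicE; case: (_ \in _); rewrite /= ?normr1 ?normr0.
rewrite Rintegral_sum//; last by move=> j; exact: integZ.
apply: eq_bigr => j _; rewrite (RintegralZl _ _ (ii j))//; congr (_ * _).
rewrite /Rintegral integral_indic// /pts setIidl.
  by rewrite ptsE// /= natrK.
move=> x /=; rewrite !in_itv/= => /andP[h1 h2].
have := gpt_le R n (ltn_ord j); rewrite gpt_full => h3.
have := gpt_ge0 R n j; lra.
Qed.

(** The inner integral of the Palm formula, against [nu] itself, is a limit of sums that involve
    only counts of [nu]. *)
Lemma palm_sum_cvg (nu : {measure set R -> \bar R}) : is_counting_measure nu ->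
  \sum_(j < n.+1) u (pat (Defs.shift (gpt R n j.+1) nu)) *
    (pts nu (gpt R n j) (gpt R n j.+1))%:R @[n --> \oo] -->
  Rintegral nu `]0%R, 1%R] (fun s : R => u (pat (Defs.shift s nu))).
Proof.
move=> cn.
have f01 : (nu `]0%R, 1%R]%classic < +oo)%E by rewrite ptsE// ltry.
under eq_fun do rewrite -Rintegral_stepf//.
have m01 : measurable (`]0%R, 1%R]%classic : set R) by [].
apply: (@Rintegral_dominated_cvg _ _ _ nu _ m01 _ _ (fun=> ubnd)).
- by move=> n; exact: measurable_stepf.
- exact: measurable_pat_shift.
- by apply: aeW => s; rewrite /= in_itv/=; exact: stepf_cvg.
- exact: integ_cst.
- by move=> n s; rewrite /= in_itv/=; exact: stepf_bound.
Qed.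

End Patterns.

Lemma measurable_ge_points (R : realType) d (T : measurableType d)
    (eta : T -> {measure set R -> \bar R}) (k : nat) (b : R) :
  (forall B, measurable B -> measurable_fun setT (fun w => eta w B)) ->
  measurable [set w | (k%:R%:E <= eta w `]0%R, b]%classic)%E].
Proof.
move=> meta; rewrite (_ : [set w | _] = (fun w => eta w `]0%R, b]%classic) @^-1`
  [set y : \bar R | (k%:R%:E <= y)%E = true])//.
rewrite -[X in measurable X]setTI; apply: meta => //; exact: emeasurable_ge_eq.
Qed.

(** * The Palm process as a limit of conditional laws *)

Lemma cvg_sumr (R : realType) (T : Type) (F : set_system T) (FF : Filter F) (I : Type)
    (s : seq I) (f : I -> T -> R) (a : I -> R) :
  (forall i, f i x @[x --> F] --> a i) ->
  (\sum_(i <- s) f i x) @[x --> F] --> \sum_(i <- s) a i.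
Proof.
move=> fa; elim: s => [|i s IH].
  by rewrite big_nil; under eq_fun do rewrite big_nil; exact: cvg_cst.
by rewrite big_cons; under eq_fun do rewrite big_cons; exact: cvgD.
Qed.

Section FiniteExpansion.
Context (R : realType) d (T : measurableType d) (mu : {measure set T -> \bar R}).
Context (F : finType) (Z : T -> F) (W : T -> R).
Hypotheses (mZ : cmeas Z) (iW : integ mu setT W).

Lemma measurable_finval (u : F -> R) : measurable_fun setT (fun w => u (Z w)).
Proof. exact: (cmeas_measurable u mZ). Qed.

Lemma integ_finval (u : F -> R) : integ mu setT (fun w => u (Z w) * W w).
Proof.
have uM e : `|u e| <= \sum_e `|u e| by rewrite (bigD1 e)//= lerDl sumr_ge0.
have mW : measurable_fun setT W by apply/measurable_EFinP; exact: (measurable_int mu iW).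
have mf : measurable_fun setT (fun w => u (Z w) * W w).
  by apply: measurable_funM => //; exact: measurable_finval.
apply: (integ_le measurableT mf (integZ measurableT (\sum_e `|u e|) (integ_abs iW))).
by move=> w _; rewrite normrM ler_wpM2r.
Qed.

Lemma Rintegral_finval (u : F -> R) :
  Rintegral mu setT (fun w => u (Z w) * W w) =
  \sum_e u e * Rintegral mu setT (fun w => (Z w == e)%:R * W w).
Proof.
transitivity (Rintegral mu setT (fun w => \sum_e u e * ((Z w == e)%:R * W w))).
  apply: eq_Rintegral => w _; rewrite (bigD1 (Z w))//= eqxx mul1r big1 ?addr0// => e.
  by rewrite eq_sym => /negbTE ->; rewrite mul0r mulr0.
rewrite Rintegral_sum//; last first.
  move=> e; apply: integZ => //; exact: (integ_finval (fun f => (f == e)%:R)).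
apply: eq_bigr => e _; rewrite RintegralZl//.
exact: (integ_finval (fun f => (f == e)%:R)).
Qed.

End FiniteExpansion.

Section PatStationary.
Context (R : realType) d (Omega : measurableType d) (P : probability Omega R).
Variable xi : Omega -> {measure set R -> \bar R}.
Hypotheses (xi_pp : point_process xi) (xi_stat : stationary_pp P xi).
Variables (dl : R) (q K : nat).

Lemma cmeas_pat_pts s a b :
  cmeas (fun w => (pat dl q K (Defs.shift s (xi w)), pts (xi w) a b)).
Proof.
apply: cmeas_pair; last exact: cmeas_pts.
rewrite (_ : (fun w => _) = patc K \o (fun w =>
    fam (fun=> 0 + s) (fun i : 'I_q => i.+1%:R * dl + s) (xi w))).
  by apply: cmeas_comp; exact: cmeas_fam.
by apply/funext => w /=; rewrite pat_shift//; exact: xi_pp.1.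
Qed.

Lemma pat_stationary (h s : R) (v : {ffun 'I_q * 'I_K -> bool} -> nat -> R) :
  Rintegral P setT (fun w => v (pat dl q K (Defs.shift s (xi w))) (pts (xi w) (s - h) s)) =
  Rintegral P setT (fun w => v (pat dl q K (xi w)) (pts (xi w) (- h) 0)).
Proof.
(* The index [None] carries the cell ]-h, 0], so that one family of counts determines both the
   pattern and the weight. *)
pose a (o : option 'I_q) : R := if o is Some i then 0 else - h.
pose b (o : option 'I_q) : R := if o is Some i then i.+1%:R * dl else 0.
pose U (f : {ffun option 'I_q -> nat}) : R :=
  v (patc K [ffun i => f (Some i)]) (f None).
have := fam_Rintegral_shift xi_pp xi_stat a b s U.
rewrite [X in X = _ -> _](_ : _ = Rintegral P setT (fun w =>
   v (pat dl q K (Defs.shift s (xi w))) (pts (xi w) (s - h) s))).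
  move=> ->; apply: eq_Rintegral => w _; rewrite /U !ffunE pat_counting; last exact: xi_pp.1.
  by congr (v _ _); congr patc; apply/ffunP => i; rewrite !ffunE.
apply: eq_Rintegral => w _; rewrite /U !ffunE pat_shift; last exact: xi_pp.1.
rewrite /a /b add0r [- h + s]addrC.
by congr (v _ _); congr patc; apply/ffunP => i; rewrite !ffunE add0r.
Qed.

End PatStationary.

Section Palm.
Context (R : realType) d (Omega : measurableType d) (P : probability Omega R).
Variable xi : Omega -> {measure set R -> \bar R}.
Hypotheses (xi_pp : point_process xi) (xi_stat : stationary_pp P xi).
Hypotheses (xi_simple : simple_pp P xi) (xi_int : has_intensity P xi 1).
Context d0 (Omega0 : measurableType d0) (P0 : probability Omega0 R).
Variable xi0 : Omega0 -> {measure set R -> \bar R}.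
Hypothesis xi0_palm : is_palm_version P xi 1 P0 xi0.
Variables (dl : R) (q K : nat).
Hypothesis dl0 : 0 <= dl.

Notation Q := {ffun 'I_q * 'I_K -> bool}.

Lemma cmeas_pat0 : cmeas (fun w => pat dl q K (xi0 w)).
Proof. exact: cmeas_pat xi0_palm.1. Qed.

Lemma cmeas_patxi : cmeas (fun w => pat dl q K (xi w)).
Proof. exact: cmeas_pat xi_pp.2. Qed.

Let psum (u : Q -> R) n w := \sum_(j < n.+1) u (pat dl q K (Defs.shift (gpt R n j.+1) (xi w))) *
    (pts (xi w) (gpt R n j) (gpt R n j.+1))%:R.

Let pint (u : Q -> R) w :=
  Rintegral (xi w) `]0%R, 1%R] (fun s : R => u (pat dl q K (Defs.shift s (xi w)))).

Let mpsum u n : measurable_fun setT (psum u n).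
Proof.
apply: measurable_sum => j.
exact: (cmeas_measurable (fun f : Q * nat => u f.1 * f.2%:R)
  (@cmeas_pat_pts _ _ _ _ xi_pp dl q K (gpt R n j.+1) (gpt R n j) (gpt R n j.+1))).
Qed.

Let psum_cvg u w : psum u n w @[n --> \oo] --> pint u w.
Proof. by apply: palm_sum_cvg => //; exact: xi_pp.1. Qed.

Let mpint u : measurable_fun setT (pint u).
Proof. by apply: (@measurable_fun_cvg _ _ _ _ (psum u)) => // w _; exact: psum_cvg. Qed.

Let psum_bound u n w : `|psum u n w| <= ubnd u * (pts (xi w) 0 1)%:R.
Proof.
apply: (le_trans (ler_norm_sum _ _ _)).
have := sum_pts_grid n 0 n.+1 (xi_pp.1 w); rewrite gpt_full !add0r => <-.
rewrite natr_sum mulr_sumr; apply: ler_sum => j _; rewrite !add0r normrM.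
by rewrite [X in _ * X]ger0_norm// ler_wpM2r// ubndP.
Qed.

(** By stationarity each of the n+1 cells of ]0, 1] contributes as much as ]-h, 0] seen from the
    origin, with h = 1/(n+1). The limit is [palm_sum_cvg], dominated by a multiple of the count in
    ]0, 1]. *)
Lemma palm_cvg_pint (u : Q -> R) :
  n.+1%:R * Rintegral P setT (fun w => u (pat dl q K (xi w)) * (pts (xi w) (- mesh R n) 0)%:R)
    @[n --> \oo] --> Rintegral P setT (pint u).
Proof.
have e n : n.+1%:R * Rintegral P setT
    (fun w => u (pat dl q K (xi w)) * (pts (xi w) (- mesh R n) 0)%:R) =
    Rintegral P setT (psum u n).
  rewrite Rintegral_sum//; last first.
    move=> j; apply: (@integ_le_pts _ _ _ _ _ xi_pp xi_int _ (ubnd u) (gpt R n j) (gpt R n j.+1)).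
      exact: (cmeas_measurable (fun f : Q * nat => u f.1 * f.2%:R)
       (@cmeas_pat_pts _ _ _ _ xi_pp dl q K (gpt R n j.+1) (gpt R n j) (gpt R n j.+1))).
    by move=> w; rewrite normrM [X in _ * X]ger0_norm// ler_wpM2r// ubndP.
  transitivity (\sum_(j < n.+1) Rintegral P setT
      (fun w => u (pat dl q K (xi w)) * (pts (xi w) (- mesh R n) 0)%:R)).
    by rewrite sumr_const card_ord mulr_natl.
  apply: eq_bigr => j _.
  rewrite -(pat_stationary xi_pp xi_stat dl (mesh R n) (gpt R n j.+1) (fun e k => u e * k%:R)).
  by apply: eq_Rintegral => w _; rewrite gptS addrK.
under eq_fun do rewrite e.
apply: (Rintegral_dominated_cvg measurableT _ _ _
  (integZ measurableT (ubnd u) (integ_pts xi_pp xi_int 0 1))) => //.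
by apply: aeW => w _; exact: psum_cvg.
Qed.

Lemma palm_pint e : fine (P0 [set w | pat dl q K (xi0 w) = e]) =
  Rintegral P setT (pint (fun f => (f == e)%:R)).
Proof.
rewrite (xi0_palm.2 _ (meas_event_pat dl e)) invr1 mul1e.
congr fine; apply: eq_integral => w _.
have cn := xi_pp.1 w.
have f01 : (xi w `]0%R, 1%R]%classic < +oo)%E by rewrite ptsE// ltry.
rewrite /pint /Rintegral fineK.
  by apply: eq_integral => s _; congr (_%:E); rewrite indicE; congr ((nat_of_bool _)%:R);
    apply/idP/idP => [/set_mem/= ->|/eqP h]//; apply/mem_set.
apply: integrable_fin_num => //; apply: (@integ_bounded _ _ _ _ _ _ _ 1) => //.
  exact: (measurable_pat_shift dl0 (fun f : Q => (f == e)%:R) cn).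
by move=> s _; case: eqP => _; rewrite ?normr1 ?normr0.
Qed.

(** Both sides are linear in [u] and there are finitely many patterns, so the indicator of a single
    pattern suffices; for it the limit is the definition of the Palm law ([palm_pint]). *)
Theorem palm_cvg (u : Q -> R) :
  n.+1%:R * Rintegral P setT (fun w => u (pat dl q K (xi w)) * (pts (xi w) (- mesh R n) 0)%:R)
    @[n --> \oo] --> Rintegral P0 setT (fun w => u (pat dl q K (xi0 w))).
Proof.
have -> : Rintegral P0 setT (fun w => u (pat dl q K (xi0 w))) =
    \sum_e u e * fine (P0 [set w | pat dl q K (xi0 w) = e]).
  transitivity (Rintegral P0 setT (fun w => u (pat dl q K (xi0 w)) * 1)).
    by apply: eq_Rintegral => w _; rewrite mulr1.
  rewrite (Rintegral_finval cmeas_pat0 (integ_cst measurableT 1 (Pfin P0))).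
  apply: eq_bigr => e _; congr (_ * _); rewrite /Rintegral.
  have := integral_indic P0 measurableT (cmeas_pat0 e); rewrite setIT => <-.
  congr fine; apply: eq_integral => w _; rewrite mulr1; congr (_%:E); rewrite indicE.
  by congr ((nat_of_bool _)%:R); apply/idP/idP => [/eqP h|/set_mem/= ->]//; apply/mem_set.
rewrite [X in X @ _ --> _](_ : _ = fun n => \sum_e u e * (n.+1%:R * Rintegral P setT
   (fun w => (pat dl q K (xi w) == e)%:R * (pts (xi w) (- mesh R n) 0)%:R))).
  apply: cvg_sumr => e; apply: cvgMl_tmp; rewrite palm_pint.
  exact: (@palm_cvg_pint (fun f => (f == e)%:R)).
apply/funext => n; rewrite (Rintegral_finval cmeas_patxi (integ_pts xi_pp xi_int _ _)).
by rewrite mulr_sumr; apply: eq_bigr => e _; rewrite mulrCA.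
Qed.

End Palm.

Lemma Rintegral_cst_prob (R : realType) d (T : measurableType d) (P : probability T R) (k : R) :
  Rintegral P setT (fun=> k) = k.
Proof.
rewrite Rintegral_cst//.
have -> : fine (P setT) = 1 by rewrite probability_setT.
by rewrite mulr1.
Qed.

Section GridPalm.
Context (R : realType) d (Omega : measurableType d) (P : probability Omega R).
Variable xi : Omega -> {measure set R -> \bar R}.
Hypotheses (xi_pp : point_process xi) (xi_stat : stationary_pp P xi).
Hypotheses (xi_int : has_intensity P xi 1).
Variables (dl : R) (q K : nat).

Lemma integ_pat_pts (M : R) s a b (v : {ffun 'I_q * 'I_K -> bool} -> nat -> R) :
  (forall e k, `|v e k| <= M * k%:R) ->
  integ P setT (fun w => v (pat dl q K (Defs.shift s (xi w))) (pts (xi w) a b)).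
Proof.
move=> vM; apply: (@integ_le_pts _ _ _ _ _ xi_pp xi_int _ M a b) => //.
exact: (cmeas_measurable (fun f : {ffun 'I_q * 'I_K -> bool} * nat => v f.1 f.2)
  (@cmeas_pat_pts _ _ _ _ xi_pp dl q K s a b)).
Qed.

Lemma grid_palm (M : R) s n m (v : {ffun 'I_q * 'I_K -> bool} -> nat -> R) :
  (forall e k, `|v e k| <= M * k%:R) ->
  Rintegral P setT (fun w => \sum_(j < m) v (pat dl q K (Defs.shift (s + gpt R n j.+1) (xi w)))
     (pts (xi w) (s + gpt R n j) (s + gpt R n j.+1))) =
  m%:R * Rintegral P setT (fun w => v (pat dl q K (xi w)) (pts (xi w) (- mesh R n) 0)).
Proof.
move=> vM; rewrite (@Rintegral_sum _ _ _ P setT measurableT 'I_m _ (fun (j : 'I_m) w =>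
  v (pat dl q K (Defs.shift (s + gpt R n j.+1) (xi w)))
    (pts (xi w) (s + gpt R n j) (s + gpt R n j.+1)))); last first.
  by move=> j; exact: integ_pat_pts.
rewrite mulr_natl -[in RHS](card_ord m) -sumr_const; apply: eq_bigr => j _.
rewrite -(pat_stationary xi_pp xi_stat dl (mesh R n) (s + gpt R n j.+1) v).
by apply: eq_Rintegral => w _; rewrite gptS addrA addrK.
Qed.

End GridPalm.

(** * Infinitely many, yet locally finitely many, points to the right in the Palm process *)

Section PalmInfinite.
Context (R : realType) d (Omega : measurableType d) (P : probability Omega R).
Variable xi : Omega -> {measure set R -> \bar R}.
Hypotheses (xi_pp : point_process xi) (xi_stat : stationary_pp P xi).
Hypotheses (xi_simple : simple_pp P xi) (xi_int : has_intensity P xi 1).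
Context d0 (Omega0 : measurableType d0) (P0 : probability Omega0 R).
Variable xi0 : Omega0 -> {measure set R -> \bar R}.
Hypothesis xi0_palm : is_palm_version P xi 1 P0 xi0.

(* Scanning the cells from left to right, a cell contributes only if fewer than k
   points follow it, so the contributions add up to about k whatever L is; by
   stationarity the Palm probability is at most k / L. *)
Lemma few_points_tail (nu : {measure set R -> \bar R}) n m k (L : R) :
  is_counting_measure nu -> gpt R n m <= L ->
  (\sum_(j < m) (if pts nu (gpt R n j.+1) L < k then pts nu (gpt R n j) (gpt R n j.+1) else 0)
   <= k + \sum_(j < m) mult2 (pts nu (gpt R n j) (gpt R n j.+1)))%N.
Proof.
move=> cn mL.
(* Passing a contributing cell with one point lowers [minn _ k] by one; cells with several points
   are paid for by [mult2]. *)
suff h i : (i <= m)%N ->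
  (\sum_(j < i) (if pts nu (gpt R n j.+1) L < k then pts nu (gpt R n j) (gpt R n j.+1) else 0)
   + minn (pts nu (gpt R n i) L) k
   <= k + \sum_(j < i) mult2 (pts nu (gpt R n j) (gpt R n j.+1)))%N.
  by apply: leq_trans (h m (leqnn _)); rewrite leq_addr.
elim: i => [|i IH] im; first by rewrite !big_ord0 add0n addn0 geq_minr.
have := IH (ltnW im); rewrite !big_ord_recr/= (@pts_cat _ nu (gpt R n i) (gpt R n i.+1) L)//.
- rewrite /mult2; case: ifP; case: ifP; lia.
- exact: gpt_le.
- exact: (le_trans (gpt_le R n im)).
Qed.

Lemma palm_few_points k (L : nat) : (0 < L)%N ->
  (P0 [set w | ~~ (k%:R%:E <= xi0 w `]0%R, L%:R]%classic)] <= (k%:R / L%:R : R)%:E)%E.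
Proof.
case: k => [|k] L0.
  rewrite (_ : [set _ | _] = set0) ?measure0 ?mul0r//.
  by rewrite -subset0 => w /=; rewrite measure_ge0.
have L0R : (0 : R) < L%:R by rewrite ltr0n.
pose u (e : {ffun 'I_1 * 'I_k.+1 -> bool}) : R := (~~ e (ord0, ord_max))%:R.
have uE0 w : u (pat L%:R 1 k.+1 (xi0 w)) = (~~ (k.+1%:R%:E <= xi0 w `]0%R, L%:R]%classic)%E)%:R.
  by rewrite /u ffunE/= mul1r.
have mA : measurable [set w | ~~ (k.+1%:R%:E <= xi0 w `]0%R, L%:R]%classic)%E].
  have := cmeas_preimage [set e : {ffun 'I_1 * 'I_k.+1 -> bool} | ~~ e (ord0, ord_max)]
    (cmeas_pat0 xi0_palm L%:R (q := 1) (K := k.+1)).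
  rewrite (_ : _ @^-1` _ = [set w | ~~ (k.+1%:R%:E <= xi0 w `]0%R, L%:R]%classic)%E])//.
  by apply/seteqP; split => w /=; rewrite ffunE/= mul1r.
have PE : P0 [set w | ~~ (k.+1%:R%:E <= xi0 w `]0%R, L%:R]%classic)%E] =
    (Rintegral P0 setT (fun w => u (pat L%:R 1 k.+1 (xi0 w))))%:E.
  have := integral_indic P0 measurableT mA; rewrite setIT => Pi.
  rewrite /Rintegral -[LHS]fineK ?fin_num_measure// -Pi; congr (fine _)%:E.
  apply: eq_integral => w _; rewrite uE0 indicE; congr ((nat_of_bool _)%:R%:E).
  by apply/idP/idP => [/set_mem|h]//; apply/mem_set.
rewrite PE lee_fin.
have cv := @palm_cvg _ _ _ _ _ xi_pp xi_stat xi_int _ _ _ _ xi0_palm _ 1 k.+1 (ler0n R L) u.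
have ev : (k.+1%:R / L%:R + epsN P xi n) @[n --> \oo] --> (k.+1%:R / L%:R : R).
  rewrite -[X in _ --> X]addr0; apply: cvgD; first exact: cvg_cst.
  exact: (@epsN_cvg0 _ _ _ _ _ xi_pp xi_stat xi_simple xi_int).
apply: (ler_cvg_to cv ev); near=> n => /=.
(* After multiplication by L the left side is the expectation of a sum over the L (n+1) cells of ]0,
   L], to which [few_points_tail] applies. *)
rewrite -(ler_pM2l L0R) mulrA -natrM.
rewrite -(@grid_palm _ _ _ _ _ xi_pp xi_stat xi_int L%:R 1 k.+1 1 0 n (L * n.+1)
  (fun e j => u e * j%:R)); last first.
  by move=> e j; rewrite normrM [X in _ * X]ger0_norm// ler_wpM2r// /u; case: (e _); rewrite ?normr0 ?normr1.
have -> : L%:R * (k.+1%:R / L%:R + epsN P xi n) = Rintegral P setT (fun w => k.+1%:R +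
   \sum_(j < L * n.+1) (mult2 (pts (xi w) (0 + gpt R n j) (0 + gpt R n j.+1)))%:R).
  have mb (e : {ffun 'I_1 * 'I_k.+1 -> bool}) (j : nat) : `|(mult2 j)%:R| <= 1 * j%:R :> R.
    by rewrite mul1r ger0_norm// ler_nat mult2_le.
  rewrite RintegralD//; last 2 first.
  - exact: integ_cst (Pfin P).
  - apply: (integ_sum measurableT) => j; exact: (integ_mult2 xi_pp xi_int).
  rewrite (@grid_palm _ _ _ _ _ xi_pp xi_stat xi_int L%:R 1 k.+1 1 0 n (L * n.+1)
    (fun e j => (mult2 j)%:R))//.
  rewrite Rintegral_cst_prob /epsN.
  by rewrite mulrDr mulrC divfK ?gt_eqF// natrM mulrA.
apply: le_Rintegral => //.
- apply: (integ_sum measurableT) => j; apply: (@integ_pat_pts _ _ _ _ _ xi_pp xi_int L%:R 1 k.+1 1 _ _ _ (fun e j => u e * j%:R)).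
  by move=> e i; rewrite normrM [X in _ * X]ger0_norm// ler_wpM2r// /u; case: (e _); rewrite ?normr0 ?normr1.
- apply: (integD measurableT (integ_cst _ _ (Pfin P))) => //.
  apply: (integ_sum measurableT) => j; exact: (integ_mult2 xi_pp xi_int).
move=> w _; have cn := xi_pp.1 w.
have gL : gpt R n (L * n.+1) <= L%:R by rewrite /gpt natrM -mulrA mesh_mul mulr1.
rewrite -natr_sum -natrD.
under [in leRHS]eq_bigr do rewrite !add0r.
apply: le_trans (_ : (k.+1 + \sum_(j < L * n.+1) mult2 (pts (xi w) (gpt R n j) (gpt R n j.+1)))%:R <= _) => //.
apply: le_trans (_ : (\sum_(j < L * n.+1) (if pts (xi w) (gpt R n j.+1) L%:R < k.+1
   then pts (xi w) (gpt R n j) (gpt R n j.+1) else 0))%N%:R <= _); last first.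
  by rewrite ler_nat; exact: few_points_tail.
(* Few points in ]s, s + L], as seen from s >= 0, implies few points in ]s, L]. *)
rewrite natr_sum; apply: ler_sum => j _; rewrite !add0r /u ffunE/= shift_itv ptsE//.
rewrite lee_fin ler_nat mul1r add0r; case: leqP => [h|_] /=; last by rewrite mul0r.
rewrite mul1r ltnS (leq_trans _ h)//.
by apply: pts_le => //; rewrite lerDl gpt_ge0.
Unshelve. all: by end_near.
Qed.

Lemma cnt_le (nu : {measure set R -> \bar R}) (x : \bar R) (y z : R) : y <= z ->
  (x <= nu `]0%R, y]%classic)%E -> (x <= nu `]0%R, z]%classic)%E.
Proof.
move=> yz /le_trans; apply; apply: le_measure; rewrite ?inE//.
by move=> t /=; rewrite !in_itv/=; lra.
Qed.

(** Let L tend to infinity in [palm_few_points] for each k, then take the countable union over k of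
    the exceptional sets. *)
Lemma palm_right_infinite :
  {ae P0, forall w, forall k : nat, exists x : R, 0 < x /\ (k%:R%:E <= xi0 w `]0%R, x]%classic)%E}.
Proof.
pose A k := \bigcap_(L in [set: nat]) [set w | ~~ (k%:R%:E <= xi0 w `]0%R, L.+1%:R]%classic)%E].
have mA1 k L : measurable [set w | ~~ (k%:R%:E <= xi0 w `]0%R, L.+1%:R]%classic)%E].
  rewrite (_ : [set w | _] = (fun w => xi0 w `]0%R, L.+1%:R]%classic) @^-1`
    [set y : \bar R | (k%:R%:E <= y)%E = false]).
    rewrite -[X in measurable X]setTI; apply: xi0_palm.1 => //; exact: emeasurable_ge_eq.
  by apply/seteqP; split => w /= => [/negbTE|->].
have A0 k : P0 (A k) = 0%E.
  apply/eqP; rewrite eq_le measure_ge0 andbT; apply/lee_addgt0Pr => e e0; rewrite add0e.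
  have e1 : 0 < e / k.+1%:R by rewrite divr_gt0.
  have := @mesh_cvg0 R => /cvgr_dist_lt/(_ _ e1)[L _ /(_ L (leqnn L))].
  rewrite /= sub0r normrN gtr0_norm ?mesh_gt0// => Le.
  apply: (@le_trans _ _ (k%:R / L.+1%:R : R)%:E).
    apply: le_trans (palm_few_points k (ltn0Sn L)).
    apply: le_measure; rewrite ?inE//; first exact: bigcapT_measurable.
    by move=> w /(_ L I).
  rewrite lee_fin; move: Le; rewrite ltr_pdivlMr// => Le.
  apply: le_trans (ltW Le); by rewrite mulrC ler_wpM2l ?invr_ge0// ler_nat.
have N : P0.-negligible (\bigcup_k A k).
  apply: negligible_bigcup => k.
  have mAk : measurable (A k) by exact: bigcapT_measurable.
  exact: (proj2 (negligibleP _ mAk) (A0 k)).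
apply: negligibleS N => w /= /existsNP[k hk]; exists k => // L _ /=.
by apply/negP => h; apply: hk; exists L.+1%:R; split.
Qed.

(** Finiteness on ]0, b] is transferred from [xi] by the Palm formula for the event [nu ]0, b] =
    +oo]; continuity from above then gives the tail. *)
Lemma palm_right_finite (b e : R) : 0 < e ->
  exists K0 : nat, forall K, (K0 <= K)%N ->
    (P0 [set w | (K%:R%:E <= xi0 w `]0%R, b]%classic)%E] <= e%:E)%E.
Proof.
move=> e0; pose F K := [set w | (K%:R%:E <= xi0 w `]0%R, b]%classic)%E].
have mF K : measurable (F K) by exact: measurable_ge_points xi0_palm.1.
have dF : nonincreasing_seq F.
  move=> m n mn; apply/subsetPset => w; apply: le_trans.
  by rewrite lee_fin ler_nat.
have P0F : P0 (\bigcap_K F K) = 0%E.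
  pose E := [set nu : rawmeas R | nu `]0, b]%classic = +oo%E].
  have mE : meas_event E.
    exact: (@meas_event_eval R _ [set +oo%E] (measurable_itv _) (emeasurable_set1 _)).
  transitivity (P0 [set w | E (xi0 w : rawmeas R)]).
    congr (P0 _); apply/seteqP; split => [w h|w /= h K _]; last by rewrite /F /= h leey.
    apply/eqP; rewrite -leye_eq leNgt; apply/negP => lty.
    have f : xi0 w `]0, b]%classic \is a fin_num by rewrite ge0_fin_numE.
    have [r rE] : exists r, xi0 w `]0, b]%classic = r%:E.
      by exists (fine (xi0 w `]0, b]%classic)); rewrite fineK.
    have := h (Num.truncn r).+1 I.
    by rewrite /F/= rE lee_fin leNgt truncnS_gt.
  rewrite (xi0_palm.2 _ mE) integral0_eq ?mule0// => w _.
  apply: integral0_eq => s _; congr (_%:E); rewrite indicE memNset// /E /= shift_itv ptsE//.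
  exact: xi_pp.1.
have F0 : (P0 (F 0%N) < +oo)%E by apply: le_lt_trans (probability_le1 P0 (mF 0%N)) (ltry _).
have cv : P0 (F n) @[n --> \oo] --> 0%E.
  by rewrite -P0F; exact: (@nonincreasing_cvg_mu _ _ _ P0 F F0 mF (bigcapT_measurable mF) dF).
have e0' : (0 < e%:E)%E by rewrite lte_fin.
have /fine_cvgP[_ /cvgr_dist_lt/(_ _ e0)[K0 _ hK]] := cv.
exists K0 => K /hK /=; rewrite sub0r normrN ger0_norm ?fine_ge0// => /ltW.
by rewrite -lee_fin fineK// fin_num_measure.
Qed.

End PalmInfinite.

(** * Point locations read off patterns *)

Section Zvec.
Context (R : realType).

Lemma sum_ltn_ord (l q : nat) : (\sum_(i < q) (i < l) = minn l q)%N.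
Proof.
elim: q => [|q IH]; first by rewrite big_ord0 minn0.
by rewrite big_ord_recr/= IH; case: ltnP; lia.
Qed.

Lemma sum_bool_between (q l u : nat) (b : 'I_q -> bool) : (l <= q)%N ->
  (forall i : 'I_q, (i < l)%N -> b i) -> (forall i : 'I_q, (u <= i)%N -> ~~ b i) ->
  (l <= \sum_(i < q) b i <= u)%N.
Proof.
move=> lq bl bu; apply/andP; split.
  rewrite -[X in (X <= _)%N](minn_idPl lq) -sum_ltn_ord; apply: leq_sum => i _.
  by case: ltnP => // /bl ->.
apply: (@leq_trans (minn u q)); last exact: geq_minl.
rewrite -sum_ltn_ord; apply: leq_sum => i _.
by case: ltnP => [_|/bu /negbTE ->//]; case: (b i).
Qed.

(** Says that y is the (k+1)-st point capped at b. The count at x = y itself is left open, so that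
    such a y exists for every measure and no continuity of counts is involved. *)
Definition located (nu : set R -> \bar R) (k : nat) (b y : R) : Prop :=
  [/\ 0 <= y <= b,
      forall x, 0 < x < y -> ~~ (k.+1%:R%:E <= nu `]0%R, x]%classic)%E &
      forall x, y < x <= b -> (k.+1%:R%:E <= nu `]0%R, x]%classic)%E].

Lemma located_exists (nu : {measure set R -> \bar R}) k b : 0 <= b ->
  exists y, located nu k b y.
Proof.
move=> b0.
pose S := [set x : R | 0 <= x <= b /\ (x = 0 \/ ~~ (k.+1%:R%:E <= nu `]0%R, x]%classic)%E)].
have S0 : S 0 by split; [rewrite lexx b0|left].
have hS : has_sup S by split; [exists 0|exists b => x [/andP[]]].
exists (sup S); split.
- by rewrite ub_le_sup//=; [rewrite ge_sup//; [exists 0|move=> x [/andP[]]]|exact: hS.2].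
- move=> x /andP[x0 xs]; have xs0 : 0 < sup S - x by lra.
  have [s [/andP[s0 sb] Ss] xls] := sup_adherent xs0 hS.
  case: Ss => [s00|]; first by exfalso; lra.
  by apply: contra; apply: cnt_le; lra.
- move=> x /andP[sx xb]; apply: contraT => nx; exfalso.
  have : x <= sup S.
    apply: ub_le_sup; first exact: hS.2.
    have s0 : 0 <= sup S by apply: ub_le_sup; first exact: hS.2.
    by split; [lra|right].
  by lra.
Qed.

Lemma xk_located (nu : {measure set R -> \bar R}) k b : 0 <= b ->
  (exists x : R, 0 < x /\ (k.+1%:R%:E <= nu `]0%R, x]%classic)%E) ->
  located nu k b (Num.min (xk k.+1 nu) b).
Proof.
move=> b0 ne; pose S := [set x : R | 0 < x /\ (k.+1%:R%:E <= nu `]0%R, x]%classic)%E].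
have hS : has_inf S by split => //; exists 0 => x [/ltW].
have x0 : 0 <= xk k.+1 nu by apply: lb_le_inf => // x [/ltW].
split.
- by rewrite le_min x0 b0 ge_min lexx orbT.
- move=> x /andP[xp]; rewrite lt_min => /andP[xx _]; apply/negP => h.
  have hx : xk k.+1 nu <= x by apply: ge_inf; [exact: hS.2|].
  by move: xx; rewrite ltNge hx.
- move=> x; rewrite gt_min => /andP[/orP[xx xb|bx xb]]; last by exfalso; lra.
  have xs0 : 0 < x - inf S by rewrite subr_gt0.
  have [s [s0 Ss] sx] := inf_adherent xs0 hS.
  by apply: cnt_le Ss; move: sx; rewrite addrC subrK => /ltW.
Qed.

(* The position of the (k+1)-st point to the right of 0, read off the pattern up
   to an error [2 * dl]; points beyond [q * dl] are placed at [q * dl]. *)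
Definition zv (dl : R) (q K : nat) (e : {ffun 'I_q * 'I_K -> bool}) : 'rV[R]_K :=
  \row_k (dl * (\sum_(i < q) ~~ e (i, k))%:R).

Lemma zv_located (dl : R) (q K : nat) (nu : set R -> \bar R) (k : 'I_K) y : 0 < dl ->
  located nu k (q%:R * dl) y -> `|zv dl (pat dl q K nu) 0 k - y| <= 2 * dl.
Proof.
move=> dl0 [/andP[y0 yb] lo hi].
rewrite mxE; pose m := Num.truncn (y / dl).
have my : m%:R * dl <= y by rewrite -ler_pdivlMr// truncn_le// divr_ge0// ltW.
have ym : y < m.+1%:R * dl by rewrite -ltr_pdivrMr// truncnS_gt.
have mq : (m <= q)%N by rewrite -(ler_nat R) -(ler_pM2r dl0) (le_trans my).
(* The lower bound is [m.-1] and not [m]: the grid point [m * dl] may equal y, where [located] says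
   nothing. *)
have /andP[h1 h2] : (m.-1 <= \sum_(i < q) ~~ pat dl q K nu (i, k) <= m)%N.
  apply: sum_bool_between; first by lia.
  - move=> i im; rewrite ffunE/=; apply: lo; rewrite mulr_gt0//=.
    apply: lt_le_trans my; rewrite ltr_pM2r// ltr_nat; lia.
  - move=> i im; rewrite ffunE/= negbK; apply: hi; apply/andP; split.
      by apply: (lt_le_trans ym); rewrite ler_pM2r// ler_nat.
    by rewrite ler_pM2r// ler_nat.
move: h1 h2; set s := (\sum_(i < q) _)%N => h1 h2.
have s1 : s%:R * dl <= m%:R * dl by rewrite ler_pM2r// ler_nat.
have s2 : m%:R * dl <= (s%:R + 1) * dl by rewrite ler_pM2r// natr1 ler_nat; lia.
rewrite -natr1 in ym; rewrite ler_norml; move: s1 s2 my ym; rewrite !mulrDl mul1r [dl * _]mulrC.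
by move: (s%:R * dl) (m%:R * dl) => u v; lra.
Qed.

(** Both grids span the same interval, so one located y is a reference for both, even if the point
    is missing. *)
Lemma zv_stable (dl dl' : R) (q q' K : nat) (nu : {measure set R -> \bar R}) (k : 'I_K) :
  0 < dl -> 0 < dl' -> q%:R * dl = q'%:R * dl' ->
  `|zv dl (pat dl q K nu) 0 k - zv dl' (pat dl' q' K nu) 0 k| <= 2 * dl + 2 * dl'.
Proof.
move=> dl0 dl0' E.
have [y yl] := located_exists nu k (mulr_ge0 (ler0n R q) (ltW dl0)).
have h1 := zv_located dl0 yl; rewrite E in yl; have h2 := zv_located dl0' yl.
rewrite (le_trans (ler_distD y _ _))// lerD// distrC//.
Qed.

Definition xvec (K : nat) (nu : set R -> \bar R) : 'rV[R]_K := \row_(i < K) xk i.+1 nu.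

(* Unlike [zv], gives 0 to a missing point, as does [xk] through [inf set0 = 0];
   this makes [xvec] a pointwise limit, hence measurable, without exception. *)
Definition zcut (dl : R) (q K : nat) (e : {ffun 'I_q * 'I_K -> bool}) : 'rV[R]_K :=
  \row_k (if [exists i, e (i, k)] then zv dl e 0 k else 0).

(** Mesh 1/(j+1) on a window of length j+1: accuracy and range improve together. *)
Definition zseq (K j : nat) (nu : set R -> \bar R) : 'rV[R]_K :=
  zcut (mesh R j) (pat (mesh R j) (j.+1 * j.+1) K nu).

Lemma zseq_cvg (K : nat) (nu : {measure set R -> \bar R}) (k : 'I_K) :
  zseq K j nu 0 k @[j --> \oo] --> xvec K nu 0 k.
Proof.
have [ne|emp] := pselect (exists x : R, 0 < x /\ (k.+1%:R%:E <= nu `]0%R, x]%classic)%E); last first.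
  apply: cvg_near_cst; near=> j; rewrite !mxE; case: ifPn => [/existsP[i]|_].
    rewrite ffunE => h; exfalso; apply: emp; exists (i.+1%:R * mesh R j); split => //.
    by rewrite mulr_gt0// mesh_gt0.
  rewrite /xk (_ : [set x | _] = set0) ?inf0// -subset0 => x [x0 h].
  by apply: emp; exists x.
have x0 : 0 <= xk k.+1 nu by apply: lb_le_inf => // x [/ltW].
have E j : (j.+1 * j.+1)%:R * mesh R j = j.+1%:R by rewrite natrM -mulrA mesh_mul mulr1.
apply/cvgrPdist_le => e e0; near=> j; rewrite !mxE.
have xj : xk k.+1 nu < j.+1%:R.
  have : (Num.truncn (xk k.+1 nu) <= j)%N by near: j; exact: nbhs_infty_ge.
  by move=> h; apply: (lt_le_trans (truncnS_gt _)); rewrite ler_nat.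
have lc : located nu k j.+1%:R (xk k.+1 nu).
  by have := xk_located (ler0n R j.+1) ne; rewrite min_l// ltW.
case: ifPn => [_|/existsPn/(_ (Ordinal (ltnSn (j.+1 * j.+1).-1)))]; last first.
  by rewrite ffunE -[X in X%:R * _]/((j.+1 * j.+1)%N) E; case: lc => _ _ ->//; rewrite lexx xj.
rewrite -E in lc; have := zv_located (mesh_gt0 R j) lc; rewrite distrC mxE => /le_trans; apply.
have : mesh R j < e / 2.
  near: j; have e2 : 0 < e / 2 by rewrite divr_gt0.
  have := @mesh_cvg0 R => /cvgr_dist_lt/(_ _ e2); apply: filterS => n.
  by rewrite sub0r normrN gtr0_norm ?mesh_gt0.
lra.
Unshelve. all: by end_near.
Qed.

Lemma cvg_row (T : Type) (F : set_system T) (FF : Filter F) (K : nat)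
    (f : T -> 'rV[R]_K) (a : 'rV[R]_K) :
  (forall k, f x 0 k @[x --> F] --> a 0 k) -> f x @[x --> F] --> a.
Proof.
move=> h; apply/cvg_ballP => e e0.
have : \forall x \near F, forall k : 'I_K, ball (a 0 k) e (f x 0 k).
  by apply: filter_forall => k; have /cvg_ballP := h k; apply.
by apply: filterS => x hx; split=> // i k; rewrite ord1; exact: hx.
Qed.

Lemma measurable_xvec (K : nat) d (T : measurableType d)
    (eta : T -> {measure set R -> \bar R}) (g : 'rV[R]_K -> R) :
  (forall B, measurable B -> measurable_fun setT (fun w => eta w B)) ->
  continuous g -> measurable_fun setT (fun w => g (xvec K (eta w))).
Proof.
move=> meta gc; apply: (@measurable_fun_cvg _ _ _ _ (fun j w => g (zseq K j (eta w)))).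
  move=> j; exact: (cmeas_measurable (fun e => g (zcut (mesh R j) e))
    (@cmeas_pat R (mesh R j) (j.+1 * j.+1) K d T eta meta)).
move=> w _; apply: cvg_comp; last exact: gc.
by apply: cvg_row => k; exact: zseq_cvg.
Qed.

End Zvec.

Lemma Rintegral_dist_ae (R : realType) d (T : measurableType d)
    (mu : {measure set T -> \bar R}) (f g h : T -> R) :
  integ mu setT f -> integ mu setT g -> integ mu setT h ->
  (forall x, 0 <= h x) -> {ae mu, forall x, `|f x - g x| <= h x} ->
  `|Rintegral mu setT f - Rintegral mu setT g| <= Rintegral mu setT h.
Proof.
move=> fi gi hi h0 fgh; rewrite -RintegralB//.
have fgi := integB measurableT fi gi.
apply: (le_trans (le_normr_Rintegral _ fgi)) => //.
have nfgi := integ_abs fgi.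
rewrite /Rintegral fine_le ?integrable_fin_num//.
apply: ae_ge0_le_integral => //.
- exact: (measurable_int mu nfgi).
- by move=> x _; rewrite lee_fin.
- exact: (measurable_int mu hi).
- by apply: filterS fgh => x hx _; rewrite lee_fin.
Qed.

(** * Lipschitz functions of the Palm gaps *)

Section LipschitzPalm.
Context (R : realType) (K : nat).

Definition lipv (Lp : R) (G : 'rV[R]_K -> R) : Prop :=
  forall v v', `|G v - G v'| <= Lp * \sum_k `|v 0 k - v' 0 k|.

Definition minv (b : R) (v : 'rV[R]_K) : 'rV[R]_K := \row_k Num.min (v 0 k) b.

Lemma lipv_near (Lp : R) G e (v v' : 'rV[R]_K) : 0 <= Lp -> lipv Lp G ->
  (forall k, `|v 0 k - v' 0 k| <= e) -> `|G v - G v'| <= Lp * (K%:R * e).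
Proof.
move=> Lp0 GL h; apply: (le_trans (GL v v')); rewrite ler_wpM2l//.
apply: le_trans (_ : \sum_(k < K) e <= _); first by apply: ler_sum => k _; exact: h.
by rewrite sumr_const card_ord mulr_natl.
Qed.

Lemma lipv_continuous (Lp : R) G : 0 <= Lp -> lipv Lp G -> continuous G.
Proof.
move=> Lp0 GL v A /nbhs_ballP[e /= e0 eA].
have q0 : 0 < Lp * K%:R + 1 by rewrite ltr_wpDl// mulr_ge0.
have d0 : 0 < e / (Lp * K%:R + 1) by rewrite divr_gt0.
apply/nbhs_ballP; exists (e / (Lp * K%:R + 1)) => // v' [_ vv']; apply: eA.
apply: (@le_lt_trans _ _ (Lp * (K%:R * (e / (Lp * K%:R + 1))))).
  by apply: lipv_near => // k; exact/ltW/vv'.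
move: (divfK (lt0r_neq0 q0) e) d0; move: (e / _) => x <- x0; lra.
Qed.

Lemma min_dist (a a' b : R) : `|Num.min a b - Num.min a' b| <= `|a - a'|.
Proof.
rewrite !minEle ler_norml; case: (leP a b) => h1; case: (leP a' b) => h2;
by case: (ler0P (a - a')); lra.
Qed.

Lemma lipv_cap (Lp : R) G b : 0 <= Lp -> lipv Lp G -> lipv Lp (fun v => G (minv b v)).
Proof.
move=> Lp0 GL v v'; apply: (le_trans (GL _ _)); rewrite ler_wpM2l//.
apply: ler_sum => k _; rewrite !mxE.
exact: min_dist.
Qed.

Context d (Omega : measurableType d) (P : probability Omega R).
Variable xi : Omega -> {measure set R -> \bar R}.
Hypotheses (xi_pp : point_process xi) (xi_stat : stationary_pp P xi).
Hypotheses (xi_simple : simple_pp P xi) (xi_int : has_intensity P xi 1).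
Context d0 (Omega0 : measurableType d0) (P0 : probability Omega0 R).
Variable xi0 : Omega0 -> {measure set R -> \bar R}.
Hypothesis xi0_palm : is_palm_version P xi 1 P0 xi0.

(** [palm_cvg] for the pattern costs [e]; replacing [zv] by the true gaps costs [2 * dl] in each
    coordinate. The cap [q * dl] is there because the pattern sees nothing beyond it. *)
Lemma palm_lip (Lp M : R) (G : 'rV[R]_K -> R) (dl : R) (q : nat) (e : R) :
  0 <= Lp -> lipv Lp G -> (forall v, `|G v| <= M) -> 0 < dl -> 0 < e ->
  \forall n \near \oo,
    `| n.+1%:R * Rintegral P setT
         (fun w => G (zv dl (pat dl q K (xi w))) * (pts (xi w) (- mesh R n) 0)%:R)
       - Rintegral P0 setT (fun w => G (minv (q%:R * dl) (xvec K (xi0 w)))) |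
    <= Lp * (K%:R * (2 * dl)) + e.
Proof.
move=> Lp0 GL GM dl0 e0.
have cv := @palm_cvg _ _ _ _ _ xi_pp xi_stat xi_int _ _ _ _ xi0_palm dl q K (ltW dl0)
  (fun e => G (zv dl e)).
have h : `|Rintegral P0 setT (fun w => G (zv dl (pat dl q K (xi0 w)))) -
   Rintegral P0 setT (fun w => G (minv (q%:R * dl) (xvec K (xi0 w))))| <= Lp * (K%:R * (2 * dl)).
  rewrite -[leRHS](Rintegral_cst_prob P0).
  apply: Rintegral_dist_ae.
  - apply: (integ_bounded measurableT (Pfin P0) _ (fun w _ => GM _)).
    have := cmeas_measurable (fun e => G (zv dl e)) (cmeas_pat0 xi0_palm dl (q := q) (K := K)); exact.
  - apply: (integ_bounded measurableT (Pfin P0) _ (fun w _ => GM _)).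
    apply: (measurable_xvec (g := fun v => G (minv (q%:R * dl) v)) xi0_palm.1).
    exact: (lipv_continuous Lp0 (lipv_cap _ Lp0 GL)).
  - exact: integ_cst (Pfin P0).
  - by move=> _; rewrite !mulr_ge0// ltW.
  apply: filterS (palm_right_infinite xi_pp xi_stat xi_simple xi_int xi0_palm) => w inf.
  apply: lipv_near => // k; rewrite [minv _ _ _ _]mxE [xvec _ _ _ _]mxE.
  by apply: zv_located => //; apply: xk_located => //; rewrite mulr_ge0// ltW.
move: cv => /cvgr_dist_le/(_ _ e0); apply: filterS => n; rewrite distrC => hn.
apply: (le_trans (ler_distD (Rintegral P0 setT (fun w => G (zv dl (pat dl q K (xi0 w))))) _ _)).
by rewrite addrC; apply: lerD.
Qed.

End LipschitzPalm.

(** * The sequence and its counting function *)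

Lemma near_pinfty_ge (R : realType) (A : R) : \forall x \near +oo, A <= x.
Proof. by apply: nbhs_pinfty_ge; exact: num_real. Qed.

Lemma near_pinfty_gt (R : realType) (A : R) : \forall x \near +oo, A < x.
Proof. by apply: nbhs_pinfty_gt; exact: num_real. Qed.

Section Sequence.
Context (R : realType) (c : nat -> R).
Hypothesis c_pos : forall n, 0 < c n.
Hypothesis c_nondecr : forall m n, (m <= n)%N -> c m <= c n.
Hypothesis Nc_equiv : ((Ncount c T * (T^-1)%:E)%E @[T --> +oo]) --> 1%E.

(** If [c] were bounded, [Ncount] would be infinite from some T on, whereas the ratio is eventually
    finite. *)
Lemma c_unbounded (T : R) : exists n, T < c n.
Proof.
apply: contrapT => /forallNP h.
have cT n : c n <= T by rewrite leNgt; apply/negP/h.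
have Ny T' : T <= T' -> Ncount c T' = +oo%E.
  move=> TT'; rewrite /Ncount (_ : [set n | _] = setT).
    by rewrite /counting asboolF//; exact: infinite_nat.
  by apply/seteqP; split => // n _ /=; rewrite in_itv/= c_pos (le_trans (cT n)).
have /fine_cvgP[[M [Mr hM]] _] := Nc_equiv.
pose T' := Num.max (Num.max T M) 0 + 1.
have : ((Ncount c T' * (T'^-1)%:E)%E \is a fin_num).
  apply: hM; rewrite /T'; have : M <= Num.max (Num.max T M) 0 by rewrite !le_max lexx orbT.
  by lra.
rewrite Ny; last first.
  rewrite /T'; have : T <= Num.max (Num.max T M) 0 by rewrite !le_max lexx.
  by lra.
rewrite gt0_mulye//= lte_fin invr_gt0 /T'.
have h0 : 0 <= Num.max (Num.max T M) 0 by rewrite le_max lexx orbT.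
by lra.
Qed.

(** Indices start at 0, so the first index beyond T is the number of terms up to T. *)
Definition Nc (T : R) : nat := ex_minn (c_unbounded T).

Lemma NcP n (T : R) : (n < Nc T)%N = (c n <= T).
Proof.
rewrite /Nc; case: ex_minnP => m Tm hm; apply/idP/idP => [nm|cn].
  by rewrite leNgt; apply/negP => /hm; lia.
rewrite ltnNge; apply/negP => /c_nondecr mn; move: Tm; rewrite ltNge.
by rewrite (le_trans mn cn).
Qed.

Lemma Nc_le (S T : R) : S <= T -> (Nc S <= Nc T)%N.
Proof.
move=> ST; rewrite leqNgt; apply/negP; rewrite NcP => h.
by have := NcP (Nc T) T; rewrite ltnn (le_trans h ST).
Qed.

Lemma NcountE (T : R) : Ncount c T = (Nc T)%:R%:E.
Proof.
rewrite /Ncount (_ : [set n | _] = `I_(Nc T)).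
  by rewrite /counting asboolT // (card_fset_set (card_eqxx _)).
by apply/seteqP; split => n /=; rewrite in_itv/= c_pos NcP.
Qed.

Lemma Nc_cvg : (Nc T)%:R / T @[T --> +oo] --> (1 : R).
Proof.
have /fine_cvgP[_] := Nc_equiv.
by apply: cvg_trans; apply: near_eq_cvg; near=> T; rewrite /= NcountE.
Unshelve. all: by end_near.
Qed.

Lemma Nc_shift_cvg (r : R) : (Nc (T + r))%:R / T @[T --> +oo] --> (1 : R).
Proof.
have h1 : (Nc (T + r))%:R / (T + r) @[T --> +oo] --> (1 : R).
  have : T + r @[T --> +oo] --> (+oo : set_system R).
    by apply/cvgryPge => A; near=> T; rewrite -lerBlDr; near: T; exact: near_pinfty_ge.
  move=> Tr; exact: (@cvg_comp _ _ _ (fun T => T + r) (fun S => (Nc S)%:R / S) _ _ _ Tr Nc_cvg).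
have h2 : 1 + r / T @[T --> +oo] --> (1 : R).
  rewrite -[X in _ --> X]addr0; apply: cvgD; first exact: cvg_cst.
  rewrite -(mulr0 r); apply: cvgMl_tmp; apply/gtr0_cvgV0; last exact: cvg_id.
  exact: (@near_pinfty_gt R 0).
have h3 : (Nc (T + r))%:R / (T + r) * (1 + r / T) @[T --> +oo] --> (1 : R).
  by rewrite -[X in _ --> X]mulr1; exact: cvgM.
move: h3; apply: cvg_trans; apply: near_eq_cvg; near=> T; rewrite /=.
have T0 : T != 0 by rewrite gt_eqF//; near: T; exact: near_pinfty_gt.
have Tr0 : T + r != 0.
  by rewrite gt_eqF// -ltrBlDr sub0r; near: T; exact: near_pinfty_gt.
by field; rewrite T0 Tr0.
Unshelve. all: by end_near.
Qed.

Lemma xiT_sum (t b : R) (B : set R) (M : nat) :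
  (forall x, B x -> x <= b) -> (Nc (t + b)%R <= M)%N ->
  xiT c t B = (\sum_(n < M) (\1_B (c n - t) : R))%:E.
Proof.
move=> Bb NM; rewrite /xiT /= /mseries (nneseries_split 0 M); last by move=> k _; exact: measure_ge0.
rewrite add0n big_mkord [X in (_ + X)%E](_ : _ = 0%E).
  by rewrite adde0 -sumEFin; apply: eq_bigr => n _; rewrite /dirac.
apply: eseries0 => k Mk _; rewrite /= /dirac indicE memNset// => /Bb h.
have : c k <= t + b by lra.
by rewrite -NcP; lia.
Qed.

Lemma xiT_counting (t : R) : is_counting_measure (xiT c t).
Proof.
move=> B mB [r Br]; exists (\sum_(n < Nc (t + r)%R) nat_of_bool ((c n - t)%R \in B))%N.
rewrite (@xiT_sum t r B (Nc (t + r)))//.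
  by rewrite natr_sum; congr (_%:E); apply: eq_bigr => n _; rewrite indicE.
by move=> x /Br /=; rewrite in_itv/= => /andP[].
Qed.

Lemma xiT_pp : @point_process R _ R (xiT c).
Proof.
split; first exact: xiT_counting.
move=> B mB; rewrite /xiT /= /mseries.
have := @ge0_emeasurable_sum _ R R setT (fun n t => (\d_(c n - t) B : \bar R)) xpredT.
apply => [k x _ _|k _]; first exact: measure_ge0.
rewrite /dirac; apply/measurable_EFinP.
apply: (measurableT_comp (f := \1_B : R -> R)); first exact: measurable_indic.
exact: measurable_funB.
Qed.

Lemma pts_xiT_sum (t a b : R) (M : nat) : (Nc (t + b)%R <= M)%N ->
  pts (xiT c t) a b = (\sum_(n < M) nat_of_bool (a < c n - t <= b)%R)%N.
Proof.
move=> NM; rewrite /pts (@xiT_sum t b _ M)//=; last first.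
  by move=> x /=; rewrite in_itv/= => /andP[].
rewrite -[RHS](natrK (R := R)) natr_sum; congr Num.truncn.
apply: eq_bigr => n _; rewrite indicE; congr ((nat_of_bool _)%:R).
by apply/idP/idP => [/set_mem/=|h]; [|apply/mem_set => /=]; rewrite in_itv.
Qed.

Lemma pts_xiT (t a b : R) : a <= b -> pts (xiT c t) a b = (Nc (t + b)%R - Nc (t + a)%R)%N.
Proof.
move=> ab; rewrite (pts_xiT_sum a (leqnn (Nc (t + b)))).
have NN : (Nc (t + a)%R <= Nc (t + b)%R)%N by apply: Nc_le; rewrite lerD2l.
have E : (Nc (t + b)%R = \sum_(n < Nc (t + b)%R) (n < Nc (t + a)%R) + \sum_(n < Nc (t + b)%R) nat_of_bool (a < c n - t <= b)%R)%N.
  rewrite -big_split/= -[LHS]card_ord -sum1_card; apply: eq_bigr => n _.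
  have := ltn_ord n; rewrite !NcP => nb.
  have -> : c n - t <= b by rewrite lerBlDl.
  by rewrite andbT ltrBrDl; case: leP.
by move: E; rewrite sum_ltn_ord (minn_idPl NN); move: (\sum_(n < _) _)%N => s; lia.
Qed.

(** With ties, [c n <= t < c n.+1] selects the last index of the tie; exactly n+1 terms are then at
    most t, and the (k+1)-st beyond t has index n+k+1. *)
Lemma located_xiT (t b : R) n k : 0 <= b -> c n <= t < c n.+1 ->
  located (xiT c t) k b (Num.min (c (n + k.+1)%N - t) b).
Proof.
move=> b0 /andP[nt tn].
have Nt : Nc t = n.+1.
  by apply/eqP; rewrite eqn_leq NcP nt andbT leqNgt NcP -ltNge.
have cntE x : 0 <= x -> (k.+1%:R%:E <= xiT c t `]0%R, x]%classic)%E = (c (n + k.+1)%N <= t + x).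
  move=> x0; rewrite ptsE; last exact: xiT_counting.
  rewrite lee_fin ler_nat pts_xiT// addr0 Nt -NcP.
  have : (n.+1 <= Nc (t + x)%R)%N by rewrite -Nt; apply: Nc_le; lra.
  by lia.
have tk : t < c (n + k.+1)%N by apply: (lt_le_trans tn); apply: c_nondecr; lia.
split.
- by rewrite le_min ge_min lexx orbT b0 subr_ge0 ltW.
- move=> x /andP[x0]; rewrite lt_min => /andP[xc _].
  by rewrite cntE ?(ltW x0)// -ltNge; lra.
- move=> x; rewrite gt_min => /andP[/orP[h|h] xb]; last by exfalso; lra.
  by rewrite cntE; lra.
Qed.

Lemma partial_sum_dist (a : nat -> R) (M : R) (m n : nat) : (forall i, `|a i| <= M) ->
  `|\sum_(i < m) a i - \sum_(i < n) a i| <= M * `|m%:R - n%:R|.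
Proof.
move=> aM; wlog mn : m n / (m <= n)%N.
  move=> H; have [/H//|/ltnW/H] := leqP m n.
  by rewrite distrC => /le_trans; apply; rewrite [`|n%:R - _|]distrC.
rewrite distrC [`|_ - n%:R|]distrC -(subnKC mn) big_split_ord/= addrAC subrr add0r.
rewrite natrD addrAC subrr add0r (le_trans (ler_norm_sum _ _ _))//.
apply: (@le_trans _ _ (\sum_(i < n - m) M)); first by apply: ler_sum.
by rewrite sumr_const card_ord ger0_norm// mulr_natr.
Qed.

Lemma avg_nat_real (a : nat -> R) (l r : R) :
  N%:R^-1 * \sum_(n < N) a n @[N --> \oo] --> l ->
  T^-1 * \sum_(n < Nc (T + r)) a n @[T --> +oo] --> l.
Proof.
move=> al.
have Ny : Nc (T + r) @[T --> +oo] --> \oo.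
  apply/cvgnyPge => A; near=> T.
  apply: ltnW; rewrite NcP -lerBlDr; near: T; exact: near_pinfty_ge.
have h : (Nc (T + r))%:R / T * ((Nc (T + r))%:R^-1 * \sum_(n < Nc (T + r)) a n)
    @[T --> +oo] --> l.
  rewrite -[X in _ --> X]mul1r; apply: cvgM; first exact: Nc_shift_cvg.
  exact: (@cvg_comp _ _ _ (fun T => Nc (T + r)) (fun N => N%:R^-1 * \sum_(n < N) a n) _ _ _ Ny al).
move: h; apply: cvg_trans; apply: near_eq_cvg; near=> T; rewrite /=.
have N0 : (Nc (T + r))%:R != 0 :> R.
  rewrite pnatr_eq0 -lt0n NcP -lerBlDr; near: T; exact: near_pinfty_ge.
have T0 : T != 0 by rewrite gt_eqF//; near: T; exact: near_pinfty_gt.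
by field; rewrite T0 N0.
Unshelve. all: by end_near.
Qed.

Lemma cvg_natr : (n%:R : R) @[n --> \oo] --> +oo.
Proof. by apply/cvgryPge => A; exact: nbhs_infty_ger. Qed.

(** The two sums differ by |N - [Nc] N| bounded terms, which is o(N). *)
Lemma avg_real_nat (a : nat -> R) (M : R) : (forall i, `|a i| <= M) ->
  N%:R^-1 * \sum_(n < N) a n - N%:R^-1 * \sum_(n < Nc N%:R) a n @[N --> \oo] --> (0 : R).
Proof.
move=> aM.
have h : M * `|1 - (Nc N%:R)%:R / N%:R| @[N --> \oo] --> (0 : R).
  rewrite -(mulr0 M); apply: cvgMl_tmp; rewrite -(normr0 R) -[in X in `|X|](subrr (1 : R)).
  apply: cvg_norm; apply: cvgB; first exact: cvg_cst.
  exact: (@cvg_comp _ _ _ (fun N : nat => N%:R : R) (fun S => (Nc S)%:R / S) _ _ _ cvg_natr Nc_cvg).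
apply: norm_cvg0; apply: (squeeze_cvgr _ (@cvg_cst _ (0:R) _ _ _) h).
near=> N; rewrite normr_ge0/= -mulrBr normrM.
have N0 : (0 : R) < N%:R by rewrite ltr0n; near: N; exact: nbhs_infty_gt.
rewrite gtr0_norm ?invr_gt0// mulrC ler_pdivrMr// (le_trans (partial_sum_dist _ _ aM))//.
have := partial_sum_dist 0 1 aM => /(le_trans (normr_ge0 _)).
rewrite sub0r normrN normr1 mulr1 => M0.
rewrite -mulrA ler_wpM2l// -[X in _ <= _ * X](gtr0_norm N0) -normrM mulrBl mul1r.
by rewrite divfK// gt_eqF.
Unshelve. all: by end_near.
Qed.

End Sequence.

(** * Vaguely continuous functions and cell counts *)

Section VagueCells.
Context (R : realType).
Implicit Types (nu mu : {measure set R -> \bar R}) (f : R -> R).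

Lemma Cc_unif f (e : R) : Cc f -> 0 < e ->
  exists2 h : R, 0 < h & forall x y, `|x - y| <= h -> `|f x - f y| <= e.
Proof.
move=> [fc [r fr]] e0.
pose p := `|r| + 1.
have key (x : R) : \forall s \near x & h \near (0 : R)^'+,
    forall z : R, `|z - s| <= h -> `|f z - f s| <= e.
  have e2 : 0 < e / 2 by rewrite divr_gt0.
  have [d /= d0 hd] : \forall y \near x, `|f x - f y| < e / 2.
    by have := fc x => /cvgr_dist_lt/(_ _ e2).
  have d2 : 0 < d / 2 by rewrite divr_gt0.
  have dd : d / 2 < d by lra.
  near=> s h => z zs.
  have xs : `|x - s| < d / 2 by near: s; exact: cvgr_dist_lt.
  have hd2 : h < d / 2 by near: h; exact: nbhs_right_lt.
  have h1 : `|f x - f s| < e / 2 by apply: hd; exact: (lt_trans xs).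
  have h2 : `|f x - f z| < e / 2.
    apply: hd => /=; apply: (le_lt_trans (ler_distD s _ _)).
    rewrite [`|s - z|]distrC [ltRHS](splitr d); apply: ltr_leD => //.
    exact: (le_trans zs (ltW hd2)).
  rewrite (le_trans (ler_distD (f x) _ _))// [`|f z - _|]distrC [leRHS](splitr e).
  by apply: lerD; exact: ltW.
have := @segment_compact R (- (p + 1)) (p + 1); rewrite compact_near_coveringP.
move=> /(_ R (0^'+) (fun h s => forall z, `|z - s| <= h -> `|f z - f s| <= e)) [].
  by move=> x _; exact: key.
move=> d /= d0 hd.
(* The bound 1 settles large y: if |y| > p + 1 then |x| > p, and both values vanish. *)
have m0 : 0 < Num.min (d / 2) 1 by rewrite lt_min ltr01 divr_gt0.
exists (Num.min (d / 2) 1) => // x y; rewrite le_min => /andP[xd x1].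
have [yK|yK] := leP `|y| (p + 1).
  apply: (hd (d / 2)) => //=.
  - by rewrite sub0r normrN gtr0_norm; lra.
  - by lra.
  - by rewrite in_itv/= -ler_norml.
have rr := ler_norm r.
have yx := ler_distD x y 0; rewrite !subr0 distrC in yx.
by rewrite !fr ?subrr ?normr0 ?(ltW e0)//; rewrite /p in yK; lra.
Unshelve. all: by end_near.
Qed.

Lemma Cc_bounded f : Cc f -> exists2 M : R, 0 <= M & forall x, `|f x| <= M.
Proof.
move=> [fc [r fr]].
have nr : - `|r| <= `|r| by have := normr_ge0 r; lra.
have [|x _ hx] := @EVT_max R (fun x => `|f x|) _ _ nr.
  apply: continuous_subspaceT => y; apply: continuous_comp; first exact: fc.
  exact: norm_continuous.
exists `|f x| => // y; have [yr|yr] := leP `|y| `|r|.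
  by apply: hx; rewrite in_itv/= -ler_norml.
by rewrite fr ?normr0//; apply: le_lt_trans yr; exact: ler_norm.
Qed.

Lemma integ_Cc nu f a b : is_counting_measure nu -> Cc f ->
  integ nu `]a, b]%classic f.
Proof.
move=> cn fC; have [M _ fM] := Cc_bounded fC.
have mab : measurable (`]a, b]%classic : set R) by [].
apply: (@integ_bounded _ _ _ nu _ mab f M) => //; first by rewrite ptsE// ltry.
apply: measurable_funTS; apply: continuous_measurable_fun; exact: fC.1.
Qed.

Lemma Rintegral_grid nu f n s m : is_counting_measure nu -> Cc f ->
  Rintegral nu `]s, s + gpt R n m]%classic f =
  \sum_(j < m) Rintegral nu `]s + gpt R n j, s + gpt R n j.+1]%classic f.
Proof.
move=> cn fC; elim: m => [|m IH].
  by rewrite big_ord0 /gpt mul0r addr0 set_itvoc0 Rintegral_set0.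
have l1 : s <= s + gpt R n m by rewrite lerDl gpt_ge0.
have l2 : s + gpt R n m <= s + gpt R n m.+1 by rewrite lerD2l gpt_le.
have E : `]s, s + gpt R n m.+1]%classic =
    `]s, s + gpt R n m] `|` `]s + gpt R n m, s + gpt R n m.+1].
  by rewrite -itv_bndbnd_setU// bnd_simp.
rewrite big_ord_recr/= -IH {1}E Rintegral_setU//.
- by rewrite -E; exact: integ_Cc.
- apply/disj_setPS => x [/=]; rewrite !in_itv/=; lra.
Qed.

(** Cells of mesh 1/(n+1) covering ]-(n+1), n+1], so that resolution and range grow together. *)
Definition ncell (n : nat) : nat := (2 * (n.+1 * n.+1))%N.

Definition cpt (n j : nat) : R := - n.+1%:R + gpt R n j.

Definition cellfam (n : nat) (nu : set R -> \bar R) : {ffun 'I_(ncell n) -> nat} :=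
  fam (fun i : 'I_(ncell n) => cpt n i) (fun i => cpt n i.+1) nu.

Lemma cpt_full n : cpt n (ncell n) = n.+1%:R.
Proof.
rewrite /cpt /gpt /ncell !natrM -!mulrA mesh_mul mulr1; lra.
Qed.

Lemma cptS n j : cpt n j.+1 = cpt n j + mesh R n.
Proof. by rewrite /cpt gptS addrA. Qed.

Lemma cpt_le n i j : (i <= j)%N -> cpt n i <= cpt n j.
Proof. by move=> ij; rewrite lerD2l gpt_le. Qed.

Definition near0 (p : R) n j : nat := nat_of_bool (`|cpt n j.+1| <= p)%R.

(** The margin 1 on the left covers a cell of which only the right end lies in [-p, p]: the mesh is
    at most 1. *)
Lemma sum_near_cells nu n (p : R) : is_counting_measure nu ->
  (\sum_(j < ncell n) near0 p n j * pts nu (cpt n j) (cpt n j.+1)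
    <= pts nu (- (p + 1))%R p)%N.
Proof.
move=> cn.
suff h k : (\sum_(j < k) near0 p n j * pts nu (cpt n j) (cpt n j.+1)
    <= pts nu (- (p + 1))%R (Num.min (cpt n k) p))%N.
  by apply: (leq_trans (h _)); apply: pts_le => //; rewrite ge_min lexx orbT.
elim: k => [|k IH]; first by rewrite big_ord0.
rewrite big_ord_recr/= {2}/near0; case: ler_normlP => [[h1 h2]|_]; last first.
  rewrite mul0n addn0 (leq_trans IH)//; apply: pts_le => //.
  by rewrite le_min !ge_min lexx orbT andbT cpt_le.
have m1 : mesh R n <= 1 by rewrite invf_le1// ler1n.
have c1 : cpt n k <= cpt n k.+1 by exact: cpt_le.
have c2 := cptS n k.
have m2 := mesh_gt0 R n.
rewrite mul1n (min_l h2) (@pts_cat _ nu (- (p + 1)) (cpt n k))//; last by lra.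
by rewrite leq_add2r (leq_trans IH)//; apply: pts_le => //; rewrite ge_min lexx.
Qed.

(** Each cell errs by at most e times its count, and by nothing if it misses the support. The radius
    is p + 1 because a cell meeting [-p, p] may have its right end outside, within one mesh. *)
Lemma Cc_sum_cells nu f n (p e h : R) : is_counting_measure nu -> Cc f ->
  (forall x, p < `|x| -> f x = 0) -> 0 <= e ->
  (forall x y, `|x - y| <= h -> `|f x - f y| <= e) ->
  mesh R n <= h -> p < n.+1%:R ->
  `|Rintegral nu setT f - \sum_(j < ncell n) f (cpt n j.+1) * (pts nu (cpt n j) (cpt n j.+1))%:R|
   <= e * (\sum_(j < ncell n) near0 (p + 1)%R n j * pts nu (cpt n j) (cpt n j.+1))%:R.
Proof.
move=> cn fC fp e0 fh nh pn.
have -> : Rintegral nu setT f = Rintegral nu `]- n.+1%:R, - n.+1%:R + gpt R n (ncell n)]%classic f.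
  rewrite [RHS]Rintegral_mkcond; congr (Rintegral _ _ _); apply/funext => x.
  rewrite patchE; case: ifPn => // /negP xn; apply: fp; rewrite ltNge; apply/negP => xp.
  apply: xn; apply/mem_set; have := cpt_full n; rewrite /cpt /= => ->.
  by move: xp; rewrite in_itv/= ler_norml; lra.
rewrite Rintegral_grid// -sumrB natr_sum mulr_sumr (le_trans (ler_norm_sum _ _ _))//.
apply: ler_sum => j _; rewrite -/(cpt n j) -/(cpt n j.+1).
pose J : set R := `]cpt n j, cpt n j.+1]%classic.
have mJ : measurable J by exact: measurable_itv.
have fJ : (nu J < +oo)%E by rewrite /J ptsE// ltry.
have cstE k : Rintegral nu J (fun=> k) = k * (pts nu (cpt n j) (cpt n j.+1))%:R.
  by rewrite (Rintegral_cst _ mJ) /J ptsE.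
rewrite -cstE natrM mulrA -cstE; apply: Rintegral_dist => //.
- exact: integ_Cc.
- exact: integ_cst mJ _ fJ.
- exact: integ_cst mJ _ fJ.
move=> x; rewrite /J /= in_itv/= cptS => /andP[x1 x2].
have m2 := mesh_gt0 R n.
have m1 : mesh R n <= 1 by rewrite invf_le1// ler1n.
have xh : `|x - (cpt n j + mesh R n)| <= mesh R n.
  by rewrite ler_norml; lra.
rewrite /near0 cptS; case: (leP `|cpt n j + mesh R n| (p + 1)) => [_|big].
  by rewrite mulr1 fh// (le_trans xh).
have := ler_distD x (cpt n j + mesh R n) 0; rewrite !subr0 distrC => tri.
by rewrite !fp ?subrr ?normr0 ?mulr0//; lra.
Qed.

(** The rank n does not depend on [mu]: equality of cell counts also bounds the mass of [mu] near
    the support of [f] by that of [nu]. *)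
Lemma Cc_same_cells nu f (e : R) : is_counting_measure nu -> Cc f -> 0 < e ->
  \forall n \near \oo, forall mu, is_counting_measure mu -> cellfam n mu = cellfam n nu ->
    `|Rintegral mu setT f - Rintegral nu setT f| < e.
Proof.
move=> cn fC e0; have [fc [r fr]] := fC; pose p := `|r|.
have fp x : p < `|x| -> f x = 0.
  by move=> px; apply: fr; apply: le_lt_trans px; exact: ler_norm.
pose W := (pts nu (- (p + 1 + 1)) (p + 1))%:R : R.
have W0 : 0 <= W by exact: ler0n.
pose e1 := e / (2 * W + 1).
have q0 : 0 < 2 * W + 1 by rewrite ltr_wpDl// mulr_ge0.
have e10 : 0 < e1 by rewrite divr_gt0.
have [h h0 hh] := Cc_unif fC e10.
near=> n => mu cm same.
have nh : mesh R n <= h.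
  apply: ltW; near: n; have := @mesh_cvg0 R => /cvgr_dist_lt/(_ _ h0).
  by apply: filterS => n; rewrite sub0r normrN gtr0_norm ?mesh_gt0.
have pn : p < n.+1%:R.
  have : (Num.truncn p <= n)%N by near: n; exact: nbhs_infty_ge.
  by move=> pn; apply: (lt_le_trans (truncnS_gt _)); rewrite ler_nat.
have b1 := Cc_sum_cells cm fC fp (ltW e10) hh nh pn.
have b2 := Cc_sum_cells cn fC fp (ltW e10) hh nh pn.
have sj (j : 'I_(ncell n)) : pts mu (cpt n j) (cpt n j.+1) = pts nu (cpt n j) (cpt n j.+1).
  by have /ffunP/(_ j) := same; rewrite !ffunE.
have eq1 : \sum_(j < ncell n) f (cpt n j.+1) * (pts mu (cpt n j) (cpt n j.+1))%:R =
    \sum_(j < ncell n) f (cpt n j.+1) * (pts nu (cpt n j) (cpt n j.+1))%:R.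
  by apply: eq_bigr => j _; rewrite sj.
have eq2 : (\sum_(j < ncell n) near0 (p + 1)%R n j * pts mu (cpt n j) (cpt n j.+1) =
    \sum_(j < ncell n) near0 (p + 1)%R n j * pts nu (cpt n j) (cpt n j.+1))%N.
  by apply: eq_bigr => j _; rewrite sj.
rewrite eq1 eq2 in b1.
have := sum_near_cells n (p + 1) cn; rewrite -(ler_nat R) -/W => b3.
have b4 := ler_wpM2l (ltW e10) b3.
have E : e1 * (2 * W + 1) = e by rewrite divfK// gt_eqF.
rewrite distrC in b2.
apply: (le_lt_trans (ler_distD (\sum_(j < ncell n) f (cpt n j.+1) * (pts nu (cpt n j) (cpt n j.+1))%:R) _ _)).
apply: (le_lt_trans (lerD (le_trans b1 b4) (le_trans b2 b4))).
by rewrite -E; lra.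
Unshelve. all: by end_near.
Qed.

Variable F : {measure set R -> \bar R} -> R.
Hypotheses (Fc : vague_continuous F) (Fb : bounded_on_counting F).

(** The best lower bound of [F] by a function of the cell counts. Such functions are measurable, and
    [Flow_cvg] passes this on to [F]. *)
Definition Flow n (v : {ffun 'I_(ncell n) -> nat}) : R :=
  inf [set F mu | mu in [set mu | is_counting_measure mu /\ cellfam n mu = v]].

Lemma Flow_le n nu : is_counting_measure nu -> Flow (cellfam n nu) <= F nu.
Proof.
move=> cn; have [M FM] := Fb; apply: ge_inf; last by exists nu.
exists (- M) => _ [mu [cm _] <-]; have := FM mu cm; rewrite ler_norml; lra.
Qed.

Lemma Flow_bounded : exists2 M, 0 <= M & forall n v, `|Flow (n := n) v| <= M.
Proof.
have [M FM] := Fb; exists `|M| => // n v; rewrite /Flow; set S := (X in inf X).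
have [S0|/set0P S0] := eqVneq S set0; first by rewrite S0 inf0 normr0.
have [x0 Sx0] := S0; have [mu [cm _] mux] := Sx0.
have M0 := ler_norm M.
rewrite ler_norml; apply/andP; split.
  apply: lb_le_inf => // _ [mu' [cm' _] <-]; have := FM mu' cm'; rewrite ler_norml; lra.
apply: (@le_trans _ _ x0).
  apply: ge_inf => //; exists (- M) => _ [mu' [cm' _] <-].
  by have := FM mu' cm'; rewrite ler_norml; lra.
by rewrite -mux; have := FM mu cm; rewrite ler_norml; lra.
Qed.

(** A vague neighbourhood of [nu] is given by finitely many test functions, so by [Cc_same_cells] it
    contains every counting measure with the same counts in a fine enough grid. *)
Lemma Flow_cvg nu : is_counting_measure nu ->
  Flow (cellfam n nu) @[n --> \oo] --> F nu.
Proof.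
move=> cn; apply/cvgrPdist_le => e e0.
have [fs [delta [fsC d0 hF]]] := Fc cn e0.
have hfs : \forall n \near \oo, forall mu, is_counting_measure mu ->
    cellfam n mu = cellfam n nu -> forall f, f \in fs ->
    `|fine (\int[mu]_x (f x)%:E) - fine (\int[nu]_x (f x)%:E)| < delta.
  move: fsC {hF}; elim: fs => [|f fs IH] fsC; first by near=> n => mu _ _ f; rewrite in_nil.
  have h1 := Cc_same_cells cn (fsC f (mem_head _ _)) d0.
  have h2 := IH (fun g gfs => fsC g (mem_behead (s := f :: fs) gfs)).
  near=> n => mu cm same g; rewrite in_cons => /orP[/eqP ->|gfs].
    by move: mu cm same; near: n; exact: h1.
  by move: mu cm same g gfs; near: n; exact: h2.
near=> n.
have := Flow_le n cn => h1; rewrite ger0_norm ?subr_ge0// lerBlDr -lerBlDl.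
apply: lb_le_inf; first by exists (F nu), nu.
move=> _ [mu [cm same] <-].
have : `|F mu - F nu| < e.
  by apply: hF => //; move: mu cm same; near: n; exact: hfs.
by rewrite ltr_norml; lra.
Unshelve. all: by end_near.
Qed.

Lemma measurable_vague d (T : measurableType d) (eta : T -> {measure set R -> \bar R}) :
  point_process eta -> measurable_fun setT (fun w => F (eta w)).
Proof.
move=> ep; apply: (@measurable_fun_cvg _ _ _ _ (fun n w => Flow (cellfam n (eta w)))).
  move=> n; exact: (cmeas_measurable (@Flow n) (cmeas_fam _ _ ep)).
by move=> w _; apply: Flow_cvg; exact: ep.1.
Qed.

End VagueCells.

(** * Continuous approximation of interval counts *)

Section Trapezoid.
Context (R : realType).
Implicit Types (nu : {measure set R -> \bar R}) (a b h x : R).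

(** The trapezoid equal to 1 on [a, b] and to 0 at distance h or more, linear in between. *)
Definition trap a b h x : R := Num.max 0 (1 - h^-1 * Num.max 0 (Num.max (a - x) (x - b))).

Lemma trap_in a b h x : a <= x <= b -> trap a b h x = 1.
Proof.
move=> /andP[ax xb]; rewrite /trap.
have -> : Num.max 0 (Num.max (a - x) (x - b)) = 0 by rewrite max_l// ge_max !subr_le0 ax xb.
by rewrite mulr0 subr0 max_r.
Qed.

Lemma trap_out a b h x : 0 < h -> (x <= a - h) || (b + h <= x) -> trap a b h x = 0.
Proof.
move=> h0 xo; rewrite /trap max_l// subr_le0.
have : h <= Num.max 0 (Num.max (a - x) (x - b)).
  by rewrite !le_max; case/orP: xo => ?; apply/orP; right; apply/orP; [left|right]; lra.
by rewrite mulrC ler_pdivlMr// mul1r.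
Qed.

Lemma trap_01 a b h x : 0 < h -> 0 <= trap a b h x <= 1.
Proof.
move=> h0; rewrite /trap le_max lexx/= ge_max ler01/= lerBlDr lerDl mulr_ge0//.
  by rewrite invr_ge0 ltW.
by rewrite le_max lexx.
Qed.

Lemma trap_Cc a b h : 0 < h -> Cc (trap a b h).
Proof.
move=> h0; split; last first.
  exists (`|a| + `|b| + h) => x hx; apply: trap_out => //.
  have := ler_norm a; have := ler_norm (- a); have := ler_norm b; have := ler_norm (- b).
  rewrite !normrN; have := normr_ge0 a; have := normr_ge0 b => p1 p2 p3 p4 p5 p6.
  by move: hx; case: (ler0P x) => hx h1; apply/orP; [left|right]; lra.
have cmax (f g : R -> R) : continuous f -> continuous g -> continuous (fun x => Num.max (f x) (g x)).
  by move=> cf cg x; exact: (@continuous_max R R f g x (cf x) (cg x)).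
have cc (k : R) : continuous (fun _ : R => k) by move=> x; exact: cvg_cst.
have c1 : continuous (fun x : R => a - x).
  by move=> x; apply: cvgB; [exact: cvg_cst|exact: cvg_id].
have c2 : continuous (fun x : R => x - b).
  by move=> x; apply: cvgB; [exact: cvg_id|exact: cvg_cst].
have c3 := cmax _ _ (cc 0) (cmax _ _ c1 c2).
apply: (cmax _ _ (cc 0)) => x; apply: cvgB; first exact: cvg_cst.
by apply: cvgM; [exact: cvg_cst|exact: c3].
Qed.

Lemma Rintegral_indic d (T : measurableType d) (mu : {measure set T -> \bar R}) (D A : set T) :
  measurable D -> measurable A -> A `<=` D ->
  Rintegral mu D (\1_A : T -> R) = fine (mu A).
Proof.
by move=> mD mA AD; rewrite /Rintegral integral_indic// setIidl.
Qed.

Lemma integ_indic d (T : measurableType d) (mu : {measure set T -> \bar R}) (D A : set T) :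
  measurable D -> measurable A -> (mu D < +oo)%E -> integ mu D (\1_A : T -> R).
Proof.
move=> mD mA fD; apply: (@integ_bounded _ _ _ mu _ mD _ 1) => //.
by move=> x _; rewrite indicE; case: (_ \in _); rewrite /= ?normr1 ?normr0.
Qed.

Lemma trap_integral nu a b h : is_counting_measure nu -> 0 < h -> a <= b ->
  `|Rintegral nu setT (trap a b h) - (pts nu a b)%:R| <=
    (pts nu (a - h) a)%:R + (pts nu b (b + h))%:R.
Proof.
move=> cn h0 ab; pose W : set R := `]a - h, b + h]%classic.
have mW : measurable W by exact: measurable_itv.
have fW : (nu W < +oo)%E by rewrite /W ptsE// ltry.
have pE (s t : R) : pts nu s t = pts nu s t by [].
have iE (s t : R) : a - h <= s -> t <= b + h ->
    Rintegral nu W (\1_(`]s, t]%classic) : R -> R) = (pts nu s t)%:R.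
  move=> sa tb; rewrite Rintegral_indic//; first by rewrite ptsE.
  by move=> x; rewrite /W /= !in_itv/=; lra.
have -> : Rintegral nu setT (trap a b h) = Rintegral nu W (trap a b h).
  rewrite [RHS]Rintegral_mkcond; congr (Rintegral _ _ _); apply/funext => x.
  rewrite patchE; case: ifPn => // /negP xn; apply: trap_out => //.
  apply: contra_notT xn; rewrite negb_or -!ltNge => /andP[x1 x2].
  by apply/mem_set; rewrite /W /= in_itv/= x1 ltW.
rewrite -!iE; [|lra|lra|lra|lra|lra|lra].
have ii s t : integ nu W (\1_(`]s, t]%classic) : R -> R) by exact: integ_indic.
rewrite -(RintegralD mW (ii _ _) (ii _ _)); apply: Rintegral_dist => //.
- exact: integ_Cc (trap_Cc _ _ _).
- exact: integD.
move=> x; rewrite /W /= in_itv/= => /andP[x1 x2].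
rewrite !indicE.
have [xa|xa] := leP x a.
  have -> : (x \in `]a - h, a]%classic) by apply/mem_set; rewrite /= in_itv/= x1.
  rewrite memNset ?subr0; last by rewrite /= in_itv/=; lra.
  have := trap_01 a b x h0 => /andP[t0 t1]; rewrite ger0_norm//.
  by rewrite (le_trans t1)// lerDl.
have [xb|xb] := leP x b.
  rewrite mem_set; last by rewrite /= in_itv/= xa.
  by rewrite trap_in ?subrr ?normr0 ?addr_ge0// (ltW xa).
rewrite memNset ?subr0; last by rewrite /= in_itv/=; lra.
have -> : (x \in `]b, b + h]%classic) by apply/mem_set; rewrite /= in_itv/= xb.
have := trap_01 a b x h0 => /andP[t0 t1]; rewrite ger0_norm//.
by rewrite (le_trans t1)// lerDr.
Qed.

End Trapezoid.

(** * Lipschitz extension from integer points *)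

Section InfConvolution.
Context (R : realType).

Lemma inf_dist (K : Type) (p q : K -> R) (m e : R) (k0 : K) :
  (forall k, m <= p k) -> (forall k, m <= q k) -> (forall k, `|p k - q k| <= e) ->
  `|inf (range p) - inf (range q)| <= e.
Proof.
move=> pm qm pq.
have lb (f : K -> R) : (forall k, m <= f k) -> has_lbound (range f).
  by move=> fm; exists m => _ [k _ <-].
rewrite ler_norml; apply/andP; split.
  rewrite lerBrDl addrC; apply: lb_le_inf; first by exists (p k0), k0.
  move=> _ [k _ <-]; have h := pq k; have : inf (range q) <= q k by apply: ge_inf; [exact: lb|exists k].
  by move: h; rewrite ler_norml; lra.
rewrite lerBlDr; rewrite -lerBlDl; apply: lb_le_inf; first by exists (q k0), k0.
move=> _ [k _ <-]; have h := pq k; have : inf (range p) <= p k by apply: ge_inf; [exact: lb|exists k].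
by move: h; rewrite ler_norml; lra.
Qed.

Variables (I : finType) (M : R) (u : {ffun I -> nat} -> R).
Hypotheses (M0 : 0 <= M) (uM : forall k, `|u k| <= M).

Let cost (x : I -> R) (k : {ffun I -> nat}) : R :=
  u k + 2 * M * \sum_i `|(k i)%:R - x i|.

(* A Lipschitz extension of [u] from the integer points to the whole space. *)
Definition uext (x : I -> R) : R := Num.min M (inf (range (cost x))).

Let cost_lb x k : - M <= cost x k.
Proof.
have := uM k; rewrite ler_norml => /andP[h _]; rewrite -[leLHS]addr0 lerD//.
by rewrite mulr_ge0// ?mulr_ge0// sumr_ge0.
Qed.

Lemma uext_bounded x : `|uext x| <= M.
Proof.
rewrite ler_norml ge_min lexx/= le_min; apply/andP; split => //.
apply/andP; split; first by have := M0; lra.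
by apply: lb_le_inf; [exists (cost x [ffun=> 0%N]), [ffun=> 0%N]|move=> _ [k _ <-]].
Qed.

Lemma uext_lip x y : `|uext x - uext y| <= 2 * M * \sum_i `|x i - y i|.
Proof.
rewrite /uext ![Num.min M _]minC (le_trans (min_dist _ _ _))//.
apply: (@inf_dist _ _ _ (- M)) => // [|k]; first exact: [ffun=> 0%N].
rewrite /cost opprD addrACA subrr add0r -mulrBr normrM ger0_norm ?mulr_ge0//.
rewrite ler_wpM2l ?mulr_ge0// -sumrB (le_trans (ler_norm_sum _ _ _))//.
apply: ler_sum => i _; apply: (le_trans (ler_dist_dist _ _)).
by rewrite opprB addrC addrA subrK distrC.
Qed.

(** Origin of the slope [2 * M]: distinct integer points are at l1-distance at least 1 while [u]
    varies by at most [2 * M], so k is its own minimiser. *)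
Lemma uext_nat (k : {ffun I -> nat}) : uext (fun i => (k i)%:R) = u k.
Proof.
have uk := uM k; rewrite ler_norml in uk.
have ck : cost (fun i => (k i)%:R) k = u k.
  by rewrite /cost big1 ?mulr0 ?addr0// => i _; rewrite subrr normr0.
rewrite /uext; have -> : inf (range (cost (fun i => (k i)%:R))) = u k.
  apply/eqP; rewrite eq_le; apply/andP; split.
    apply: ge_inf; last by exists k.
    by exists (- M) => _ [k' _ <-].
  apply: lb_le_inf; first by exists (u k), k.
  move=> _ [k' _ <-]; have [->|kk'] := eqVneq k' k; first by rewrite ck.
  have [i ki] : exists i, k' i != k i.
    apply: contrapT => /forallNP h; move/eqP: kk'; apply; apply/ffunP => i.
    by apply/eqP; apply: contra_notT (h i).
  have i1 : 1 <= \sum_i `|(k' i)%:R - (k i)%:R| :> R.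
    rewrite (bigD1 i)//= -[leLHS]addr0 lerD ?sumr_ge0//.
    move: ki; rewrite neq_ltn => /orP[h|h].
      by rewrite distrC ger0_norm ?subr_ge0 ?ler_nat ?(ltnW h)// lerBrDr addrC natr1 ler_nat.
    by rewrite ger0_norm ?subr_ge0 ?ler_nat ?(ltnW h)// lerBrDr addrC natr1 ler_nat.
  have := uM k'; rewrite ler_norml => uk'.
  have := ler_wpM2l (_ : 0 <= 2 * M) i1 => /(_ ltac:(by rewrite mulr_ge0)).
  by rewrite mulr1 /cost; lra.
by rewrite min_r//; case/andP: uk.
Qed.

End InfConvolution.

(** * From time averages to gaps *)

Section TimeAverage.
Context (R : realType) (c : nat -> R).
Hypothesis c_pos : forall n, 0 < c n.
Hypothesis c_nondecr : forall m n, (m <= n)%N -> c m <= c n.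
Hypothesis Nc_equiv : ((Ncount c T * (T^-1)%:E)%E @[T --> +oo]) --> 1%E.

Notation lam := (@lebesgue_measure R).
Notation NC := (Nc c_pos Nc_equiv).

Lemma measurable_0T (T : R) : measurable (`]0, T]%classic : set (measurableTypeR R)).
Proof. exact: measurable_itv. Qed.

Lemma lam_itv (a b : R) : a <= b -> lam `]a, b]%classic = (b - a)%:E.
Proof.
move=> ab; rewrite lebesgue_measure_itv/= lte_fin.
by case: ltP => // ba; congr (_%:E); lra.
Qed.

Lemma lam_0T_fin (T : R) : (lam `]0%R, T]%classic < +oo)%E.
Proof.
have [T0|T0] := leP 0 T; first by rewrite lam_itv// ltry.
by rewrite set_itv_ge ?measure0// bnd_simp -leNgt ltW.
Qed.

Lemma integ_time (T M : R) (u : R -> R) : measurable_fun setT u -> (forall t, `|u t| <= M) ->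
  integ lam `]0, T]%classic u.
Proof.
move=> mu uM; apply: (@integ_bounded _ _ _ lam _ (measurable_0T T) u M) => //.
- exact: lam_0T_fin.
- exact: measurable_funTS.
Qed.

Lemma Rintegral_time_cst (T k : R) : 0 <= T -> Rintegral lam `]0, T]%classic (fun=> k) = k * T.
Proof.
move=> T0; transitivity (k * fine (lam `]0, T]%classic)).
  exact: Rintegral_cst (measurable_0T T) k.
by rewrite lam_itv// subr0.
Qed.

Lemma time_window_le (T a b x : R) : a <= b ->
  Rintegral lam `]0, T]%classic (fun t : R => (nat_of_bool (a < x - t <= b))%:R) <= b - a.
Proof.
move=> ab; pose A : set (measurableTypeR R) := `[x - b, x - a[%classic.
have mA : measurable A by exact: measurable_itv.
rewrite (_ : (fun t : R => _) = \1_A); last first.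
  apply/funext => t; rewrite indicE; congr ((nat_of_bool _)%:R).
  by apply/idP/idP => [h|/set_mem]; [apply/mem_set|]; rewrite /A /= in_itv/=; lra.
have lA : lam A = (b - a)%:E.
  rewrite /A lebesgue_measure_itv/= lte_fin ltrD2l ltrN2.
  by case: ltP => // ba; congr (_%:E); lra.
have le1 : (lam (A `&` `]0%R, T]%classic) <= (b - a)%:E)%E.
  rewrite -lA; apply: le_measure; rewrite ?inE//.
  exact: (measurableI _ _ mA (measurable_0T T)).
have E : Rintegral lam `]0, T]%classic (\1_A : R -> R) = fine (lam (A `&` `]0, T]%classic)).
  by rewrite /Rintegral (integral_indic lam (measurable_0T T) mA).
rewrite E -lee_fin fineK// ge0_fin_numE; last exact: measure_ge0.
by rewrite (le_lt_trans le1) ?ltry.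
Qed.

Lemma integ_window (T a b x : R) :
  integ lam `]0, T]%classic (fun t : R => (nat_of_bool (a < x - t <= b))%:R).
Proof.
apply: (@integ_time _ 1); last by move=> t; case: (_ && _); rewrite /= ?normr1 ?normr0 ?ler01.
pose A : set R := `[x - b, x - a[%classic.
have mA : measurable A by exact: measurable_itv.
rewrite (_ : (fun t : R => _) = \1_A); first exact: (@measurable_indic _ R R setT A mA).
apply/funext => t; rewrite indicE; congr ((nat_of_bool _)%:R).
by apply/idP/idP => [h|/set_mem]; [apply/mem_set|]; rewrite /A /= in_itv/=; lra.
Qed.

Lemma pts_time_sum (T a b t : R) : t \in `]0, T]%classic ->
  (pts (xiT c t) a b)%:R = \sum_(n < NC (T + b)) (nat_of_bool (a < c n - t <= b))%:R :> R.
Proof.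
move=> /set_mem /=; rewrite in_itv/= => /andP[t0 tT].
rewrite (@pts_xiT_sum _ _ c_pos c_nondecr Nc_equiv t a b (NC (T + b))) ?natr_sum//.
by apply: Nc_le => //; rewrite lerD2r.
Qed.

Lemma integ_pts_time (T a b : R) : integ lam `]0, T]%classic (fun t => (pts (xiT c t) a b)%:R).
Proof.
have : integ lam `]0, T]%classic
    (fun t => \sum_(n < NC (T + b)) (nat_of_bool (a < c n - t <= b))%:R).
  by apply: (integ_sum (measurable_0T T)) => n; exact: integ_window.
apply: eq_integrable; first exact: (measurable_0T T).
by move=> t tT /=; rewrite (pts_time_sum _ _ tT).
Qed.

(** Each term of [c] is counted during a time of at most b - a, and only terms up to T + b are ever
    counted. *)
Lemma Rintegral_pts_time (T a b : R) : a <= b ->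
  Rintegral lam `]0, T]%classic (fun t => (pts (xiT c t) a b)%:R) <= (b - a) * (NC (T + b))%:R.
Proof.
move=> ab; rewrite (eq_Rintegral lam (fun t tT => pts_time_sum a b tT)).
rewrite (Rintegral_sum (measurable_0T T)); last by move=> n; exact: integ_window.
rewrite mulr_natr -[in leRHS](card_ord (NC _)) -sumr_const.
by apply: ler_sum => n _; exact: time_window_le.
Qed.

Lemma avg_pts_near (a b e : R) : a <= b -> 0 < e ->
  \forall T \near +oo, T^-1 * Rintegral lam `]0, T]%classic (fun t => (pts (xiT c t) a b)%:R)
    <= (b - a) + e.
Proof.
move=> ab e0.
have h : (b - a) * ((NC (T + b))%:R / T) @[T --> +oo] --> (b - a).
  rewrite -[X in _ --> X]mulr1; apply: cvgMl_tmp; exact: Nc_shift_cvg.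
have := h => /cvgr_dist_le/(_ _ e0) h1.
near=> T.
have T0 : 0 < T by near: T; exact: near_pinfty_gt.
have := Rintegral_pts_time T ab; rewrite -(ler_pM2l (_ : 0 < T^-1)) ?invr_gt0// => /le_trans; apply.
have : `|b - a - (b - a) * ((NC (T + b))%:R / T)| <= e by near: T; exact: h1.
rewrite ler_norml mulrCA [T^-1 * _]mulrC; lra.
Unshelve. all: by end_near.
Qed.

Lemma measurable_time (C : countType) (u : C -> R) (Z : R -> C) :
  cmeas Z -> measurable_fun setT (fun t : R => u (Z t)).
Proof. by move=> mZ; exact: (cmeas_measurable u mZ). Qed.

Lemma xiTpp : @point_process R _ R (xiT c).
Proof. exact: xiT_pp c_pos c_nondecr Nc_equiv. Qed.

Section FiniteDimensional.
Context d (Omega : measurableType d) (P : probability Omega R).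
Variable xi : Omega -> {measure set R -> \bar R}.
Hypotheses (xi_pp : point_process xi) (xi_int : has_intensity P xi 1).
Hypothesis conv : forall F : {measure set R -> \bar R} -> R,
     vague_continuous F -> bounded_on_counting F ->
     (T^-1 * Rintegral lam `]0%R, T] (fun t => F (xiT c t)))
       @[T --> +oo] --> Rintegral P setT (fun w => F (xi w)).
Variables (I : finType) (a b : I -> R) (M : R) (u : {ffun I -> nat} -> R).
Hypotheses (ab : forall i, a i <= b i) (M0 : 0 <= M) (uM : forall k, `|u k| <= M).

(** A vaguely continuous substitute for [u] of the counts: trapezoid integrals replace the counts,
    and the Lipschitz extension accepts their real values. *)
Let Fh (h : R) (nu : {measure set R -> \bar R}) : R :=
  uext M u (fun i => Rintegral nu setT (trap (a i) (b i) h)).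

Let Fh_cont h : 0 < h -> vague_continuous (Fh h).
Proof.
move=> h0 nu cn e e0; exists [seq trap (a i) (b i) h | i : I], (e / (2 * M * #|I|%:R + 1)).
have q0 : 0 < 2 * M * #|I|%:R + 1 by rewrite ltr_wpDl// !mulr_ge0.
split.
- by move=> f /mapP[i _ ->]; exact: trap_Cc.
- by rewrite divr_gt0.
move=> mu cm hmu; apply: (le_lt_trans (uext_lip M0 uM _ _)).
apply: (@le_lt_trans _ _ (2 * M * (\sum_(i : I) (e / (2 * M * #|I|%:R + 1))))).
  rewrite ler_wpM2l ?mulr_ge0//; apply: ler_sum => i _; apply: ltW; apply: hmu.
  exact: map_f (mem_enum _ _).
rewrite sumr_const -[X in _ * X]mulr_natr.
move: (divfK (lt0r_neq0 q0) e) (divr_gt0 e0 q0); move: (e / _) => x <- x0.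
by lra.
Qed.

Let Fh_bounded h : bounded_on_counting (Fh h).
Proof. by exists M => nu _; exact: uext_bounded. Qed.

Let err h (nu : set R -> \bar R) : R :=
  2 * M * \sum_i ((pts nu (a i - h) (a i))%:R + (pts nu (b i) (b i + h))%:R).

Let Fh_close h (nu : {measure set R -> \bar R}) : 0 < h -> is_counting_measure nu ->
  `|Fh h nu - u (fam a b nu)| <= err h nu.
Proof.
move=> h0 cn; rewrite /Fh -(uext_nat M0 uM) (le_trans (uext_lip M0 uM _ _))//.
rewrite ler_wpM2l ?mulr_ge0//; apply: ler_sum => i _; rewrite ffunE.
exact: trap_integral.
Qed.

(** By [Fh_close] only points within h outside an end of an interval matter. Their expected number
    is 2 h per interval, and [uext] has slope [2 * M]. [T_close] is the same for time averages. *)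
Let E_close h : 0 < h ->
  `|Rintegral P setT (fun w => Fh h (xi w)) - Rintegral P setT (fun w => u (fam a b (xi w)))|
    <= 4 * M * #|I|%:R * h.
Proof.
move=> h0.
have iu : integ P setT (fun w => u (fam a b (xi w))).
  apply: (@integ_bounded _ _ _ P _ measurableT _ M) => //; first exact: Pfin.
  exact: (cmeas_measurable u (cmeas_fam a b xi_pp)).
have iF : integ P setT (fun w => Fh h (xi w)).
  apply: (@integ_bounded _ _ _ P _ measurableT _ M) => //; first exact: Pfin.
    apply: measurable_vague => //; exact: Fh_cont.
  by move=> w _; exact: uext_bounded.
have ip i : integ P setT (fun w => (pts (xi w) (a i - h) (a i))%:R + (pts (xi w) (b i) (b i + h))%:R).
  by apply: integD => //; exact: integ_pts.
have ie : integ P setT (fun w => err h (xi w)).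
  by apply: integZ => //; apply: integ_sum.
apply: (le_trans (Rintegral_dist measurableT iF iu ie _)).
  by move=> w _; apply: Fh_close => //; exact: xi_pp.1.
rewrite /err RintegralZl//; last exact: integ_sum.
rewrite Rintegral_sum// (eq_bigr (fun=> 2 * h)) => [|i _].
  by rewrite sumr_const -mulr_natr; lra.
rewrite RintegralD//; [|exact: integ_pts|exact: integ_pts].
by rewrite !(Rintegral_pts xi_pp xi_int); lra.
Qed.

Let T_close h e : 0 < h -> 0 < e -> \forall T \near +oo,
  `|T^-1 * Rintegral lam `]0, T]%classic (fun t => Fh h (xiT c t)) -
    T^-1 * Rintegral lam `]0, T]%classic (fun t => u (fam a b (xiT c t)))|
    <= 4 * M * #|I|%:R * (h + e).
Proof.
move=> h0 e0.
have hnear : \forall T \near +oo, forall i,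
   (T^-1 * Rintegral lam `]0, T]%classic (fun t => (pts (xiT c t) (a i - h) (a i))%:R) <= h + e) /\
   (T^-1 * Rintegral lam `]0, T]%classic (fun t => (pts (xiT c t) (b i) (b i + h))%:R) <= h + e).
  apply: filter_forall => i.
  have h1 := @avg_pts_near (a i - h) (a i) e (ltac:(lra)) e0.
  have h2 := @avg_pts_near (b i) (b i + h) e (ltac:(lra)) e0.
  near=> T; split.
    by apply: (le_trans (near h1 T _)) => //; lra.
  by apply: (le_trans (near h2 T _)) => //; lra.
near=> T.
have T0 : 0 < T by near: T; exact: near_pinfty_gt.
have mT := measurable_0T T.
have iu : integ lam `]0, T]%classic (fun t => u (fam a b (xiT c t))).
  apply: (@integ_time _ M) => //; exact: (measurable_time u (cmeas_fam a b xiTpp)).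
have iF : integ lam `]0, T]%classic (fun t => Fh h (xiT c t)).
  apply: (@integ_time _ M); last by move=> t; exact: uext_bounded.
  by apply: measurable_vague => //; [exact: Fh_cont|exact: xiTpp].
have ip i : integ lam `]0, T]%classic
   (fun t => (pts (xiT c t) (a i - h) (a i))%:R + (pts (xiT c t) (b i) (b i + h))%:R).
  by apply: integD => //; exact: integ_pts_time.
have ie : integ lam `]0, T]%classic (fun t => err h (xiT c t)).
  by apply: integZ => //; apply: integ_sum.
rewrite -mulrBr normrM gtr0_norm ?invr_gt0//.
apply: (@le_trans _ _ (T^-1 * Rintegral lam `]0, T]%classic (fun t => err h (xiT c t)))).
  rewrite ler_wpM2l ?invr_ge0 ?(ltW T0)//; apply: Rintegral_dist => // t _.
  by apply: Fh_close => //; exact: xiTpp.1.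
rewrite /err RintegralZl//; last exact: integ_sum.
rewrite Rintegral_sum// mulrCA mulr_sumr.
apply: (@le_trans _ _ (2 * M * \sum_(i : I) (2 * (h + e)))); last first.
  by rewrite sumr_const -mulr_natr; lra.
rewrite ler_wpM2l ?mulr_ge0//; apply: ler_sum => i _.
rewrite RintegralD//; [|exact: integ_pts_time|exact: integ_pts_time].
have hT : (T^-1 * Rintegral lam `]0, T]%classic (fun t => (pts (xiT c t) (a i - h) (a i))%:R) <= h + e) /\
   (T^-1 * Rintegral lam `]0, T]%classic (fun t => (pts (xiT c t) (b i) (b i + h))%:R) <= h + e).
  by move: i; near: T; exact: hnear.
rewrite mulrDr; have [q1 q2] := hT.
by apply: (le_trans (lerD q1 q2)); rewrite mulr_natl.
Unshelve. all: by end_near.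
Qed.

Theorem count_average_cvg :
  T^-1 * Rintegral lam `]0, T]%classic (fun t => u (fam a b (xiT c t))) @[T --> +oo]
    --> Rintegral P setT (fun w => u (fam a b (xi w))).
Proof.
apply/cvgrPdist_le => e e0.
pose D := 4 * M * #|I|%:R.
have D0 : 0 <= D by rewrite !mulr_ge0.
(* [E_close] costs D h, [T_close] 2 D h and [conv] e / 4; this h keeps the sum below e. *)
pose h := e / (4 * (D + 1)).
have q0 : 0 < 4 * (D + 1) by lra.
have h0 : 0 < h by rewrite divr_gt0.
have hE : h * (4 * (D + 1)) = e by rewrite divfK// gt_eqF.
have e4 : 0 < e / 4 by rewrite divr_gt0.
have h1 := E_close h0; have h2 := T_close h0 h0.
have h3 := conv (Fh_cont h0) (Fh_bounded h).
move: h3 => /cvgr_dist_le/(_ _ e4) h3.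
near=> T.
have k2 : `|T^-1 * Rintegral lam `]0, T]%classic (fun t => Fh h (xiT c t)) -
    T^-1 * Rintegral lam `]0, T]%classic (fun t => u (fam a b (xiT c t)))| <= D * (h + h).
  by near: T; exact: h2.
have k3 : `|Rintegral P setT (fun w => Fh h (xi w)) -
    T^-1 * Rintegral lam `]0, T]%classic (fun t => Fh h (xiT c t))| <= e / 4.
  by near: T; exact: h3.
move: h1 k2 k3; rewrite -/D !ler_norml => /andP[? ?] /andP[? ?] /andP[? ?].
by apply/andP; split; lra.
Unshelve. all: by end_near.
Qed.

End FiniteDimensional.
End TimeAverage.

(** * Time windows following the terms of the sequence *)

Section GapAverage.
Context (R : realType) (c : nat -> R).
Hypothesis c_pos : forall n, 0 < c n.
Hypothesis c_nondecr : forall m n, (m <= n)%N -> c m <= c n.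
Hypothesis Nc_equiv : ((Ncount c T * (T^-1)%:E)%E @[T --> +oo]) --> 1%E.

Notation lam := (@lebesgue_measure R).
Notation NC := (Nc c_pos Nc_equiv).

Definition gapv (K n : nat) : 'rV[R]_K := \row_(i < K) (c (n + i.+1)%N - c n).

Definition hit (h : R) (nu : set R -> \bar R) : R := (nat_of_bool (0 < pts nu (- h) 0)%N)%:R.

(** The times at which m is the last index with [c m <= t], and t is within h of [c m]. Cutting at
    [c m.+1] makes the windows disjoint; a tied index other than the last gets an empty one. *)
Let L (h : R) (m : nat) (t : R) : R := (nat_of_bool (c m <= t < Num.min (c m + h) (c m.+1)))%:R.

Let L_last h t m : (c m <= t < c m.+1) -> forall m', m' != m -> L h m' t = 0.
Proof.
move=> /andP[mt tm] m'; rewrite neq_ltn /L lt_min => /orP[mm|mm].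
  have -> : (t < c m'.+1) = false by rewrite ltNge (le_trans (c_nondecr mm) mt).
  by rewrite !andbF.
have := c_nondecr mm => h1.
by rewrite leNgt (lt_le_trans tm h1).
Qed.

Let hit_interval h t m : 0 < h -> c m <= t < c m.+1 -> hit h (xiT c t) = L h m t.
Proof.
move=> h0 /andP[mt tm]; rewrite /hit /L lt_min tm mt andbT/=.
rewrite (pts_xiT c_pos c_nondecr Nc_equiv); last by lra.
rewrite subn_gt0 addr0; congr ((nat_of_bool _)%:R).
have Nt : NC t = m.+1.
  by apply/eqP; rewrite eqn_leq NcP// mt andbT leqNgt NcP// -ltNge.
rewrite Nt ltnS leqNgt NcP// -ltNge; apply/idP/idP; lra.
Qed.

Let hit_none h t : 0 < h -> t < c 0%N -> hit h (xiT c t) = 0.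
Proof.
move=> h0 tc; rewrite /hit (pts_xiT c_pos c_nondecr Nc_equiv); last by lra.
rewrite subn_gt0 addr0; have -> : NC t = 0%N.
  by apply/eqP; rewrite -leqn0 leqNgt NcP// -ltNge.
by [].
Qed.

Let time_cases t : (exists m, c m <= t < c m.+1) \/ t < c 0%N.
Proof.
case E : (NC t) => [|m]; [right|left; exists m].
  by rewrite ltNge -(NcP c_pos c_nondecr Nc_equiv) E.
by rewrite -(NcP c_pos c_nondecr Nc_equiv) E ltnSn/= ltNge -(NcP c_pos c_nondecr Nc_equiv) E ltnn.
Qed.

Let L_none h t m : t < c 0%N -> L h m t = 0.
Proof.
by move=> tc; rewrite /L leNgt (lt_le_trans tc (c_nondecr (leq0n m))).
Qed.

Let hit_sum h t T : 0 < h -> t <= T -> hit h (xiT c t) = \sum_(m < NC T) L h m t.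
Proof.
move=> h0 tT; have [[m mt]|tc] := time_cases t; last first.
  by rewrite hit_none// big1// => m _; exact: L_none.
have mT : (m < NC T)%N by rewrite NcP//; case/andP: mt => h1 _; exact: le_trans tT.
rewrite (hit_interval h0 mt) (bigD1 (Ordinal mT))//= big1 ?addr0// => i im.
exact: (L_last _ mt).
Qed.

Let measurable_L h m : measurable_fun setT (L h m).
Proof.
pose A : set R := `[c m, Num.min (c m + h) (c m.+1)[%classic.
have mA : measurable A by exact: measurable_itv.
rewrite (_ : L h m = \1_A); first exact: (@measurable_indic _ R R setT A mA).
apply/funext => t; rewrite /L indicE; congr ((nat_of_bool _)%:R).
by apply/idP/idP => [?|/set_mem]; [apply/mem_set|]; rewrite /A /= in_itv.
Qed.

Let integ_L T h m : integ lam `]0, T]%classic (L h m).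
Proof.
apply: (@integ_time _ _ 1); first exact: measurable_L.
by move=> t; rewrite /L; case: (_ && _); rewrite /= ?normr1 ?normr0 ?ler01.
Qed.

Let Rintegral_L_le T h m : 0 <= h -> Rintegral lam `]0, T]%classic (L h m) <= h.
Proof.
move=> h0.
have h1 : - h <= 0 by lra.
apply: le_trans (_ : Rintegral lam `]0, T]%classic
   (fun t : R => (nat_of_bool (- h < c m - t <= 0))%:R) <= _); last first.
  by have := time_window_le T (c m) h1; lra.
apply: le_Rintegral; [exact: measurable_0T|exact: integ_L|exact: integ_window|].
move=> t _; rewrite ler_nat /L lt_min.
case: (boolP (_ && _)) => // /and3P[k1 k2 k3].
by have -> : - h < c m - t <= 0 by lra.
Qed.

Variables (K : nat) (Lp M : R) (G : 'rV[R]_K -> R).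
Hypotheses (Lp0 : 0 <= Lp) (GL : lipv Lp G) (M0 : 0 <= M) (GM : forall v, `|G v| <= M).
Variables (dl : R) (q : nat).
Hypothesis dl0 : 0 < dl.

Let b := q%:R * dl.

Definition hitG (h : R) (nu : set R -> \bar R) : R := hit h nu * G (zv dl (pat dl q K nu)).

Definition fhit (h : R) (f : {ffun option 'I_q -> nat}) : R :=
  (nat_of_bool (0 < f None)%N)%:R * G (zv dl (patc K [ffun i => f (Some i)])).

Definition lend (h : R) (o : option 'I_q) : R := if o is Some i then 0 else - h.
Definition rend (o : option 'I_q) : R := if o is Some i then i.+1%:R * dl else 0.

Lemma hitGE h (nu : {measure set R -> \bar R}) : is_counting_measure nu ->
  hitG h nu = fhit h (fam (lend h) rend nu).
Proof.
move=> cn; rewrite /hitG /fhit /hit !ffunE pat_counting//; congr (_ * G (zv _ (patc _ _))).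
by apply/ffunP => i; rewrite !ffunE.
Qed.

Lemma fhit_bounded h f : `|fhit h f| <= M.
Proof.
rewrite /fhit normrM; case: (0 < _)%N; first by rewrite /= normr1 mul1r.
by rewrite /= normr0 mul0r.
Qed.

Lemma hit01 h nu : 0 <= hit h nu <= 1.
Proof. by rewrite /hit; case: (0 < _)%N; rewrite /= ?lexx ?ler01. Qed.

Lemma measurable_hitG h d (T : measurableType d) (eta : T -> {measure set R -> \bar R}) :
  point_process eta -> measurable_fun setT (fun w => hitG h (eta w)).
Proof.
move=> ep; rewrite (_ : (fun w => _) = fhit h \o (fun w => fam (lend h) rend (eta w))).
  exact: (cmeas_measurable (fhit h) (cmeas_fam _ _ ep)).
by apply/funext => w /=; rewrite hitGE//; exact: ep.1.
Qed.

Lemma measurable_hit h d (T : measurableType d) (eta : T -> {measure set R -> \bar R}) :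
  point_process eta -> measurable_fun setT (fun w => hit h (eta w)).
Proof.
move=> ep.
exact: (@cmeas_measurable _ _ _ _ _ (fun k : nat => (nat_of_bool (0 < k)%N)%:R : R) _
  (cmeas_pts (- h) 0 ep)).
Qed.

(** Inside a window the points are seen from t instead of [c m], which moves each coordinate by less
    than h; the pattern adds [2 * dl]. *)
Let hitG_dist h t T : 0 < h -> t <= T ->
  `|hitG h (xiT c t) - \sum_(m < NC T) L h m t * G (minv b (gapv K m))| <=
  Lp * (K%:R * (2 * dl + h)) * hit h (xiT c t).
Proof.
move=> h0 tT; have [[m mt]|tc] := time_cases t; last first.
  rewrite /hitG hit_none// mul0r mulr0 sub0r normrN big1 ?normr0// => m _.
  by rewrite L_none// mul0r.
have mT : (m < NC T)%N by rewrite NcP//; case/andP: mt => h1 _; exact: le_trans tT.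
rewrite (bigD1 (Ordinal mT))//= big1 ?addr0 => [|i im]; last by rewrite (L_last _ mt) ?mul0r.
rewrite /hitG (hit_interval h0 mt).
have [Lt|Lt] : L h m t = 1 /\ t < c m + h \/ L h m t = 0.
  by rewrite /L lt_min; case: (boolP (_ && _)) => [/and3P[_ ? _]|_]; [left|right].
  case: Lt => -> th; rewrite !mul1r mulr1; apply: lipv_near => // k.
  have b0 : 0 <= b by rewrite mulr_ge0// ltW.
  have lc := located_xiT c_pos c_nondecr Nc_equiv k b0 mt.
  apply: (le_trans (ler_distD (Num.min (c (m + k.+1)%N - t) b) _ _)); apply: lerD.
    exact: zv_located.
  rewrite !mxE (le_trans (min_dist _ _ _))//.
  by case/andP: mt => mt _; rewrite ler_norml; lra.
by rewrite Lt !mul0r mulr0 subrr normr0.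
Qed.

(** A window has length l_m <= h = 1/(n+1), and giving its index full weight changes the sum by at
    most M (1 - (n+1) l_m). These deficits add up to the factor of M in the bound: clusters of [c]
    are felt only there. *)
Lemma gap_average T n : 0 <= T ->
  `|n.+1%:R * Rintegral lam `]0, T]%classic (fun t => hitG (mesh R n) (xiT c t))
    - \sum_(m < NC T) G (minv b (gapv K m))| <=
  Lp * (K%:R * (2 * dl + mesh R n)) * (NC T)%:R
  + M * ((NC T)%:R - n.+1%:R * Rintegral lam `]0, T]%classic (fun t => hit (mesh R n) (xiT c t))).
Proof.
move=> T0; set h := mesh R n; have h0 : 0 < h by exact: mesh_gt0.
have mT := measurable_0T T.
have xpp := xiTpp c_pos c_nondecr Nc_equiv.
pose l m := Rintegral lam `]0, T]%classic (L h m).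
have hl m : n.+1%:R * l m <= 1.
  by rewrite -[leRHS](mesh_mul R n) ler_pM2l//; apply: Rintegral_L_le; exact: ltW.
have ih : integ lam `]0, T]%classic (fun t => hit h (xiT c t)).
  apply: (@integ_time _ _ 1); first exact: measurable_hit.
  by move=> t; have /andP[h1 h2] := hit01 h (xiT c t); rewrite ger0_norm.
have iG : integ lam `]0, T]%classic (fun t => hitG h (xiT c t)).
  apply: (@integ_time _ _ M); first exact: measurable_hitG.
  by move=> t; rewrite hitGE ?fhit_bounded//; exact: xpp.1.
have iLG m : integ lam `]0, T]%classic (fun t => L h m t * G (minv b (gapv K m))).
  have := integZ mT (G (minv b (gapv K m))) (integ_L T h m).
  by apply: eq_integrable => // t _ /=; rewrite mulrC.
have hE : Rintegral lam `]0, T]%classic (fun t => hit h (xiT c t)) = \sum_(m < NC T) l m.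
  rewrite -(Rintegral_sum mT); last by move=> m; exact: integ_L.
  apply: eq_Rintegral => t /set_mem /=; rewrite in_itv/= => /andP[_ tT].
  exact: hit_sum.
have d1 : `|Rintegral lam `]0, T]%classic (fun t => hitG h (xiT c t)) -
    \sum_(m < NC T) l m * G (minv b (gapv K m))| <=
    Lp * (K%:R * (2 * dl + h)) * \sum_(m < NC T) l m.
  rewrite -hE -RintegralZl//.
  have -> : \sum_(m < NC T) l m * G (minv b (gapv K m)) = Rintegral lam `]0, T]%classic
     (fun t => \sum_(m < NC T) L h m t * G (minv b (gapv K m))).
    rewrite (Rintegral_sum mT)//; apply: eq_bigr => m _.
    by rewrite /l -RintegralZr//; exact: integ_L.
  apply: Rintegral_dist => //; [exact: integ_sum|exact: integZ|].
  move=> t /=; rewrite in_itv/= => /andP[_ tT]; exact: hitG_dist.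
rewrite hE; set S := \sum_(m < _) l m * _ in d1.
have n0 : (0 : R) <= n.+1%:R by [].
have d2 : `|n.+1%:R * S - \sum_(m < NC T) G (minv b (gapv K m))| <=
    M * ((NC T)%:R - n.+1%:R * \sum_(m < NC T) l m).
  rewrite /S !mulr_sumr -sumrB (le_trans (ler_norm_sum _ _ _))//.
  have -> : (NC T)%:R = \sum_(m < NC T) (1 : R) by rewrite sumr_const card_ord.
  rewrite -sumrB mulr_sumr; apply: ler_sum => m _.
  have hr : 0 <= 1 - n.+1%:R * l m by rewrite subr_ge0.
  have -> : n.+1%:R * (l m * G (minv b (gapv K m))) - G (minv b (gapv K m)) =
      - ((1 - n.+1%:R * l m) * G (minv b (gapv K m))) by ring.
  by rewrite normrN normrM (ger0_norm hr) mulrC; exact: ler_wpM2r.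
have C0 : 0 <= Lp * (K%:R * (2 * dl + h)).
  by rewrite mulr_ge0// mulr_ge0// addr_ge0 ?mulr_ge0 ?ltW.
have d3 : n.+1%:R * (Lp * (K%:R * (2 * dl + h)) * \sum_(m < NC T) l m) <=
    Lp * (K%:R * (2 * dl + h)) * (NC T)%:R.
  rewrite mulrCA ler_wpM2l// mulr_sumr.
  have -> : (NC T)%:R = \sum_(m < NC T) (1 : R) by rewrite sumr_const card_ord.
  by apply: ler_sum.
apply: (le_trans (ler_distD (n.+1%:R * S) _ _)); apply: lerD => //.
by rewrite -mulrBr normrM ger0_norm// (le_trans _ d3)// ler_wpM2l.
Qed.

End GapAverage.

Lemma near_natr (R : realType) (Q : R -> Prop) :
  (\forall T \near +oo, Q T) -> \forall N \near \oo, Q N%:R.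
Proof. by move=> hQ; exact: (@cvg_natr R _ hQ). Qed.

Lemma near_mesh_le (R : realType) (e : R) : 0 < e -> \forall n \near \oo, mesh R n <= e.
Proof.
move=> e0; have := @mesh_cvg0 R => /cvgr_dist_lt/(_ _ e0); apply: filterS => n.
by rewrite sub0r normrN gtr0_norm ?mesh_gt0// => /ltW.
Qed.

(** * Convergence of gaps for Lipschitz functions *)

Section TimeToGaps.
Context (R : realType) (c : nat -> R).
Hypothesis c_pos : forall n, 0 < c n.
Hypothesis c_nondecr : forall m n, (m <= n)%N -> c m <= c n.
Hypothesis Nc_equiv : ((Ncount c T * (T^-1)%:E)%E @[T --> +oo]) --> 1%E.
Context d (Omega : measurableType d) (P : probability Omega R).
Variable xi : Omega -> {measure set R -> \bar R}.
Hypotheses (xi_pp : point_process xi) (xi_stat : stationary_pp P xi).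
Hypotheses (xi_simple : simple_pp P xi) (xi_int : has_intensity P xi 1).
Context d0 (Omega0 : measurableType d0) (P0 : probability Omega0 R).
Variable xi0 : Omega0 -> {measure set R -> \bar R}.
Hypothesis xi0_palm : is_palm_version P xi 1 P0 xi0.

Notation lam := (@lebesgue_measure R).
Notation NC := (Nc c_pos Nc_equiv).

Hypothesis conv : forall F : {measure set R -> \bar R} -> R,
     vague_continuous F -> bounded_on_counting F ->
     (T^-1 * Rintegral lam `]0%R, T] (fun t => F (xiT c t)))
       @[T --> +oo] --> Rintegral P setT (fun w => F (xi w)).

Lemma hit_mult2 (h : R) (nu : set R -> \bar R) :
  `|(pts nu (- h) 0)%:R - hit h nu| <= (mult2 (pts nu (- h) 0))%:R.
Proof.
rewrite /hit /mult2; case: (pts nu (- h) 0) => [|[|k]] /=; rewrite ?subrr ?normr0//.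
rewrite ger0_norm; first by rewrite lerBlDr lerDl ler01.
by rewrite subr_ge0 ler1n.
Qed.

Lemma hit_average_cvg h : 0 < h ->
  T^-1 * Rintegral lam `]0%R, T] (fun t => hit h (xiT c t)) @[T --> +oo]
    --> Rintegral P setT (fun w => hit h (xi w)).
Proof.
move=> h0; pose u (f : {ffun unit -> nat}) : R := (nat_of_bool (0 < f tt)%N)%:R.
have -> : @hit R h = fun nu => u (fam (fun=> - h) (fun=> 0) nu).
  by apply/funext => nu; rewrite /u ffunE.
apply: (@count_average_cvg _ _ c_pos c_nondecr Nc_equiv _ _ _ _ xi_pp xi_int conv
  unit (fun=> - h) (fun=> 0) 1 u) => //.
  by move=> _; lra.
by move=> k; rewrite /u; case: (0 < _)%N; rewrite /= ?normr1 ?normr0 ?ler01.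
Qed.

(** The expected count of ]-h, 0] is h, so this cell is hit with probability h up to multiple
    points. Through [hit_average_cvg] this bounds the deficit in [gap_average], so that simplicity
    of [xi] controls the clusters of [c]. *)
Lemma expectation_hit_ge n :
  1 - epsN P xi n <= n.+1%:R * Rintegral P setT (fun w => hit (mesh R n) (xi w)).
Proof.
have ih : integ P setT (fun w => hit (mesh R n) (xi w)).
  apply: (@integ_bounded _ _ _ P _ measurableT _ 1) => //; first exact: Pfin.
    exact: measurable_hit.
  by move=> w _; have /andP[h1 h2] := hit01 (mesh R n) (xi w); rewrite ger0_norm.
have := Rintegral_dist measurableT (integ_pts xi_pp xi_int (- mesh R n) 0) ih
  (integ_mult2 xi_pp xi_int (- mesh R n) 0) (fun w _ => hit_mult2 (mesh R n) (xi w)).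
rewrite (Rintegral_pts xi_pp xi_int); last by rewrite oppr_le0 ltW// mesh_gt0.
rewrite sub0r opprK /epsN => /(le_trans (ler_norm _)) h.
have := ler_wpM2l (ler0n R n.+1) h; rewrite mulrBr mesh_mul; lra.
Qed.

Section Lipschitz.
Variables (K : nat) (Lp M : R) (G : 'rV[R]_K -> R).
Hypotheses (Lp0 : 0 <= Lp) (GL : lipv Lp G) (M0 : 0 <= M) (GM : forall v, `|G v| <= M).

Lemma hitG_average_cvg (dl h : R) q : 0 < dl -> 0 < h ->
  T^-1 * Rintegral lam `]0%R, T] (fun t => hitG G dl q h (xiT c t)) @[T --> +oo]
    --> Rintegral P setT (fun w => hitG G dl q h (xi w)).
Proof.
move=> dl0 h0.
rewrite (_ : (fun w => hitG G dl q h (xi w)) =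
    fun w => fhit G dl h (fam (lend h) (rend dl (q := q)) (xi w))).
  rewrite (_ : (fun T => T^-1 * Rintegral lam _ _) = fun T : R => T^-1 * Rintegral lam
     `]0%R, T] (fun t => fhit G dl h (fam (lend h) (rend dl (q := q)) (xiT c t)))).
    apply: (@count_average_cvg _ _ c_pos c_nondecr Nc_equiv _ _ _ _ xi_pp xi_int conv
      _ (lend h) (rend dl (q := q)) M) => //.
      by case=> [i|]; rewrite /lend /rend ?mulr_ge0 ?ltW//; lra.
    by move=> k; exact: fhit_bounded.
  apply/funext => T; congr (_ * Rintegral _ _ _); apply/funext => t.
  by rewrite hitGE//; exact: (xiTpp c_pos c_nondecr Nc_equiv).1.
by apply/funext => w; rewrite hitGE//; exact: xi_pp.1.
Qed.

Lemma palm_hitG_dist (dl : R) q n : 0 < dl ->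
  `|n.+1%:R * Rintegral P setT (fun w => G (zv dl (pat dl q K (xi w))) * (pts (xi w) (- mesh R n) 0)%:R)
    - n.+1%:R * Rintegral P setT (fun w => hitG G dl q (mesh R n) (xi w))| <= M * epsN P xi n.
Proof.
move=> dl0; have i1 : integ P setT (fun w => hitG G dl q (mesh R n) (xi w)).
  apply: (@integ_bounded _ _ _ P _ measurableT _ M) => //; first exact: Pfin.
    exact: measurable_hitG.
  by move=> w _; rewrite hitGE ?fhit_bounded//; exact: xi_pp.1.
have i2 : integ P setT (fun w => G (zv dl (pat dl q K (xi w))) * (pts (xi w) (- mesh R n) 0)%:R).
  exact: (integ_finval (cmeas_patxi xi_pp dl (q := q) (K := K)) (integ_pts xi_pp xi_int _ _)
    (fun e => G (zv dl e))).
have i3 := integZ measurableT M (integ_mult2 xi_pp xi_int (- mesh R n) 0).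
rewrite -mulrBr normrM ger0_norm// /epsN mulrCA ler_wpM2l//.
have := Rintegral_dist measurableT i2 i1 i3; rewrite RintegralZl//; last exact: integ_mult2.
apply=> w _; rewrite /hitG mulrC -mulrBl normrM mulrC.
by apply: ler_pM => //; exact: hit_mult2.
Qed.

(** Choices are made in the order [dl] (through q), n, N: [palm_lip] needs a fixed pattern, and time
    averages converge for a fixed window length. *)
Lemma gaps_lip_cvg (b : R) : 0 < b ->
  N%:R^-1 * \sum_(m < N) G (minv b (gapv c K m)) @[N --> \oo]
    --> Rintegral P0 setT (fun w => G (minv b (xvec K (xi0 w)))).
Proof.
move=> b0; apply/cvgrPdist_le => e e0.
(* The errors below add up to at most [12 * ee]. *)
pose ee := e / 20; have ee0 : 0 < ee by rewrite divr_gt0.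
have [q qe] : exists q, Lp * (K%:R * (2 * (b * mesh R q))) <= ee.
  pose C := Lp * K%:R * 2 * b + 1.
  have C0 : 0 < C by rewrite ltr_wpDl// !mulr_ge0// ltW.
  have [q _ /(_ q (leqnn q)) hq] := near_mesh_le (divr_gt0 ee0 C0).
  exists q; move: hq; rewrite ler_pdivlMr// /C.
  by have := mesh_gt0 R q; lra.
pose dl := b * mesh R q.
have dl0 : 0 < dl by rewrite mulr_gt0// mesh_gt0.
have bE : q.+1%:R * dl = b by rewrite mulrCA mesh_mul mulr1.
have h1 := @palm_lip R K _ _ _ _ xi_pp xi_stat xi_simple xi_int _ _ _ _ xi0_palm Lp M G dl q.+1 ee
  Lp0 GL GM dl0 ee0.
have h2 : \forall n \near \oo, Lp * (K%:R * mesh R n) <= ee.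
  pose C := Lp * K%:R + 1.
  have C0 : 0 < C by rewrite ltr_wpDl// !mulr_ge0.
  apply: filterS (near_mesh_le (divr_gt0 ee0 C0)) => n; rewrite ler_pdivlMr// /C.
  by have := mesh_gt0 R n; lra.
have h3 : \forall n \near \oo, M * epsN P xi n <= ee.
  have M1 : 0 < M + 1 by rewrite ltr_wpDl.
  have := @epsN_cvg0 _ _ _ _ _ xi_pp xi_stat xi_simple xi_int => /cvgr_dist_le/(_ _ (divr_gt0 ee0 M1)).
  apply: filterS => n; rewrite sub0r normrN ger0_norm; last by rewrite mulr_ge0// Rintegral_ge0.
  rewrite ler_pdivlMr// => hn; have : 0 <= epsN P xi n by rewrite mulr_ge0// Rintegral_ge0.
  by lra.
have [n _ /(_ n (leqnn n)) [k1 [k2 k3]]] := filterI h1 (filterI h2 h3).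
have k4 := palm_hitG_dist q.+1 n dl0.
have k5 := expectation_hit_ge n.
pose s := ee / (M + 1).
have M1 : 0 < M + 1 by rewrite ltr_wpDl.
have s0 : 0 < s by rewrite divr_gt0.
have sE : s * (M + 1) = ee by rewrite divfK// gt_eqF.
have n0 : (0 : R) < n.+1%:R by [].
have t1 := @hitG_average_cvg dl (mesh R n) q.+1 dl0 (mesh_gt0 R n).
move: t1 => /cvgr_dist_le/(_ _ (divr_gt0 ee0 n0))/near_natr t1.
have t2 := @hit_average_cvg (mesh R n) (mesh_gt0 R n).
move: t2 => /cvgr_dist_le/(_ _ (divr_gt0 s0 n0))/near_natr t2.
have t3 := @Nc_cvg _ _ c_pos c_nondecr Nc_equiv.
(* The bound 1 gives r <= 2 for the ratio r of [Nc] to N; the bound s makes M |1 - r| at most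
   [ee]. *)
have m10 : 0 < Num.min 1 s by rewrite lt_min ltr01.
move: t3 => /cvgr_dist_le/(_ _ m10)/near_natr t3.
have bb m : `|G (minv b (gapv c K m))| <= M by [].
have t4 := @avg_real_nat _ _ c_pos c_nondecr Nc_equiv _ M bb.
move: t4 => /cvgr_dist_le/(_ _ ee0) t4.
near=> N.
have N0 : (0 : R) < N%:R by rewrite ltr0n; near: N; exact: nbhs_infty_gt.
pose I1 := N%:R^-1 * Rintegral lam `]0%R, N%:R] (fun t => hitG G dl q.+1 (mesh R n) (xiT c t)).
pose I2 := N%:R^-1 * Rintegral lam `]0%R, N%:R] (fun t => hit (mesh R n) (xiT c t)).
pose S := N%:R^-1 * \sum_(m < NC N%:R) G (minv b (gapv c K m)).
pose r := (NC N%:R)%:R / N%:R : R.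
have u1 : `|Rintegral P setT (fun w => hitG G dl q.+1 (mesh R n) (xi w)) - I1| <= ee / n.+1%:R.
  by rewrite /I1; near: N; exact: t1.
have u2 : `|Rintegral P setT (fun w => hit (mesh R n) (xi w)) - I2| <= s / n.+1%:R.
  by rewrite /I2; near: N; exact: t2.
have u3 : `|1 - r| <= Num.min 1 s by rewrite /r; near: N; exact: t3.
have u4 : `|0 - (N%:R^-1 * \sum_(m < N) G (minv b (gapv c K m)) - S)| <= ee.
  by rewrite /S; near: N; exact: t4.
have ga : `|n.+1%:R * I1 - S| <= Lp * (K%:R * (2 * dl + mesh R n)) * r + M * (r - n.+1%:R * I2).
  have := gap_average c_pos c_nondecr Nc_equiv Lp0 GL M0 GM q.+1 dl0 n (ltW N0).
  rewrite bE -(ler_pM2l (_ : 0 < N%:R^-1)) ?invr_gt0// => h.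
  have e1 : n.+1%:R * I1 - S = N%:R^-1 * (n.+1%:R * Rintegral lam `]0%R, N%:R]
     (fun t => hitG G dl q.+1 (mesh R n) (xiT c t)) - \sum_(m < NC N%:R) G (minv b (gapv c K m))).
    by rewrite /I1 /S; ring.
  rewrite e1 normrM [`|N%:R^-1|]gtr0_norm ?invr_gt0// (le_trans h)//.
  by rewrite /I2 /r le_eqVlt; apply/orP; left; apply/eqP; ring.
have v1 : `|n.+1%:R * Rintegral P setT (fun w => hitG G dl q.+1 (mesh R n) (xi w)) - n.+1%:R * I1| <= ee.
  by rewrite -mulrBr normrM gtr0_norm// mulrC -ler_pdivlMr.
have v2 : `|n.+1%:R * Rintegral P setT (fun w => hit (mesh R n) (xi w)) - n.+1%:R * I2| <= s.
  by rewrite -mulrBr normrM gtr0_norm// mulrC -ler_pdivlMr.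
rewrite bE in k1.
have r1 : `|1 - r| <= 1 by apply: (le_trans u3); rewrite ge_min lexx.
have r2 : `|1 - r| <= s by apply: (le_trans u3); rewrite ge_min lexx orbT.
have C0 : 0 <= Lp * (K%:R * (2 * dl + mesh R n)).
  by rewrite mulr_ge0// mulr_ge0// addr_ge0 ?mulr_ge0// ltW// mesh_gt0.
have qe' : Lp * (K%:R * (2 * dl)) <= ee := qe.
clear h1 h2 h3 u1 u2 u3 qe m10 b0 n0 N0 bb M1.
have C2 : Lp * (K%:R * (2 * dl + mesh R n)) <= 2 * ee.
  by rewrite mulrDr mulrDr; move: qe' k2; lra.
have w1 : Lp * (K%:R * (2 * dl + mesh R n)) * r <= 4 * ee.
  have -> : 4 * ee = 2 * ee * 2 by ring.
  by apply: ler_pM => //; move: r1 ee0; rewrite ler_norml; lra.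
have w2 : M * (r - n.+1%:R * I2) <= M * (2 * s + epsN P xi n).
  by apply: ler_wpM2l => //; move: v2 r2 k5; rewrite !ler_norml; lra.
have w3 : M * s <= ee by rewrite -sE; lra.
have w4 : M * (2 * s + epsN P xi n) <= 3 * ee by rewrite mulrDr mulrCA; lra.
have w5 : `|n.+1%:R * I1 - S| <= 7 * ee by apply: (le_trans ga); lra.
have eE : e = 20 * ee by rewrite /ee mulrCA mulfV ?mulr1// pnatr_eq0.
move: k1 k4 v1 w5 u4; rewrite -/dl sub0r normrN !ler_norml.
move=> /andP[p1 p2] /andP[p3 p4] /andP[p5 p6] /andP[p7 p8] /andP[p9 p10].
by apply/andP; split; lra.
Unshelve. all: by end_near.
Qed.

End Lipschitz.
End TimeToGaps.

(** * Lipschitz minorants of a continuous function *)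

Section LowerEnvelope.
Context (R : realType) (K : nat) (g : 'rV[R]_K.+1 -> R) (M : R).
Hypotheses (gc : continuous g) (g0 : forall v, 0 <= g v) (gM : forall v, g v <= M).

Let trunc (m : nat) (u : 'rV[R]_K.+1) : R := if u 0 ord_max < m.+1%:R then g u else 0.

Let trunc_ge0 m u : 0 <= trunc m u.
Proof. by rewrite /trunc; case: ifP. Qed.

Let trunc_le m u : trunc m u <= g u.
Proof. by rewrite /trunc; case: ifP. Qed.

Let cost (m : nat) (v u : 'rV[R]_K.+1) : R :=
  trunc m u + m.+1%:R * \sum_k `|v 0 k - u 0 k|.

Let cost_ge0 m v u : 0 <= cost m v u.
Proof. by rewrite addr_ge0// mulr_ge0// sumr_ge0. Qed.

(* [lowenv m] is a Lipschitz minorant of [g] vanishing where the last coordinate is at least [m.+1]. *)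
Definition lowenv (m : nat) (v : 'rV[R]_K.+1) : R := inf (range (cost m v)).

Lemma lowenv_ge0 m v : 0 <= lowenv m v.
Proof. by apply: lb_le_inf; [exists (cost m v v), v|move=> _ [u _ <-]]. Qed.

Let lowenv_le_trunc m v : lowenv m v <= trunc m v.
Proof.
have -> : trunc m v = cost m v v.
  by rewrite /cost big1 ?mulr0 ?addr0// => k _; rewrite subrr normr0.
by apply: ge_inf; [exists 0 => _ [u _ <-]|exists v].
Qed.

Lemma lowenv_le m v : lowenv m v <= g v.
Proof. exact: le_trans (lowenv_le_trunc m v) (trunc_le m v). Qed.

Lemma lowenv_bounded m v : `|lowenv m v| <= M.
Proof.
rewrite ger0_norm; first exact: le_trans (lowenv_le m v) (gM v).
exact: lowenv_ge0.
Qed.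

Lemma lowenv_far m (v : 'rV[R]_K.+1) : m.+1%:R <= v 0 ord_max -> lowenv m v = 0.
Proof.
move=> mv; apply/eqP; rewrite eq_le lowenv_ge0 andbT.
by rewrite (le_trans (lowenv_le_trunc m v))// /trunc ltNge mv.
Qed.

Lemma lowenv_lip m : lipv m.+1%:R (lowenv m).
Proof.
move=> v v'; apply: (@inf_dist _ _ _ _ 0 _ v) => [u|u|u]; rewrite ?cost_ge0//.
rewrite /cost opprD addrACA subrr add0r -mulrBr normrM ger0_norm// ler_wpM2l//.
rewrite -sumrB (le_trans (ler_norm_sum _ _ _))//; apply: ler_sum => k _.
apply: (le_trans (ler_dist_dist _ _)).
by rewrite opprB addrA subrK.
Qed.

(** Gap vectors are nondecreasing. Either the last coordinate is below m+1 and the cap changes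
    nothing, or the cap puts it at m+1, where the minorant vanishes. *)
Lemma lowenv_sorted_le m (v : 'rV[R]_K.+1) : (forall k, v 0 k <= v 0 ord_max) ->
  lowenv m (minv m.+1%:R v) <= g v.
Proof.
move=> sv; have [vm|mv] := ltP (v 0 ord_max) m.+1%:R.
  suff -> : minv m.+1%:R v = v by exact: lowenv_le.
  by apply/rowP => k; rewrite mxE min_l// (le_trans (sv k))// ltW.
by rewrite lowenv_far// mxE min_r.
Qed.

Lemma lowenv_cvg (v : 'rV[R]_K.+1) : lowenv m (minv m.+1%:R v) @[m --> \oo] --> g v.
Proof.
apply/cvgrPdist_le => e e0.
have [dd /= dd0 hd] : exists2 dd : R, 0 < dd & forall u : 'rV[R]_K.+1, (forall k, `|v 0 k - u 0 k| < dd) -> `|g v - g u| <= e.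
  have := @gc v => /(_ _ (nbhsx_ballx (g v) e e0)) /nbhs_ballP[dd dd0 hd].
  exists dd => // u hu; apply: ltW; apply: hd; split => // i j; rewrite ord1; exact: hu.
(* The first two terms keep v and its dd-neighbours below the cap and the truncation. The term M /
   dd makes the slope so large that any other u costs at least M >= g v. *)
pose B := \sum_k `|v 0 k| + dd + M / dd.
near=> m.
have Bm : B < m.+1%:R.
  have : (Num.truncn B <= m)%N by near: m; exact: nbhs_infty_ge.
  by move=> h; apply: (lt_le_trans (truncnS_gt _)); rewrite ler_nat.
have M0 : 0 <= M := le_trans (g0 v) (gM v).
have Md : 0 <= M / dd by rewrite divr_ge0// ltW.
have vk k : v 0 k + dd < m.+1%:R.
  apply: le_lt_trans Bm; rewrite /B (bigD1 k)//=.
  have : 0 <= \sum_(i < K.+1 | i != k) `|v 0 i| by rewrite sumr_ge0.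
  have := ler_norm (v 0 k); lra.
have -> : minv m.+1%:R v = v.
  by apply/rowP => k; rewrite mxE min_l//; have := vk k; lra.
rewrite ger0_norm ?subr_ge0 ?lowenv_le// lerBlDr -lerBlDl.
apply: lb_le_inf; first by exists (cost m v v), v.
move=> _ [u _ <-].
have [hu|/existsNP[k hk]] := pselect (forall k, `|v 0 k - u 0 k| < dd).
  have um : u 0 ord_max < m.+1%:R.
    have := hu ord_max; have := vk ord_max; rewrite ltr_norml; lra.
  have := hd u hu; rewrite ler_norml /cost /trunc um => /andP[_ h].
  have : 0 <= m.+1%:R * \sum_k `|v 0 k - u 0 k| by rewrite mulr_ge0// sumr_ge0.
  by lra.
have {}hk : dd <= `|v 0 k - u 0 k| by rewrite leNgt; apply/negP.
have s1 : dd <= \sum_k `|v 0 k - u 0 k|.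
  by rewrite (bigD1 k)//= (le_trans hk)// lerDl sumr_ge0.
have s2 : M <= m.+1%:R * \sum_k `|v 0 k - u 0 k|.
  have -> : M = M / dd * dd by rewrite divfK// gt_eqF.
  apply: ler_pM => //; first exact: ltW.
  apply: le_trans (ltW Bm); rewrite /B.
  have : 0 <= \sum_k `|v 0 k| by rewrite sumr_ge0.
  lra.
rewrite /cost; have := trunc_ge0 m u; have := gM v; lra.
Unshelve. all: by end_near.
Qed.

End LowerEnvelope.

(** * Convergence of gaps for bounded continuous functions *)

Section TimeToGaps.
Context (R : realType) (c : nat -> R).
Hypothesis c_pos : forall n, 0 < c n.
Hypothesis c_nondecr : forall m n, (m <= n)%N -> c m <= c n.
Hypothesis Nc_equiv : ((Ncount c T * (T^-1)%:E)%E @[T --> +oo]) --> 1%E.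
Context d (Omega : measurableType d) (P : probability Omega R).
Variable xi : Omega -> {measure set R -> \bar R}.
Hypotheses (xi_pp : point_process xi) (xi_stat : stationary_pp P xi).
Hypotheses (xi_simple : simple_pp P xi) (xi_int : has_intensity P xi 1).
Context d0 (Omega0 : measurableType d0) (P0 : probability Omega0 R).
Variable xi0 : Omega0 -> {measure set R -> \bar R}.
Hypothesis xi0_palm : is_palm_version P xi 1 P0 xi0.
Hypothesis conv : forall F : {measure set R -> \bar R} -> R,
     vague_continuous F -> bounded_on_counting F ->
     (T^-1 * Rintegral (@lebesgue_measure R) `]0%R, T] (fun t => F (xiT c t)))
       @[T --> +oo] --> Rintegral P setT (fun w => F (xi w)).

Lemma integ_xvec (K : nat) (g : 'rV[R]_K -> R) (M : R) : continuous g ->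
  (forall v, `|g v| <= M) -> integ P0 setT (fun w => g (xvec K (xi0 w))).
Proof.
move=> gc gM; apply: (@integ_bounded _ _ _ P0 _ measurableT _ M) => //; first exact: Pfin.
exact: measurable_xvec xi0_palm.1 gc.
Qed.

(** The limit in m is taken under [P0] only, by dominated convergence; along the sequence the
    minorant gives an inequality directly. [time_to_gaps] applies this to g + M and M - g. *)
Lemma gaps_lower (K : nat) (g : 'rV[R]_K.+1 -> R) (M e : R) : continuous g ->
  (forall v, 0 <= g v) -> (forall v, g v <= M) -> 0 < e ->
  \forall N \near \oo, Rintegral P0 setT (fun w => g (xvec K.+1 (xi0 w))) - e <=
     N%:R^-1 * \sum_(n < N) g (gapv c K.+1 n).
Proof.
move=> gc g0 gM e0.
have M0 : 0 <= M := le_trans (g0 0) (gM 0).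
have e2 : 0 < e / 2 by rewrite divr_gt0.
have gm_c m : continuous (fun v => lowenv g m (minv m.+1%:R v)).
  apply: (@lipv_continuous R K.+1 m.+1%:R) => //; apply: lipv_cap => //; exact: lowenv_lip.
have cv : Rintegral P0 setT (fun w => lowenv g m (minv m.+1%:R (xvec K.+1 (xi0 w)))) @[m --> \oo]
    --> Rintegral P0 setT (fun w => g (xvec K.+1 (xi0 w))).
  apply: (@Rintegral_dominated_cvg _ _ _ P0 setT measurableT _ _ (fun=> M)).
  - by move=> m; exact: (measurable_xvec xi0_palm.1 (gm_c m)).
  - exact: measurable_xvec xi0_palm.1 gc.
  - by apply: aeW => w _; exact: lowenv_cvg.
  - exact: integ_cst (Pfin P0).
  - by move=> m w _; exact: lowenv_bounded.
move: cv => /cvgrPdist_le/(_ _ e2)[m _ /(_ m (leqnn m)) hm].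
have m0 : 0 < m.+1%:R :> R by [].
have := @gaps_lip_cvg _ _ c_pos c_nondecr Nc_equiv _ _ _ _ xi_pp xi_stat xi_simple xi_int
  _ _ _ _ xi0_palm conv K.+1 m.+1%:R M (lowenv g m) (ler0n _ _) (lowenv_lip g0 m)
  M0 (lowenv_bounded g0 gM m) m.+1%:R m0.
move=> /cvgrPdist_le/(_ _ e2); apply: filterS => N hN.
have gapN : N%:R^-1 * \sum_(n < N) lowenv g m (minv m.+1%:R (gapv c K.+1 n)) <=
    N%:R^-1 * \sum_(n < N) g (gapv c K.+1 n).
  rewrite ler_wpM2l ?invr_ge0//; apply: ler_sum => n _; apply: lowenv_sorted_le => // k.
  rewrite !mxE lerD2r; apply: c_nondecr; rewrite leq_add2l ltnS -ltnS; exact: ltn_ord.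
move: hm hN gapN; rewrite !ler_norml; lra.
Qed.

Theorem time_to_gaps (K : nat) : (0 < K)%N -> forall g : 'rV[R]_K -> R, continuous g ->
  (exists M : R, forall v, `|g v| <= M) ->
  N%:R^-1 * \sum_(n < N) g (gapv c K n) @[N --> \oo]
    --> Rintegral P0 setT (fun w => g (xvec K (xi0 w))).
Proof.
case: K => // K _ g gc [M gM].
have ig := integ_xvec gc gM.
have ic k : integ P0 setT (fun=> k) by exact: integ_cst (Pfin P0).
apply/cvgrPdist_le => e e0.
have gp : continuous (fun v => g v + M).
  by move=> v; exact: (cvgD (gc v) (@cvg_cst _ M _ (nbhs v) _)).
have gn : continuous (fun v => M - g v).
  by move=> v; exact: (cvgB (@cvg_cst _ M _ (nbhs v) _) (gc v)).
have gM' v : - M <= g v <= M by rewrite -ler_norml.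
have h1 := @gaps_lower K _ (M + M) e gp (fun v => ltac:(have := gM' v; lra))
  (fun v => ltac:(have := gM' v; lra)) e0.
have h2 := @gaps_lower K _ (M + M) e gn (fun v => ltac:(have := gM' v; lra))
  (fun v => ltac:(have := gM' v; lra)) e0.
have i1 : Rintegral P0 setT (fun w => g (xvec K.+1 (xi0 w)) + M) =
    Rintegral P0 setT (fun w => g (xvec K.+1 (xi0 w))) + M.
  by rewrite (RintegralD measurableT ig (ic M)) Rintegral_cst_prob.
have i2 : Rintegral P0 setT (fun w => M - g (xvec K.+1 (xi0 w))) =
    M - Rintegral P0 setT (fun w => g (xvec K.+1 (xi0 w))).
  by rewrite (RintegralB measurableT (ic M) ig) Rintegral_cst_prob.
near=> N.
have N0 : N%:R != 0 :> R by rewrite pnatr_eq0 -lt0n; near: N; exact: nbhs_infty_gt.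
have k1 : Rintegral P0 setT (fun w => g (xvec K.+1 (xi0 w)) + M) - e <=
    N%:R^-1 * \sum_(n < N) (g (gapv c K.+1 n) + M) by near: N; exact: h1.
have k2 : Rintegral P0 setT (fun w => M - g (xvec K.+1 (xi0 w))) - e <=
    N%:R^-1 * \sum_(n < N) (M - g (gapv c K.+1 n)) by near: N; exact: h2.
have sM : \sum_(n < N) M = M * N%:R by rewrite sumr_const card_ord mulr_natr.
move: k1 k2; rewrite i1 i2 big_split sumrB/= sM mulrDr mulrBr.
have -> : N%:R^-1 * (M * N%:R) = M by rewrite mulrCA mulVf// mulr1.
rewrite ler_norml => k1 k2; apply/andP; split; lra.
Unshelve. all: by end_near.
Qed.

End TimeToGaps.

(** * From gaps to time averages *)

Section JumpKernel.
Context (R : realType) (m0 K : nat) (M : R) (u : {ffun 'I_(ncell m0) -> nat} -> R).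
Hypotheses (M0 : 0 <= M) (uM : forall k, `|u k| <= M).

Notation lam := (@lebesgue_measure R).
Notation cp := (cpt R m0).
Let A : R := m0.+1%:R.

Definition incell (i : nat) (x : R) : nat := nat_of_bool (cp i < x <= cp i.+1).

Definition ev (x : R) : {ffun 'I_(ncell m0) -> nat} := [ffun i : 'I_(ncell m0) => incell i x].

Definition evs (s : R) (v : 'rV[R]_K) : {ffun 'I_(ncell m0) -> nat} :=
  [ffun i : 'I_(ncell m0) => (\sum_k incell i (s + v 0 k)%R)%N].

(* The change of [u] when a point is added at [s] to the points [s + v_k] lying to its right. *)
Definition jump (s : R) (v : 'rV[R]_K) : R :=
  u [ffun i => (ev s i + evs s v i)%N] - u (evs s v).

Lemma jump_bounded s v : `|jump s v| <= 2 * M.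
Proof.
rewrite (le_trans (ler_normB _ _))//; have := uM [ffun i => (ev s i + evs s v i)%N].
by have := uM (evs s v); lra.
Qed.

Lemma cp_ge i : - A <= cp i.
Proof. by rewrite /cpt lerDl gpt_ge0. Qed.

Lemma cp_leA (i : 'I_(ncell m0)) : cp i.+1 <= A.
Proof. by rewrite /A -(cpt_full R m0) cpt_le. Qed.

Lemma incell_out (i : 'I_(ncell m0)) x : (x <= - A) || (A < x) -> incell i x = 0%N.
Proof.
move=> xA; rewrite /incell; have := cp_ge i; have := cp_leA i => h1 h2.
by case: (boolP (_ && _)) => // /andP[k1 k2]; exfalso; case/orP: xA => ?; lra.
Qed.

Lemma jump_out s v : (s <= - A) || (A < s) -> jump s v = 0.
Proof.
move=> sA; rewrite /jump (_ : [ffun i => _] = evs s v) ?subrr//.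
by apply/ffunP => i; rewrite !ffunE incell_out.
Qed.

(** For s > -A a gap of at least 2 A leads beyond the last cell, so its exact value is irrelevant;
    for other s no cell contains s and the jump is 0. *)
Lemma jump_minv s v : jump s (minv (2 * A) v) = jump s v.
Proof.
have [sA|] := boolP ((s <= - A) || (A < s)); first by rewrite !jump_out.
rewrite negb_or -ltNge -leNgt => /andP[s1 s2].
suff E : evs s (minv (2 * A) v) = evs s v by rewrite /jump E.
apply/ffunP => i; rewrite !ffunE; apply: eq_bigr => k _; rewrite mxE.
by case: (leP (v 0 k) (2 * A)) => // vA; rewrite !incell_out//; apply/orP; right; lra.
Qed.

Definition close (e x : R) : nat := (\sum_(i < (ncell m0).+1) nat_of_bool (`|cp i - x| <= e)%R)%N.

Lemma incell_eq (e x x' : R) (i : 'I_(ncell m0)) : `|x - x'| <= e -> close e x = 0%N ->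
  incell i x = incell i x'.
Proof.
move=> xx /eqP; rewrite sum_nat_eq0 => /forallP c0.
have far (j : 'I_(ncell m0).+1) : e < `|cp j - x|.
  by have := c0 j; case: leP.
have k1 := far (widen_ord (leqnSn _) i); have k2 := far (lift ord0 i).
rewrite /= /bump/= add1n in k1 k2.
congr nat_of_bool; move: xx k1 k2; rewrite ler_norml => /andP[h1 h2].
case: (ler0P (cp i - x)) => d1 k1; case: (ler0P (cp i.+1 - x)) => d2 k2;
apply/idP/idP => /andP[h3 h4]; apply/andP; split; lra.
Qed.

(** As a function of the positions, [jump] is locally constant as long as neither s nor a listed
    point is at a cell boundary. Otherwise it changes by at most 4 M, twice its bound. *)
Definition osc (e s : R) (v : 'rV[R]_K) : R :=
  4 * M * (close e s + \sum_k close e (s + v 0 k)%R)%N%:R.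

Lemma jump_osc (e s s' : R) (v v' : 'rV[R]_K) : `|s - s'| <= e ->
  (forall k, `|(s + v 0 k) - (s' + v' 0 k)| <= e) ->
  `|jump s v - jump s' v'| <= osc e s v.
Proof.
move=> ss vv; rewrite /osc; case E : (_ + _)%N => [|N]; last first.
  apply: (@le_trans _ _ (4 * M * 1)); last by rewrite ler_wpM2l ?mulr_ge0// ler1n.
  rewrite (le_trans (ler_normB _ _))//.
  by have := jump_bounded s v; have := jump_bounded s' v'; lra.
move/eqP: E; rewrite addn_eq0 sum_nat_eq0 => /andP[/eqP c1 /forallP c2].
rewrite mulr0; suff -> : jump s v = jump s' v' by rewrite subrr normr0.
have E1 : ev s = ev s' by apply/ffunP => i; rewrite !ffunE (incell_eq i ss).
have E2 : evs s v = evs s' v'.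
  apply/ffunP => i; rewrite !ffunE; apply: eq_bigr => k _.
  by apply: (incell_eq i (vv k)); apply/eqP; exact: (implyP (c2 k)).
by rewrite /jump E1 E2.
Qed.

Let W : set (measurableTypeR R) := `]- A, A]%classic.

Let mW : measurable W. Proof. exact: measurable_itv. Qed.

Let A0 : 0 <= A. Proof. exact: ler0n. Qed.

Let WE : lam W = (2 * A)%:E.
Proof. by rewrite /W lam_itv; [congr (_%:E); have := A0; lra|have := A0; lra]. Qed.

Let Wfin : (lam W < +oo)%E. Proof. by rewrite WE ltry. Qed.

Lemma cmeas_ivl (P : R -> bool) (i : interval R) : (forall x, P x = (x \in i)) ->
  cmeas (fun x : R => nat_of_bool (P x)).
Proof.
move=> Pi; apply: (cmeas_comp nat_of_bool) => b.
have mi : measurable ([set` i] : set R) by exact: measurable_itv.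
have E : (P @^-1` [set true]) = [set` i] by apply/seteqP; split => x /=; rewrite Pi.
case: b; first by rewrite E.
rewrite (_ : _ @^-1` _ = ~` (P @^-1` [set true])); first by rewrite E; exact: measurableC.
by apply/seteqP; split => x /=; case: (P x).
Qed.

Lemma cmeas_incell i y : cmeas (fun s : R => incell i (s + y)).
Proof.
apply: (@cmeas_ivl _ `]cp i - y, cp i.+1 - y]%R) => x.
by rewrite in_itv/= ltrBlDr lerBrDr.
Qed.

Lemma cmeas_sum d (T : measurableType d) (n : nat) (Z : 'I_n -> T -> nat) :
  (forall k, cmeas (Z k)) -> cmeas (fun w => (\sum_k Z k w)%N).
Proof.
move=> mZ; have := cmeas_comp (fun f : {ffun 'I_n -> nat} => (\sum_k f k)%N) (cmeas_ffun mZ).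
by congr cmeas; apply/funext => w /=; apply: eq_bigr => k _; rewrite ffunE.
Qed.

Lemma cmeas_evs v : cmeas (fun s : R => evs s v).
Proof.
by apply: cmeas_ffun => i; apply: cmeas_sum => k; exact: cmeas_incell.
Qed.

Lemma measurable_jump v : measurable_fun setT (fun s : R => jump s v).
Proof.
have m1 : cmeas (fun s : R => (ev s, evs s v)).
  apply: cmeas_pair; last exact: cmeas_evs.
  apply: cmeas_ffun => i; have := cmeas_incell i 0.
  by congr cmeas; apply/funext => s; rewrite addr0.
exact: (cmeas_measurable (fun f : {ffun 'I_(ncell m0) -> nat} * {ffun 'I_(ncell m0) -> nat} =>
  u [ffun i => (f.1 i + f.2 i)%N] - u f.2) m1).
Qed.

Lemma cmeas_close e y : cmeas (fun s : R => close e (s + y)).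
Proof.
apply: cmeas_sum => i; apply: (@cmeas_ivl _ `[cp i - y - e, cp i - y + e]%R) => x.
by rewrite in_itv/= ler_norml; apply/idP/idP => /andP[h1 h2]; apply/andP; split; lra.
Qed.

Lemma integ_jump v : integ lam W (fun s => jump s v).
Proof.
apply: (@integ_bounded _ _ _ lam _ mW _ (2 * M)) => //.
  apply: measurable_funTS; exact: measurable_jump.
by move=> s _; exact: jump_bounded.
Qed.

Lemma integ_close e y : integ lam W (fun s => (close e (s + y))%:R).
Proof.
apply: (@integ_bounded _ _ _ lam _ mW _ ((ncell m0).+1%:R)) => //.
  apply: measurable_funTS; exact: (cmeas_measurable (fun k : nat => k%:R : R) (cmeas_close e y)).
move=> s _; rewrite ger0_norm// ler_nat.
rewrite -[X in (_ <= X)%N](card_ord (ncell m0).+1) -sum1_card; apply: leq_sum => i _.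
by case: (_ <= _).
Qed.

Lemma Rintegral_close e y : 0 <= e ->
  Rintegral lam W (fun s => (close e (s + y))%:R) <= (ncell m0).+1%:R * (2 * e).
Proof.
move=> e0.
have iE (i : 'I_(ncell m0).+1) (s : R) : (nat_of_bool (`|cp i - (s + y)| <= e))%:R =
    \1_(`[cp i - y - e, cp i - y + e]%classic : set R) s :> R.
  rewrite indicE; congr ((nat_of_bool _)%:R).
  by apply/idP/idP => [|/set_mem]; [move=> h; apply/mem_set; move: h|]; rewrite /= in_itv/= ler_norml;
    move=> /andP[h1 h2]; apply/andP; split; lra.
pose J (i : 'I_(ncell m0).+1) : set (measurableTypeR R) := `[cp i - y - e, cp i - y + e]%classic.
have mJ i : measurable (J i) by exact: measurable_itv.
have -> : Rintegral lam W (fun s => (close e (s + y))%:R) = Rintegral lam W (fun s =>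
    \sum_(i < (ncell m0).+1) \1_(J i) s).
  by apply: eq_Rintegral => s _; rewrite /close natr_sum; apply: eq_bigr => i _; exact: iE.
rewrite (Rintegral_sum mW); last by move=> i; exact: (integ_indic mW (mJ i) Wfin).
rewrite -[X in _ <= X%:R * _](card_ord (ncell m0).+1) mulr_natl -sumr_const; apply: ler_sum => i _.
have lJ : lam (J i) = (2 * e)%:E.
  by rewrite /J lebesgue_measure_itv/= lte_fin; case: ltP => h; congr (_%:E); lra.
have le1 : (lam (J i `&` W) <= (2 * e)%:E)%E.
  rewrite -lJ; apply: le_measure; rewrite ?inE//.
  exact: (measurableI _ _ (mJ i) mW).
have -> : Rintegral lam W (\1_(J i) : R -> R) = fine (lam (J i `&` W)).
  by rewrite /Rintegral (integral_indic lam mW (mJ i)).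
rewrite -lee_fin fineK//.
rewrite ge0_fin_numE; last exact: measure_ge0.
by rewrite (le_lt_trans le1) ?ltry.
Qed.

(** 4 M for each of K+1 points near one of [(ncell m0).+1] boundaries, each proximity lasting for a
    set of s of length 2 e. *)
Definition jumpC : R := 4 * M * ((ncell m0).+1%:R * 2 * K.+1%:R).

Lemma jumpC_ge0 : 0 <= jumpC.
Proof. by rewrite !mulr_ge0. Qed.

Lemma integ_osc (e : R) (v : 'rV[R]_K) : integ lam W (fun s => osc e s v).
Proof.
have : integ lam W (fun s => 4 * M * ((close e (s + 0))%:R + \sum_k (close e (s + v 0 k))%:R)).
  apply: integZ => //; apply: integD => //; first exact: integ_close.
  apply: integ_sum => // k; exact: integ_close.
apply: eq_integrable => // s _ /=.
by rewrite /osc natrD natr_sum addr0.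
Qed.

Lemma Rintegral_osc (e : R) (v : 'rV[R]_K) : 0 <= e -> Rintegral lam W (fun s => osc e s v) <= jumpC * e.
Proof.
move=> e0.
have -> : Rintegral lam W (fun s => osc e s v) = Rintegral lam W
   (fun s => 4 * M * ((close e (s + 0))%:R + \sum_k (close e (s + v 0 k))%:R)).
  by apply: eq_Rintegral => s _; rewrite /osc natrD natr_sum addr0.
have i1 : integ lam W (fun s => \sum_k (close e (s + v 0 k))%:R).
  apply: integ_sum => // k; exact: integ_close.
rewrite RintegralZl//; last by apply: integD => //; exact: integ_close.
rewrite RintegralD//; last exact: integ_close.
rewrite (Rintegral_sum mW); last by move=> k; exact: integ_close.
rewrite /jumpC -!mulrA ler_wpM2l ?mulr_ge0// ler_wpM2l//.
have : \sum_k Rintegral lam W (fun s => (close e (s + v 0 k))%:R) <=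
    \sum_(k < K) (ncell m0).+1%:R * (2 * e).
  by apply: ler_sum => k _; exact: Rintegral_close.
rewrite sumr_const card_ord -[_ *+ K]mulr_natr => h1.
have h2 := Rintegral_close 0 e0.
by rewrite -natr1; lra.
Qed.

(** Although [jump] is discontinuous, its discontinuities move with v and are smoothed by the
    integral over s: [jbar] is Lipschitz. *)
Definition jbar (v : 'rV[R]_K) : R := Rintegral lam W (fun s => jump s v).

Lemma jbar_bounded v : `|jbar v| <= 4 * M * A.
Proof.
have := Rintegral_dist mW (integ_jump v) (integ_cst mW 0 Wfin) (integ_cst mW (2 * M) Wfin).
rewrite !Rintegral_cst// mul0r subr0 => h; apply: (le_trans (h _)).
  by move=> s _; rewrite subr0 jump_bounded.
have -> : fine (lam W) = 2 * A by rewrite WE.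
by lra.
Qed.

Lemma jbar_near (e : R) (v v' : 'rV[R]_K) : 0 <= e -> (forall k, `|v 0 k - v' 0 k| <= e) ->
  `|jbar v - jbar v'| <= jumpC * e.
Proof.
move=> e0 vv; apply: le_trans (Rintegral_osc v e0).
apply: Rintegral_dist => //; [exact: integ_jump|exact: integ_jump|exact: integ_osc|].
move=> s _; apply: jump_osc => [|k]; first by rewrite subrr normr0.
by rewrite [s + v 0 k]addrC addrKA vv.
Qed.

Lemma jbar_lip : lipv jumpC jbar.
Proof.
move=> v v'; apply: jbar_near; first exact: sumr_ge0.
by move=> k; rewrite (bigD1 k)//= lerDl sumr_ge0.
Qed.

Lemma jbar_minv v : jbar (minv (2 * A) v) = jbar v.
Proof. by apply: eq_Rintegral => s _; exact: jump_minv. Qed.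

(** On a cell of the grid both s and the listed points move by at most the mesh plus e, so the
    integral of [osc] bounds the error of the Riemann sum and of the change from v to v'
    together. *)
Lemma jump_riemann n (e : R) (v v' : 'rV[R]_K) : 0 <= e -> (forall k, `|v 0 k - v' 0 k| <= e) ->
  `|mesh R n * \sum_(j < 2 * m0.+1 * n.+1) jump (- A + gpt R n j.+1) v' - jbar v| <=
     jumpC * (mesh R n + e).
Proof.
move=> e0 vv.
have h0 := mesh_gt0 R n.
pose J (j : nat) : set (measurableTypeR R) := `]- A + gpt R n j, - A + gpt R n j.+1]%classic.
have mJ j : measurable (J j) by exact: measurable_itv.
have lJ j : lam (J j) = (mesh R n)%:E.
  by rewrite /J lam_itv gptS; [congr (_%:E)|]; lra.
have Jfin j : (lam (J j) < +oo)%E by rewrite lJ ltry.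
have full : - A + gpt R n (2 * m0.+1 * n.+1) = A.
  rewrite /gpt natrM -mulrA mesh_mul mulr1 natrM /A; lra.
have split f : integ lam W f -> Rintegral lam W f = \sum_(j < 2 * m0.+1 * n.+1) Rintegral lam (J j) f.
  move=> fi; rewrite {1}/W -{2}full; move: (2 * m0.+1 * n.+1)%N full => m full.
  have : forall k, (k <= m)%N -> Rintegral lam `]- A, - A + gpt R n k]%classic f =
      \sum_(j < k) Rintegral lam (J j) f.
    elim=> [|k IH] km.
      by rewrite big_ord0 /gpt mul0r addr0 set_itvoc0 Rintegral_set0.
    have l1 : - A <= - A + gpt R n k by rewrite lerDl gpt_ge0.
    have l2 : - A + gpt R n k <= - A + gpt R n k.+1 by rewrite gptS; lra.
    have l3 : - A + gpt R n k.+1 <= A by have := gpt_le R n km; have := full; lra.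
    have E : `]- A, - A + gpt R n k.+1]%classic = `]- A, - A + gpt R n k] `|` J k.
      by rewrite /J -itv_bndbnd_setU// bnd_simp.
    have m1 : measurable (`]- A, - A + gpt R n k]%classic : set (measurableTypeR R)).
      exact: measurable_itv.
    rewrite big_ord_recr/= -IH ?(ltnW km)// E Rintegral_setU//.
    - rewrite -E; apply: (integrableS mW _ _ fi); first exact: measurable_itv.
      by move=> x; rewrite /W /= !in_itv/=; lra.
    - apply/disj_setPS => x []; rewrite /J /= !in_itv/=; lra.
  by move=> /(_ m (leqnn m)).
rewrite /jbar split; last exact: integ_jump.
rewrite mulr_sumr -sumrB (le_trans (ler_norm_sum _ _ _))//.
have e1 : 0 <= mesh R n + e by lra.
apply: le_trans (Rintegral_osc v e1).
rewrite split; last exact: integ_osc.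
apply: ler_sum => j _.
have sub (f : R -> R) : integ lam W f -> integ lam (J j) f.
  move=> fi; apply: (integrableS mW _ _ fi); first exact: mJ.
  move=> x; rewrite /W /J /= !in_itv/= => /andP[x1 x2].
  have := gpt_ge0 R n j; have := gpt_le R n (ltn_ord j); move: full; lra.
have -> : mesh R n * jump (- A + gpt R n j.+1) v' =
    Rintegral lam (J j) (fun=> jump (- A + gpt R n j.+1) v').
  rewrite mulrC (Rintegral_cst lam (mJ j)); congr (_ * _).
  by have -> : fine (lam (J j)) = mesh R n by rewrite lJ.
rewrite distrC; apply: Rintegral_dist; [exact: mJ|exact/sub/integ_jump|exact: integ_cst (mJ j) _ (Jfin j)|exact/sub/integ_osc|].
move=> s; rewrite /J /= in_itv/= gptS => /andP[s1 s2].
have k1 : `|s - (- A + (gpt R n j + mesh R n))| <= mesh R n by rewrite ler_norml; lra.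
apply: jump_osc => [|k]; first by move: k1; rewrite !ler_norml; lra.
have := vv k; move: k1; rewrite !ler_norml; lra.
Qed.

End JumpKernel.

(** * Removing the points of a counting measure along a fine grid *)

Section GridTelescoping.
Context (R : realType) (m0 l n K : nat) (nu : {measure set R -> \bar R}).
Hypotheses (nE : n.+1 = (m0.+1 * l.+1)%N) (cn : is_counting_measure nu).

Notation A := (m0.+1%:R : R).
Notation cp := (cpt R m0).
Notation Q := (2 * m0.+1 * n.+1)%N.

Definition spt (j : nat) : R := - A + gpt R n j.

Lemma lt_spt i j : (spt i < spt j) = (i < j)%N.
Proof. by rewrite ltrD2l ltr_pM2r ?mesh_gt0// ltr_nat. Qed.

Lemma le_spt i j : (spt i <= spt j) = (i <= j)%N.
Proof. by rewrite lerD2l ler_pM2r ?mesh_gt0// ler_nat. Qed.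

Lemma sptD i j : spt (i + j) = spt i + j%:R * mesh R n.
Proof. by rewrite /spt /gpt natrD mulrDl addrA. Qed.

(** By [nE] the coarse mesh is a multiple of the fine one, so cell ends are grid points and no fine
    cell straddles two coarse cells. *)
Lemma cpt_spt i : cp i = spt (i * l.+1).
Proof.
by rewrite /cpt /spt /gpt /mesh nE !natrM; congr (_ + _); rewrite invfM mulrACA mulfV ?mulr1 ?pnatr_eq0.
Qed.

Lemma ncell_spt : (ncell m0 * l.+1 = Q)%N.
Proof. by rewrite nE /ncell; lia. Qed.

Lemma incell_spt i j : incell m0 i (spt j) = nat_of_bool (i * l.+1 < j <= i.+1 * l.+1)%N.
Proof. by rewrite /incell !cpt_spt lt_spt le_spt. Qed.

(** Cell counts of the points beyond s. As [pts] is 0 on reversed intervals, one formula covers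
    cells to the left of s, around s and to its right. *)
Definition tailfam (s : R) : {ffun 'I_(ncell m0) -> nat} :=
  [ffun i : 'I_(ncell m0) => (pts nu s (cp i.+1) - pts nu s (cp i))%N].

Lemma tailfam_start : tailfam (spt 0) = cellfam m0 nu.
Proof.
apply/ffunP => i; rewrite !ffunE.
by rewrite (@pts_cat _ nu (spt 0) (cp i) (cp i.+1))// ?cpt_le ?cpt_spt ?le_spt// addKn.
Qed.

Lemma tailfam_end : tailfam (spt Q) = [ffun=> 0%N].
Proof.
apply/ffunP => i; rewrite !ffunE !pts_ge// cpt_spt le_spt -ncell_spt leq_mul2r.
  by rewrite ltnW ?orbT.
by rewrite ltn_ord orbT.
Qed.

Lemma pts_spt j p : pts nu (spt j) (spt p) =
  ((j < p) * pts nu (spt j) (spt j.+1) + pts nu (spt j.+1) (spt p))%N.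
Proof.
case: ltnP => jp; first by rewrite mul1n -pts_cat// le_spt.
by rewrite mul0n !pts_ge// le_spt// leqW.
Qed.

Lemma tailfamS j (i : 'I_(ncell m0)) : tailfam (spt j) i =
  (incell m0 i (spt j.+1) * pts nu (spt j) (spt j.+1) + tailfam (spt j.+1) i)%N.
Proof.
rewrite !ffunE incell_spt !cpt_spt (pts_spt j (i.+1 * l.+1)) (pts_spt j (i * l.+1)).
have il : (i * l.+1 <= i.+1 * l.+1)%N by rewrite leq_mul2r leqnSn orbT.
have := @pts_le _ nu (spt j.+1) (spt (i * l.+1)) (spt j.+1) (spt (i.+1 * l.+1)) cn (lexx _).
rewrite le_spt => /(_ il).
by rewrite ltnS; case: (leqP (i * l.+1) j); case: (ltnP j (i.+1 * l.+1)); lia.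
Qed.

(** Seen from a grid point, [zv] gives the left end of the fine cell that holds the point. One more
    mesh gives the right end, which lies in the same coarse cell as the point. *)
Definition zup (e : {ffun 'I_Q * 'I_K -> bool}) : 'rV[R]_K :=
  \row_k (zv (mesh R n) e 0 k + mesh R n).

Notation zpat j := (zup (pat (mesh R n) Q K (Defs.shift (spt j) nu))).

(** Rounding up to the grid does not change which points are at most a given grid point, and fewer
    than K points ahead means that the K listed ones include them all. *)
Lemma count_zup j p : (p <= Q)%N -> (pts nu (spt j) (spt j + 2 * A) < K)%N ->
  (\sum_(k < K) nat_of_bool (spt j + zpat j 0 k <= spt p)%R = pts nu (spt j) (spt p))%N.
Proof.
move=> pQ ptK; pose S (k : 'I_K) := (\sum_(i < Q) ~~ pat (mesh R n) Q K (Defs.shift (spt j) nu) (i, k))%N.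
have -> : (\sum_(k < K) nat_of_bool (spt j + zpat j 0 k <= spt p)%R =
    \sum_(k < K) (j + (S k).+1 <= p))%N.
  apply: eq_bigr => k _; congr nat_of_bool; rewrite -le_spt sptD !mxE -/(S k).
  by rewrite -natr1 mulrDl mul1r [mesh R n * _]mulrC.
have [pj|jp] := leqP p j.
  rewrite big1 ?pts_ge ?le_spt// => k _; apply/eqP; rewrite eqb0 -ltnNge; lia.
pose r := (p - j).-1; have rQ : (r < Q)%N by rewrite /r; lia.
have rE : p = (j + r.+1)%N by rewrite /r; lia.
have patE (i : 'I_Q) (k : 'I_K) : pat (mesh R n) Q K (Defs.shift (spt j) nu) (i, k) =
    (k < pts nu (spt j) (spt (j + i.+1)))%N.
  by rewrite pat_shift// !ffunE/= add0r addrC -sptD.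
have mono (i i' : nat) : (i <= i')%N ->
    (pts nu (spt j) (spt (j + i)) <= pts nu (spt j) (spt (j + i')))%N.
  by move=> ii; apply: pts_le => //; rewrite le_spt leq_add2l.
have pK : (pts nu (spt j) (spt p) < K)%N.
  apply: leq_ltn_trans ptK; apply: pts_le => //.
  have -> : spt j + 2 * A = spt (j + Q) by rewrite sptD natrM -mulrA mesh_mul mulr1 natrM.
  by rewrite le_spt; lia.
rewrite -[RHS](minn_idPl (ltnW pK)) -sum_ltn_ord; apply: eq_bigr => k _; congr nat_of_bool.
rewrite {1}rE leq_add2l ltnS.
case: (ltnP k (pts nu (spt j) (spt p))) => kp.
  have /andP[_ ->//] : (0 <= S k <= r)%N.
  apply: sum_bool_between => // i ri; rewrite patE negbK (leq_trans kp)// rE.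
  exact: mono.
apply/negbTE; rewrite -ltnNge.
have /andP[->//] : (r.+1 <= S k <= Q)%N.
apply: sum_bool_between => // i ri; last by have := ltn_ord i; rewrite ltnNge ri.
by rewrite patE -leqNgt (leq_trans _ kp)// rE; exact: mono.
Qed.

Lemma evs_zup j : (pts nu (spt j) (spt j + 2 * A) < K)%N ->
  evs m0 (spt j) (zpat j) = tailfam (spt j).
Proof.
move=> ptK; apply/ffunP => i; rewrite !ffunE.
have le1 : (i.+1 * l.+1 <= Q)%N by rewrite -ncell_spt leq_mul2r ltn_ord orbT.
have le0 : (i * l.+1 <= Q)%N by rewrite -ncell_spt leq_mul2r ltnW ?orbT.
rewrite !cpt_spt -!count_zup// -!cpt_spt; symmetry; apply/eqP.
rewrite -(eqn_add2r (\sum_(k < K) nat_of_bool (spt j + zpat j 0 k <= cp i)%R)%N) subnK.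
  rewrite -big_split/=; apply/eqP; apply: eq_bigr => k _; rewrite /incell.
  have := cpt_le R m0 (leqnSn i); case: (leP (spt j + zpat j 0 k) (cp i)) => h1 h2 /=.
    by rewrite (le_trans h1).
  by rewrite addn0.
apply: leq_sum => k _; have := cpt_le R m0 (leqnSn i).
by case: (leP _ (cp i)) => // h1 h2; rewrite (le_trans h1).
Qed.

Variables (M : R) (u : {ffun 'I_(ncell m0) -> nat} -> R).
Hypotheses (M0 : 0 <= M) (uM : forall k, `|u k| <= M).

(** An empty fine cell changes nothing; one point changes [u] exactly by [jump], unless K points
    follow within 2 A. The two exceptions, crowding and several points in a fine cell, cost at most
    4 M per point. *)
Lemma telescope_step j :
  `|u (tailfam (spt j)) - u (tailfam (spt j.+1)) -
     (pts nu (spt j) (spt j.+1))%:R * jump u (spt j.+1) (zpat j.+1)| <=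
  4 * M * ((mult2 (pts nu (spt j) (spt j.+1)))%:R +
     (pts nu (spt j) (spt j.+1))%:R *
     (nat_of_bool (K <= pts nu (spt j.+1) (spt j.+1 + 2 * A))%N)%:R).
Proof.
have E : tailfam (spt j) = [ffun i : 'I_(ncell m0) => (incell m0 i (spt j.+1) * pts nu (spt j) (spt j.+1) +
    tailfam (spt j.+1) i)%N] by apply/ffunP => i; rewrite tailfamS [RHS]ffunE.
have jb := jump_bounded uM (spt j.+1) (zpat j.+1).
have u1 := uM (tailfam (spt j)); have u2 := uM (tailfam (spt j.+1)).
have ub : `|u (tailfam (spt j)) - u (tailfam (spt j.+1))| <= 2 * M.
  by rewrite (le_trans (ler_normB _ _))//; lra.
have gen : `|u (tailfam (spt j)) - u (tailfam (spt j.+1)) -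
     (pts nu (spt j) (spt j.+1))%:R * jump u (spt j.+1) (zpat j.+1)| <=
     2 * M + (pts nu (spt j) (spt j.+1))%:R * (2 * M).
  rewrite (le_trans (ler_normB _ _))// lerD// normrM [X in X * _]ger0_norm//.
  by rewrite ler_wpM2l.
move: gen E; rewrite /mult2; case: (pts nu (spt j) (spt j.+1)) => [|[|k]] gen E /=.
- rewrite mul0r subr0 mul0r addr0 mulr0.
  suff -> : tailfam (spt j) = tailfam (spt j.+1) by rewrite subrr normr0.
  by rewrite E; apply/ffunP => i; rewrite ffunE muln0.
- rewrite mul1r add0r mul1r; case: leqP => KK; last first.
    rewrite mulr0 /jump evs_zup//.
    suff -> : [ffun i : 'I_(ncell m0) => (ev m0 (spt j.+1) i + tailfam (spt j.+1) i)%N] = tailfam (spt j).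
      by rewrite subrr normr0.
    by rewrite E; apply/ffunP => i; rewrite !ffunE muln1.
  rewrite mulr1; apply: (le_trans (ler_normB _ _)); lra.
- apply: (le_trans gen); rewrite mulrDr -[leLHS]addr0 lerD// ?mulr_ge0//.
  have : (2 : R) <= k.+2%:R by rewrite ler_nat.
  by move: M0; move: (k.+2%:R : R) => x; nra.
Qed.

Lemma telescope_sum :
  `|u (cellfam m0 nu) - u [ffun=> 0%N] -
     \sum_(j < Q) (pts nu (spt j) (spt j.+1))%:R * jump u (spt j.+1) (zpat j.+1)| <=
  \sum_(j < Q) 4 * M * ((mult2 (pts nu (spt j) (spt j.+1)))%:R +
     (pts nu (spt j) (spt j.+1))%:R *
     (nat_of_bool (K <= pts nu (spt j.+1) (spt j.+1 + 2 * A))%N)%:R).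
Proof.
have -> : u (cellfam m0 nu) - u [ffun=> 0%N] =
    \sum_(j < Q) (u (tailfam (spt j)) - u (tailfam (spt j.+1))).
  rewrite -tailfam_start -tailfam_end -[LHS]opprB -(@telescope_sumr _ 0 Q (fun j => u (tailfam (spt j))))//.
  by rewrite big_mkord -sumrN; apply: eq_bigr => j _; rewrite opprB.
rewrite -sumrB (le_trans (ler_norm_sum _ _ _))//.
by apply: ler_sum => j _; exact: telescope_step.
Qed.

End GridTelescoping.

(** * The expectation of a function of cells as a Palm expectation *)

Section PalmExpansion.
Context (R : realType) d (Omega : measurableType d) (P : probability Omega R).
Variable xi : Omega -> {measure set R -> \bar R}.
Hypotheses (xi_pp : point_process xi) (xi_stat : stationary_pp P xi).
Hypotheses (xi_simple : simple_pp P xi) (xi_int : has_intensity P xi 1).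
Context d0 (Omega0 : measurableType d0) (P0 : probability Omega0 R).
Variable xi0 : Omega0 -> {measure set R -> \bar R}.
Hypothesis xi0_palm : is_palm_version P xi 1 P0 xi0.
Variables (m0 k0 : nat) (M : R) (u : {ffun 'I_(ncell m0) -> nat} -> R).
Hypotheses (M0 : 0 <= M) (uM : forall k, `|u k| <= M).

Notation A := (m0.+1%:R : R).
Notation K := k0.+1.
Notation Sz n := (2 * m0.+1 * n.+1)%N.
Notation jb := (@jbar R m0 K u).

Let many (e : {ffun 'I_1 * 'I_K -> bool}) : R := (nat_of_bool (e (ord0, ord_max)))%:R.

Let many_bound e k : `|many e * k%:R| <= 1 * k%:R.
Proof.
by rewrite normrM [X in _ * X]ger0_norm// ler_wpM2r// /many; case: (e _); rewrite ?normr0 ?normr1 ?ler01.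
Qed.

Let manyE s (nu : {measure set R -> \bar R}) : is_counting_measure nu ->
  (nat_of_bool (K <= pts nu s (s + 2 * A))%N)%:R = many (pat (2 * A) 1 K (Defs.shift s nu)).
Proof.
by move=> cn; rewrite /many pat_shift// !ffunE/= add0r mul1r [2 * A + s]addrC.
Qed.

Let a (n : nat) w : R := (pts (xi w) (- mesh R n) 0)%:R.

(** The 4 M of [telescope_step] times the 2 A (n+1) fine cells of ]-A, A]; the factor n+1 is
    absorbed into the two rescaled expectations. *)
Let err (n : nat) : R := 8 * M * A * (epsN P xi n +
  n.+1%:R * Rintegral P setT (fun w => many (pat (2 * A) 1 K (xi w)) * a n w)).

Let term (n : nat) (v : 'rV[R]_K) : R := \sum_(j < Sz n) jump u (- A + gpt R n j.+1) v.

Let integ_cells : integ P setT (fun w => u (cellfam m0 (xi w))).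
Proof.
apply: (@integ_bounded _ _ _ P _ measurableT _ M) => //; first exact: Pfin.
exact: (cmeas_measurable u (cmeas_fam _ _ xi_pp)).
Qed.

Let integ_jump_pat s s' t t' dl (q : nat) (f : {ffun 'I_q * 'I_K -> bool} -> 'rV[R]_K) :
  integ P setT (fun w => (pts (xi w) t t')%:R * jump u s (f (pat dl q K (Defs.shift s' (xi w))))).
Proof.
apply: (@integ_pat_pts _ _ _ _ _ xi_pp xi_int dl q K (2 * M) s' t t'
  (fun e k => k%:R * jump u s (f e))) => e k.
by rewrite normrM ger0_norm// mulrC ler_wpM2r// (jump_bounded uM).
Qed.

(** Stationarity moves every fine cell to ]-h, 0]. The telescoped sum becomes the count there times
    a sum over s of [jump] at one and the same pattern, a Riemann sum for [jbar]. *)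
Let expansion_grid l n : n.+1 = (m0.+1 * l.+1)%N ->
  `|Rintegral P setT (fun w => u (cellfam m0 (xi w))) - u [ffun=> 0%N] -
    Rintegral P setT (fun w => a n w * term n (@zup R m0 n K (pat (mesh R n) (Sz n) K (xi w))))| <= err n.
Proof.
move=> nE.
have N0 : (0 : R) <= n.+1%:R by [].
have mb (e : {ffun 'I_1 * 'I_K -> bool}) (j : nat) : `|(mult2 j)%:R| <= 1 * j%:R :> R.
  by rewrite mul1r ger0_norm// ler_nat mult2_le.
have SE : (Sz n)%:R = 2 * A * n.+1%:R :> R by rewrite !natrM.
have SE0 : (Sz n)%:R * mesh R n = 2 * A by rewrite SE -mulrA mesh_mul mulr1.
have E1 : Rintegral P setT (fun w => a n w * term n (@zup R m0 n K (pat (mesh R n) (Sz n) K (xi w)))) =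
   Rintegral P setT (fun w => \sum_(j < Sz n) (pts (xi w) (spt R m0 n j) (spt R m0 n j.+1))%:R *
     jump u (spt R m0 n j.+1) (@zup R m0 n K (pat (mesh R n) (Sz n) K (Defs.shift (spt R m0 n j.+1) (xi w))))).
  rewrite (Rintegral_sum measurableT); last first.
    by move=> j; exact: (integ_jump_pat _ _ _ _ _ (@zup R m0 n K)).
  transitivity (Rintegral P setT (fun w => \sum_(j < Sz n) a n w * jump u (spt R m0 n j.+1)
     (@zup R m0 n K (pat (mesh R n) (Sz n) K (xi w))))).
    by apply: eq_Rintegral => w _; rewrite mulr_sumr.
  rewrite (Rintegral_sum measurableT); last first.
    move=> j; have mf : measurable_fun setT (fun w => a n w * jump u (spt R m0 n j.+1)
       (@zup R m0 n K (pat (mesh R n) (Sz n) K (xi w)))).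
      apply: measurable_funM; first exact: measurable_pts.
      exact: (cmeas_measurable (fun e => jump u (spt R m0 n j.+1) (@zup R m0 n K e))
        (cmeas_patxi xi_pp (mesh R n) (q := Sz n) (K := K))).
    apply: (@integ_le_pts _ _ _ _ _ xi_pp xi_int _ (2 * M) (- mesh R n) 0) => // w.
    by rewrite normrM ger0_norm// mulrC ler_wpM2r// (jump_bounded uM).
  apply: eq_bigr => j _.
  rewrite -(pat_stationary xi_pp xi_stat (mesh R n) (mesh R n) (spt R m0 n j.+1)
    (fun e k => k%:R * jump u (spt R m0 n j.+1) (@zup R m0 n K e))).
  apply: eq_Rintegral => w _; congr (_%:R * _); congr pts.
  by rewrite /spt gptS addrA addrK.
have ij : integ P setT (fun w => \sum_(j < Sz n) (pts (xi w) (spt R m0 n j) (spt R m0 n j.+1))%:R *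
     jump u (spt R m0 n j.+1) (@zup R m0 n K (pat (mesh R n) (Sz n) K (Defs.shift (spt R m0 n j.+1) (xi w))))).
  by apply: (integ_sum measurableT) => j; exact: (integ_jump_pat _ _ _ _ _ (@zup R m0 n K)).
have i2 : integ P setT (fun w => \sum_(j < Sz n) (mult2 (pts (xi w) (- A + gpt R n j) (- A + gpt R n j.+1)))%:R : R).
  by apply: (integ_sum measurableT) => j; exact: (integ_mult2 xi_pp xi_int).
have i3 : integ P setT (fun w => \sum_(j < Sz n) many (pat (2 * A) 1 K (Defs.shift (- A + gpt R n j.+1) (xi w))) *
    (pts (xi w) (- A + gpt R n j) (- A + gpt R n j.+1))%:R).
  apply: (integ_sum measurableT) => j.
  exact: (@integ_pat_pts _ _ _ _ _ xi_pp xi_int _ _ _ 1 _ _ _ (fun e k => many e * k%:R)).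
have -> : err n = Rintegral P setT (fun w => 4 * M * (
   \sum_(j < Sz n) (mult2 (pts (xi w) (- A + gpt R n j) (- A + gpt R n j.+1)))%:R +
   \sum_(j < Sz n) many (pat (2 * A) 1 K (Defs.shift (- A + gpt R n j.+1) (xi w))) *
    (pts (xi w) (- A + gpt R n j) (- A + gpt R n j.+1))%:R)).
  rewrite RintegralZl//; last exact: integD.
  rewrite (RintegralD measurableT i2 i3).
  rewrite (@grid_palm _ _ _ _ _ xi_pp xi_stat xi_int (2 * A) 1 K 1 (- A) n (Sz n)
    (fun e j => (mult2 j)%:R))//.
  rewrite (@grid_palm _ _ _ _ _ xi_pp xi_stat xi_int (2 * A) 1 K 1 (- A) n (Sz n)
    (fun e j => many e * j%:R))//.
  by rewrite /err /epsN SE; ring.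
rewrite E1 -[u [ffun=> 0%N]](Rintegral_cst_prob P).
have i0 := integ_cst measurableT (u [ffun=> 0%N]) (Pfin P).
rewrite -(RintegralB measurableT integ_cells i0).
apply: (Rintegral_dist measurableT (integB measurableT integ_cells i0) ij).
  by apply: (integZ measurableT); exact: (integD measurableT i2 i3).
move=> w _; have cn := xi_pp.1 w.
apply: (le_trans (@telescope_sum _ _ _ _ K _ nE cn _ _ M0 uM)).
rewrite -big_split/= mulr_sumr; apply: ler_sum => j _.
by rewrite manyE// [many _ * _]mulrC.
Qed.

Let jb_lip : lipv (jumpC m0 K M) jb. Proof. exact: jbar_lip. Qed.

Let C0 : 0 <= jumpC m0 K M :> R. Proof. exact: jumpC_ge0. Qed.

(** [palm_cvg] lets n grow with the pattern fixed, so the gap vector read on mesh n is replaced here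
    by one read on an independent mesh p. *)
Let riemann_grid n p :
  `|Rintegral P setT (fun w => a n w * term n (@zup R m0 n K (pat (mesh R n) (Sz n) K (xi w)))) -
    n.+1%:R * Rintegral P setT (fun w => jb (zv (mesh R p) (pat (mesh R p) (Sz p) K (xi w))) * a n w)| <=
   jumpC m0 K M * (4 * mesh R n + 2 * mesh R p).
Proof.
have h0 := mesh_gt0 R n; have h0' := mesh_gt0 R p.
have ia := integ_pts xi_pp xi_int (- mesh R n) 0.
have ijb : integ P setT (fun w => jb (zv (mesh R p) (pat (mesh R p) (Sz p) K (xi w))) * a n w).
  exact: (integ_finval (cmeas_patxi xi_pp (mesh R p) (q := Sz p) (K := K)) ia (fun e => jb (zv (mesh R p) e))).
have iterm : integ P setT (fun w => a n w * term n (@zup R m0 n K (pat (mesh R n) (Sz n) K (xi w)))).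
  have := integ_finval (cmeas_patxi xi_pp (mesh R n) (q := Sz n) (K := K)) ia (fun e => term n (@zup R m0 n K e)).
  by apply: eq_integrable => // w _; rewrite /= mulrC.
rewrite -RintegralZl//.
have -> : jumpC m0 K M * (4 * mesh R n + 2 * mesh R p) = Rintegral P setT
    (fun w => n.+1%:R * (jumpC m0 K M * (4 * mesh R n + 2 * mesh R p)) * a n w).
  rewrite RintegralZl// Rintegral_pts//; last by lra.
  by rewrite opprK add0r [RHS]mulrAC mesh_mul mul1r.
apply: Rintegral_dist => //; [exact: (integZ measurableT)|exact: (integZ measurableT)|].
move=> w _; set v' := zup _ _; set v := zv _ _.
have a0 : 0 <= a n w by exact: ler0n.
have -> : a n w * term n v' - n.+1%:R * (jb v * a n w) =
    n.+1%:R * (mesh R n * term n v' - jb v) * a n w.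
  have -> : n.+1%:R * (mesh R n * term n v' - jb v) =
      (n.+1%:R * mesh R n) * term n v' - n.+1%:R * jb v by ring.
  by rewrite mesh_mul; ring.
rewrite !normrM [X in _ * X]ger0_norm// ler_wpM2r// ger0_norm// ler_wpM2l//.
(* Two meshes for each reading ([zv_stable]) and one more of mesh n for the rounding up in [zup]. *)
have e0 : 0 <= 2 * mesh R p + 3 * mesh R n by lra.
apply: (le_trans (@jump_riemann _ _ _ _ _ M0 uM n _ v v' e0 _)) => [k|].
  rewrite /v /v' [zup _ _ _ _]mxE.
  have := @zv_stable R (mesh R p) (mesh R n) (Sz p) (Sz n) K (xi w) k h0' h0.
  rewrite !natrM -!mulrA !mesh_mul => /(_ erefl).
  move: (zv _ _ _ _) (zv _ _ _ _) => x y; rewrite !ler_norml.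
  by move: (mesh R n) (mesh R p) h0 h0' => s t; lra.
rewrite ler_wpM2l//; lra.
Qed.

Lemma palm_expansion :
  `|Rintegral P setT (fun w => u (cellfam m0 (xi w))) - u [ffun=> 0%N] -
    Rintegral P0 setT (fun w => jb (xvec K (xi0 w)))| <=
  8 * M * A * fine (P0 [set w | (K%:R%:E <= xi0 w `]0%R, (2 * A)%R]%classic)%E]).
Proof.
apply/ler_addgt0Pr => e e0.
(* The two parts of [err] cost 8 M A e1 each, the other errors at most 3 e1. *)
pose e1 := e / (16 * M * A + 4).
have q0 : 0 < 16 * M * A + 4 by rewrite ltr_wpDl// !mulr_ge0.
have e10 : 0 < e1 by rewrite divr_gt0.
have Ee : e1 * (16 * M * A + 4) = e by rewrite divfK// gt_eqF.
have [p hp] : exists p, jumpC m0 K M * ((2 + 2 * K%:R) * mesh R p) <= e1.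
  have q : 0 < jumpC m0 K M * (2 + 2 * K%:R) + 1 :> R.
    by rewrite ltr_wpDl// mulr_ge0// addr_ge0// mulr_ge0.
  have [p _ /(_ p (leqnn p))/= hp] := near_mesh_le (divr_gt0 e10 q).
  exists p; have hp0 := mesh_gt0 R p.
  rewrite mulrA; move: hp; rewrite ler_pdivlMr// mulrC => hp; apply: le_trans hp.
  by rewrite ler_wpM2r ?(ltW hp0)// lerDl.
(* With p fixed, n runs through the values for which n+1 is a multiple of m0+1, as [expansion_grid]
   requires. *)
have [l [h1 h2 h3 h4]] : exists l, let n := (m0.+1 * l.+1).-1 in [/\
   jumpC m0 K M * (4 * mesh R n) <= e1, epsN P xi n <= e1,
   n.+1%:R * Rintegral P setT (fun w => many (pat (2 * A) 1 K (xi w)) * a n w) <=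
   fine (P0 [set w | (K%:R%:E <= xi0 w `]0%R, (2 * A)%R]%classic)%E]) + e1 &
   `|n.+1%:R * Rintegral P setT (fun w => jb (zv (mesh R p) (pat (mesh R p) (Sz p) K (xi w))) * a n w)
    - Rintegral P0 setT (fun w => jb (xvec K (xi0 w)))| <= jumpC m0 K M * (K%:R * (2 * mesh R p)) + e1].
  have A20 : 0 <= 2 * A by [].
  have cv := @palm_cvg _ _ _ _ _ xi_pp xi_stat xi_int _ _ _ _ xi0_palm (2 * A) 1 K A20 many.
  have PE : Rintegral P0 setT (fun w => many (pat (2 * A) 1 K (xi0 w))) =
     fine (P0 [set w | (K%:R%:E <= xi0 w `]0%R, (2 * A)%R]%classic)%E]).
    have mB := measurable_ge_points K (2 * A) xi0_palm.1.
    rewrite -(Rintegral_indic P0 measurableT mB)//; apply: eq_Rintegral => w _.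
    rewrite /many ffunE/= mul1r; congr ((nat_of_bool _)%:R).
    by apply/idP/idP => [h|/set_mem//]; exact/mem_set.
  rewrite PE in cv.
  have n1 := @palm_lip R K _ _ _ _ xi_pp xi_stat xi_simple xi_int _ _ _ _ xi0_palm _ _ jb
    (mesh R p) (Sz p) e1 C0 jb_lip (jbar_bounded uM) (mesh_gt0 R p) e10.
  have q : 0 < jumpC m0 K M * 4 + 1 :> R by rewrite ltr_wpDl// mulr_ge0.
  have n2 := near_mesh_le (divr_gt0 e10 q).
  have n3 := @epsN_cvg0 _ _ _ _ _ xi_pp xi_stat xi_simple xi_int.
  move/cvgr_dist_le/(_ _ e10): n3 => n3.
  move/cvgr_dist_le/(_ _ e10): cv => n4.
  have [l _ hl] := filterI (filterI n1 n2) (filterI n3 n4).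
  exists l => n; have [|[k1 k2] [k3 k4]] := hl n; first by rewrite /n /=; nia.
  split.
  - move: k2; rewrite ler_pdivlMr// => /(le_trans _); apply.
    by rewrite mulrA mulrC ler_wpM2l// ?lerDl// ltW ?mesh_gt0.
  - by move: k3; rewrite sub0r normrN; apply: le_trans; exact: ler_norm.
  - by move: k4; rewrite ler_norml /a; lra.
  - have E : (Sz p)%:R * mesh R p = 2 * A by rewrite natrM -mulrA mesh_mul mulr1 natrM.
    have E2 : Rintegral P0 setT (fun w => jb (minv ((Sz p)%:R * mesh R p) (xvec K (xi0 w)))) =
        Rintegral P0 setT (fun w => jb (xvec K (xi0 w))).
      by apply: eq_Rintegral => w _; rewrite E jbar_minv.
    by rewrite -E2.
move: h1 h2 h3 h4; set n := (_.-1) => h1 h2 h3 h4.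
have nE : n.+1 = (m0.+1 * l.+1)%N by rewrite /n prednK.
have g1 := expansion_grid nE.
have g2 := riemann_grid n p.
have g3 : err n <= 8 * M * A * (fine (P0 [set w | (K%:R%:E <= xi0 w `]0%R, (2 * A)%R]%classic)%E]) + 2 * e1).
  by rewrite /err ler_wpM2l ?mulr_ge0//; lra.
move: g1 g2 h4; set X := Rintegral _ _ _ - _; set Y := Rintegral P setT _; set Z := n.+1%:R * _; set W := Rintegral P0 _ _.
move=> g1 g2 h4; rewrite (le_trans (ler_distD Y _ _))//.
have := ler_distD Z Y W; rewrite -Ee => g4.
move: g3 hp h1; rewrite !mulrDr !mulrDl.
lra.
Qed.

End PalmExpansion.

Lemma sum_nat_trunc (f : nat -> nat) (a b b' : nat) : (a <= b)%N -> (a <= b')%N ->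
  (forall k, (b <= k)%N -> f k = 0%N) -> (forall k, (b' <= k)%N -> f k = 0%N) ->
  (\sum_(a <= k < b) f k = \sum_(a <= k < b') f k)%N.
Proof.
wlog bb : b b' / (b <= b')%N => [H|] ab ab' fb fb'.
  by have [/H->//|/ltnW/H ->] := leqP b b'.
rewrite [RHS](big_cat_nat (n := b))//= [X in (_ = _ + X)%N](_ : _ = 0%N) ?addn0// big_nat_cond big1// => k.
by rewrite andbT => /andP[/fb].
Qed.

(** * Reflection invariance of Lebesgue measure *)

Section Reflection.
Context (R : realType).

Notation lam := (@lebesgue_measure R).

Lemma lebesgue_measure_reflect (a : R) (B : set (measurableTypeR R)) : measurable B ->
  pushforward lam ((fun t => a - t) : _ -> measurableTypeR R) B = lam B.
Proof.
move=> mB; apply/esym/lebesgue_measure_unique => //=.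
  exact: measurable_funB.
move=> mphi _ [[x y]] _ <-; rewrite /pushforward.
have -> : (fun t : R => a - t) @^-1` `]x, y]%classic = `[a - y, a - x[%classic.
  by apply/seteqP; split => t /=; rewrite !in_itv/=; lra.
rewrite !lebesgue_measure_itv/= !lte_fin ltrD2l ltrN2.
by case: ltP => // _; congr (_%:E); lra.
Qed.

Lemma Rintegral_reflect (C : countType) (Z : R -> C) (u : C -> R) (a : R) : cmeas Z ->
  Rintegral lam setT (fun t : R => u (Z (a - t))) = Rintegral lam setT (fun t => u (Z t)).
Proof.
move=> mZ; have mphi : measurable_fun setT (fun t : R => a - t) by exact: measurable_funB.
have mZ' : cmeas (fun t : R => Z (a - t)).
  by move=> b; rewrite -[X in measurable X]setTI; apply: (mphi measurableT _ (mZ b)).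
apply: (@eq_law_Rintegral R C _ _ _ _ lam lam _ _ mZ' mZ) => b.
exact: lebesgue_measure_reflect (mZ b).
Qed.

End Reflection.

(** * A time integral as a sum over gaps *)

Section GapExpansion.
Context (R : realType) (c : nat -> R).
Hypothesis c_pos : forall n, 0 < c n.
Hypothesis c_nondecr : forall m n, (m <= n)%N -> c m <= c n.
Hypothesis Nc_equiv : ((Ncount c T * (T^-1)%:E)%E @[T --> +oo]) --> 1%E.
Variables (m0 k0 : nat) (M : R) (u : {ffun 'I_(ncell m0) -> nat} -> R).
Hypotheses (M0 : 0 <= M) (uM : forall k, `|u k| <= M).

Notation lam := (@lebesgue_measure R).
Notation NC := (Nc c_pos Nc_equiv).
Notation A := (m0.+1%:R : R).
Notation K := k0.+1.
Notation jb := (@jbar R m0 K u).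

Let tail (B : nat) (t : R) (j : nat) : {ffun 'I_(ncell m0) -> nat} :=
  [ffun i : 'I_(ncell m0) => (\sum_(j <= k < B) incell m0 i (c k - t)%R)%N].

Let tail_start T t : t <= T -> tail (NC (T + A)) t 0 = cellfam m0 (xiT c t).
Proof.
move=> tT; apply/ffunP => i; rewrite !ffunE big_mkord.
rewrite (@pts_xiT_sum _ _ c_pos c_nondecr Nc_equiv _ _ _ (NC (T + A)))//.
by apply: Nc_le => //; apply: lerD => //; exact: cp_leA.
Qed.

Let tailS B t j (i : 'I_(ncell m0)) : (j < B)%N ->
  tail B t j i = (ev m0 (c j - t) i + tail B t j.+1 i)%N.
Proof. by move=> jB; rewrite !ffunE big_ltn. Qed.

Definition crowded (j : nat) : R := (nat_of_bool (c (j + K)%N - c j <= 2 * A))%:R.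

Let win (j : nat) (t : R) : R := (nat_of_bool (- A < c j - t <= A))%:R.

(** By monotonicity all indices from j+K on lie beyond the last cell, so the K gaps following j
    account for the whole tail. *)
Let tail_evs B t j : (forall k, (B <= k)%N -> A < c k - t) -> (j < B)%N ->
  A < c (j + K)%N - t -> evs m0 (c j - t) (gapv c K j) = tail B t j.+1.
Proof.
move=> hB jB hK; apply/ffunP => i; rewrite !ffunE.
rewrite -(@sum_nat_trunc _ j.+1 (j.+1 + K) B)//; last 3 first.
- by rewrite leq_addr.
- move=> k jk; apply: incell_out; apply/orP; right; apply: (lt_le_trans hK).
  by rewrite lerD2r; apply: c_nondecr; lia.
- by move=> k /hB Bk; apply: incell_out; apply/orP; right.
rewrite -{1}[j.+1]add0n big_addn addKn big_mkord; apply: eq_bigr => k _; rewrite mxE.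
by congr incell; rewrite -addSnnS addnC; lra.
Qed.

(** Points are removed by index rather than by cell, so ties of [c] cause no error, in contrast to
    [telescope_step]; crowding is the one exception. *)
Let gap_step B t j : (forall k, (B <= k)%N -> A < c k - t) -> (j < B)%N ->
  `|u (tail B t j) - u (tail B t j.+1) - jump u (c j - t) (gapv c K j)| <=
  4 * M * (crowded j * win j t).
Proof.
move=> hB jB.
have E : tail B t j = [ffun i : 'I_(ncell m0) => (ev m0 (c j - t) i + tail B t j.+1 i)%N].
  by apply/ffunP => i; rewrite tailS// [RHS]ffunE.
rewrite /win; case: (boolP (- A < c j - t <= A)) => [/andP[w1 w2]|]; last first.
  rewrite negb_and -leNgt -ltNge => wo; rewrite mulr0 mulr0 jump_out// subr0.
  suff -> : tail B t j = tail B t j.+1 by rewrite subrr normr0.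
  by apply/ffunP => i; rewrite tailS// [ev _ _ _]ffunE incell_out.
rewrite mulr1 /crowded; case: (leP (c (j + K)%N - c j) (2 * A)) => cK.
  rewrite mulr1; have := jump_bounded uM (c j - t) (gapv c K j).
  have := uM (tail B t j); have := uM (tail B t j.+1) => u1 u2 u3.
  apply: (le_trans (ler_normB _ _)); have := ler_normB (u (tail B t j)) (u (tail B t j.+1)).
  by lra.
rewrite mulr0 /jump (tail_evs hB jB); last by lra.
by rewrite {1}E subrr normr0.
Qed.

Let gap_sum B t : (forall k, (B <= k)%N -> A < c k - t) ->
  `|u (tail B t 0) - u [ffun=> 0%N] - \sum_(j < B) jump u (c j - t) (gapv c K j)| <=
  \sum_(j < B) 4 * M * (crowded j * win j t).
Proof.
move=> hB.
have -> : u (tail B t 0) - u [ffun=> 0%N] = \sum_(j < B) (u (tail B t j) - u (tail B t j.+1)).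
  have -> : [ffun=> 0%N] = tail B t B by apply/ffunP => i; rewrite !ffunE big_geq.
  rewrite -[LHS]opprB -(@telescope_sumr _ 0 B (fun j => u (tail B t j)))//.
  by rewrite big_mkord -sumrN; apply: eq_bigr => j _; rewrite opprB.
rewrite -sumrB (le_trans (ler_norm_sum _ _ _))//.
by apply: ler_sum => j _; exact: gap_step.
Qed.

Let measurable_reflect_jump (a : R) (v : 'rV[R]_K) :
  measurable_fun setT (fun t : R => jump u (a - t) v).
Proof.
apply: (@measurableT_comp _ _ _ _ _ _ (fun s : R => jump u s v) _ (fun t : R => a - t)).
  exact: measurable_jump.
exact: measurable_funB.
Qed.

Let integ_reflect_jump (a T : R) (v : 'rV[R]_K) :
  integ lam `]0, T]%classic (fun t : R => jump u (a - t) v).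
Proof.
apply: (@integ_time _ _ (2 * M)); first exact: measurable_reflect_jump.
by move=> t; exact: jump_bounded.
Qed.

Let integ_win j T : integ lam `]0, T]%classic (win j).
Proof. exact: integ_window. Qed.

Let Rintegral_win j T : Rintegral lam `]0, T]%classic (win j) <= 2 * A.
Proof.
have AA : - A <= A by have := ler0n R m0.+1; lra.
by have := time_window_le T (c j) AA; rewrite /win; lra.
Qed.

Let Rintegral_reflect_jump_le (j : nat) T (v : 'rV[R]_K) :
  `|Rintegral lam `]0, T]%classic (fun t => jump u (c j - t) v)| <= 4 * M * A.
Proof.
have mT := measurable_0T T.
have := Rintegral_dist mT (integ_reflect_jump (c j) T v) (integ_cst mT 0 (lam_0T_fin T))
  (integZ mT (2 * M) (integ_win j T)).
rewrite (Rintegral_cst lam mT) mul0r subr0 => h.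
apply: (le_trans (h _)) => [t _|].
  rewrite subr0 /win; case: (boolP (- A < c j - t <= A)) => [_|].
    by rewrite mulr1 jump_bounded.
  by rewrite negb_and -leNgt -ltNge => wo; rewrite jump_out// normr0 mulr0.
rewrite RintegralZl//; last exact: integ_win.
have := Rintegral_win j T => hw.
have := ler_wpM2l (_ : 0 <= 2 * M) hw => /(_ ltac:(by rewrite mulr_ge0)).
by lra.
Qed.

(** For such an a, all times with -A < a - t <= A lie in ]0, T], so the integral is the full [jbar]
    after the substitution s = a - t. *)
Let Rintegral_reflect_jump (a T : R) (v : 'rV[R]_K) : A < a <= T - A ->
  Rintegral lam `]0, T]%classic (fun t => jump u (a - t) v) = jb v.
Proof.
move=> /andP[Aa aT].
rewrite /jbar Rintegral_mkcond [RHS]Rintegral_mkcond.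
have -> : ((fun t => jump u (a - t) v) \_ `]0, T]%classic) = (fun t => jump u (a - t) v).
  apply/funext => t; rewrite patchE; case: ifPn => // /negP tn.
  case: (boolP (- A < a - t <= A)) => [h|].
    by exfalso; apply: tn; apply/mem_set => /=; rewrite in_itv/=; lra.
  by rewrite negb_and -leNgt -ltNge => wo; rewrite jump_out.
have -> : ((fun s => jump u s v) \_ `]- A, A]%classic) = (fun s => jump u s v).
  apply/funext => t; rewrite patchE; case: ifPn => // /negP tn.
  case: (boolP (- A < t <= A)) => [h|].
    by exfalso; apply: tn; apply/mem_set => /=; rewrite in_itv.
  by rewrite negb_and -leNgt -ltNge => wo; rewrite jump_out.
have mZ : cmeas (fun s : R => (ev m0 s, evs m0 s v)).
  apply: cmeas_pair; last exact: cmeas_evs.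
  apply: cmeas_ffun => i; have := @cmeas_incell R m0 i 0.
  by congr cmeas; apply/funext => s; rewrite addr0.
exact: (Rintegral_reflect (fun f : {ffun 'I_(ncell m0) -> nat} * {ffun 'I_(ncell m0) -> nat} =>
  u [ffun i => (f.1 i + f.2 i)%N] - u f.2) a mZ).
Qed.

Let boundary T : 0 <= T ->
  (\sum_(j < NC (T + A)) ~~ (A < c j <= T - A)%R <= NC A + (NC (T + A) - NC (T - A)))%N.
Proof.
move=> T0; have le1 : (NC (T - A)%R <= NC (T + A)%R)%N by apply: Nc_le => //; have := ler0n R m0.+1; lra.
have le2 : (NC A <= NC (T + A)%R)%N by apply: Nc_le => //; rewrite lerDr.
have E1 := sum_ltn_ord (NC A) (NC (T + A)); have E2 := sum_ltn_ord (NC (T - A)) (NC (T + A)).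
rewrite (minn_idPl le2) in E1; rewrite (minn_idPl le1) in E2.
have E3 : (\sum_(j < NC (T + A)%R) ~~ (A < c j <= T - A)%R + \sum_(j < NC (T + A)%R) (j < NC (T - A)%R)
   <= \sum_(j < NC (T + A)%R) (j < NC A) + NC (T + A)%R)%N.
  rewrite -[X in (_ <= _ + X)%N](card_ord (NC (T + A))) -sum1_card -!big_split/=.
  apply: leq_sum => j _; rewrite !NcP//.
  by case: (leP (c j) A); case: (leP (c j) (T - A)).
move: E3; rewrite E1 E2; lia.
Qed.

(** A crowded index costs 4 M during a window of length 2 A. An index whose window may leave ]0, T]
    costs at most the sum of two terms bounded by 4 M A. *)
Lemma gap_expansion T : 0 <= T ->
  `|Rintegral lam `]0, T]%classic (fun t => u (cellfam m0 (xiT c t))) - T * u [ffun=> 0%N]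
    - \sum_(j < NC (T + A)) jb (gapv c K j)| <=
  8 * M * A * (\sum_(j < NC (T + A)) crowded j) +
  8 * M * A * (NC A + (NC (T + A)%R - NC (T - A)%R))%N%:R.
Proof.
move=> T0; have mT := measurable_0T T; set B := NC (T + A).
have iu : integ lam `]0, T]%classic (fun t => u (cellfam m0 (xiT c t))).
  apply: (@integ_time _ _ M) => //.
  exact: (measurable_time u (cmeas_fam _ _ (xiTpp c_pos c_nondecr Nc_equiv))).
have i0 := integ_cst mT (u [ffun=> 0%N]) (lam_0T_fin T).
have ij : integ lam `]0, T]%classic (fun t => \sum_(j < B) jump u (c j - t) (gapv c K j)).
  by apply: (integ_sum mT) => j; exact: integ_reflect_jump.
have id j : integ lam `]0, T]%classic (fun t => 4 * M * (crowded j * win j t)).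
  by apply: (integZ mT); apply: (integZ mT); exact: integ_win.
have iS : integ lam `]0, T]%classic (fun t => \sum_(j < B) 4 * M * (crowded j * win j t)).
  by apply: (integ_sum mT) => j; exact: id.
have h1 := Rintegral_dist mT (integB mT iu i0) ij iS.
rewrite (RintegralB mT iu i0) (Rintegral_time_cst _ T0) (Rintegral_sum mT) in h1; last first.
  by move=> j; exact: integ_reflect_jump.
rewrite (Rintegral_sum mT) in h1; last by move=> j; exact: id.
have {}h1 : `|Rintegral lam `]0, T]%classic (fun t => u (cellfam m0 (xiT c t))) - u [ffun=> 0%N] * T
   - \sum_(j < B) Rintegral lam `]0, T]%classic (fun t => jump u (c j - t) (gapv c K j))| <=
   8 * M * A * (\sum_(j < B) crowded j).
  apply: le_trans (h1 _) _.
    move=> t /=; rewrite in_itv/= => /andP[t0 tT].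
    rewrite -(tail_start tT); apply: gap_sum => k.
    by rewrite leqNgt NcP// -ltNge; lra.
  rewrite mulr_sumr; apply: ler_sum => j _.
  rewrite RintegralZl//; last by apply: (integZ mT); exact: integ_win.
  rewrite RintegralZl//; last exact: integ_win.
  have d0 : 0 <= crowded j by exact: ler0n.
  have := ler_wpM2l (_ : 0 <= 4 * M * crowded j) (Rintegral_win j T) => /(_ ltac:(by rewrite !mulr_ge0)).
  by lra.
have h2 : `|\sum_(j < B) Rintegral lam `]0, T]%classic (fun t => jump u (c j - t) (gapv c K j)) -
    \sum_(j < B) jb (gapv c K j)| <= 8 * M * A * (NC A + (NC (T + A)%R - NC (T - A)%R))%N%:R.
  rewrite -sumrB (le_trans (ler_norm_sum _ _ _))//.
  apply: le_trans (_ : 8 * M * A * (\sum_(j < B) ~~ (A < c j <= T - A)%R)%N%:R <= _); last first.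
    by rewrite ler_wpM2l ?mulr_ge0// ler_nat; exact: boundary.
  rewrite natr_sum mulr_sumr; apply: ler_sum => j _.
  case: (boolP (A < c j <= T - A)) => h; first by rewrite Rintegral_reflect_jump// subrr normr0 mulr0.
  have := Rintegral_reflect_jump_le j T (gapv c K j).
  have := @jbar_bounded _ _ _ _ _ uM (gapv c K j).
  by move=> k1 k2; apply: (le_trans (ler_normB _ _)); rewrite mulr1; lra.
rewrite [T * _]mulrC; apply: (le_trans (ler_distD (\sum_(j < B) Rintegral lam `]0, T]%classic
  (fun t => jump u (c j - t) (gapv c K j))) _ _)).
exact: lerD.
Qed.

End GapExpansion.

(** * Convergence of time averages *)

Section GapsToTime.
Context (R : realType) (c : nat -> R).
Hypothesis c_pos : forall n, 0 < c n.
Hypothesis c_nondecr : forall m n, (m <= n)%N -> c m <= c n.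
Hypothesis Nc_equiv : ((Ncount c T * (T^-1)%:E)%E @[T --> +oo]) --> 1%E.
Context d (Omega : measurableType d) (P : probability Omega R).
Variable xi : Omega -> {measure set R -> \bar R}.
Hypotheses (xi_pp : point_process xi) (xi_stat : stationary_pp P xi).
Hypotheses (xi_simple : simple_pp P xi) (xi_int : has_intensity P xi 1).
Context d0 (Omega0 : measurableType d0) (P0 : probability Omega0 R).
Variable xi0 : Omega0 -> {measure set R -> \bar R}.
Hypothesis xi0_palm : is_palm_version P xi 1 P0 xi0.
Hypothesis conv : forall K : nat, (0 < K)%N ->
  forall g : 'rV[R]_K -> R, continuous g -> (exists M : R, forall v, `|g v| <= M) ->
  N%:R^-1 * \sum_(n < N) g (gapv c K n) @[N --> \oo]
    --> Rintegral P0 setT (fun w => g (xvec K (xi0 w))).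

Notation lam := (@lebesgue_measure R).
Notation NC := (Nc c_pos Nc_equiv).

Lemma boundary_cvg (a : R) : 0 <= a ->
  T^-1 * (NC a + (NC (T + a)%R - NC (T - a)%R))%N%:R @[T --> +oo] --> (0 : R).
Proof.
move=> a0.
have h1 : (NC a)%:R / T @[T --> +oo] --> (0 : R).
  rewrite -(mulr0 (NC a)%:R); apply: cvgMl_tmp; apply/gtr0_cvgV0; last exact: cvg_id.
  exact: (@near_pinfty_gt R 0).
have h2 : (NC (T + a))%:R / T - (NC (T - a))%:R / T @[T --> +oo] --> (1 - 1 : R).
  by apply: cvgB; exact: Nc_shift_cvg.
have h3 : (NC a)%:R / T + ((NC (T + a))%:R / T - (NC (T - a))%:R / T) @[T --> +oo] --> (0 : R).
  by rewrite -[X in _ --> X]addr0 -[X in _ --> _ + X](subrr (1 : R)); exact: cvgD.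
move: h3; apply: cvg_trans; apply: near_eq_cvg; near=> T.
rewrite /= [RHS]mulrC natrD natrB; first by rewrite mulrDl mulrBl.
by apply: Nc_le => //; lra.
Unshelve. all: by end_near.
Qed.

Let rare k b : R := fine (P0 [set w | (k%:R%:E <= xi0 w `]0%R, b]%classic)%E]).

Let measurable_rare k b : measurable [set w | (k%:R%:E <= xi0 w `]0%R, b]%classic)%E].
Proof. exact: measurable_ge_points xi0_palm.1. Qed.

Section Cells.
Variables (m0 : nat) (M : R) (u : {ffun 'I_(ncell m0) -> nat} -> R).
Hypotheses (M0 : 0 <= M) (uM : forall k, `|u k| <= M).

Notation A := (m0.+1%:R : R).

(** A continuous majorant of [crowded], as the hypothesis [conv] concerns continuous functions. It
    vanishes from 2 A + 1 on, whence that value in the tail event; the left end -1 only serves to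
    include the gap 0. *)
Let cutoff k0 (v : 'rV[R]_k0.+1) : R := trap (- 1) (2 * A) 1 (v 0 ord_max).

Let cutoff_01 k0 (v : 'rV[R]_k0.+1) : 0 <= cutoff v <= 1.
Proof. exact: trap_01. Qed.

Let cutoff_bounded k0 (v : 'rV[R]_k0.+1) : `|cutoff v| <= 1.
Proof. by have /andP[h1 h2] := cutoff_01 v; rewrite ger0_norm. Qed.

Let cutoff_continuous k0 : continuous (@cutoff k0).
Proof.
move=> v; apply: (@continuous_comp _ _ _ (fun v : 'rV[R]_k0.+1 => v 0 ord_max)
  (trap (- 1) (2 * A) 1)); first exact: (@coord_continuous R 1 k0.+1 0 ord_max).
exact: (trap_Cc (- 1) (2 * A) ltr01).1.
Qed.

Let crowded_cutoff k0 n : crowded c m0 k0 n <= cutoff (gapv c k0.+1 n).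
Proof.
have /andP[h0 _] := cutoff_01 (gapv c k0.+1 n).
rewrite /crowded; case: (boolP (c (n + k0.+1)%N - c n <= 2 * A)) => // h; rewrite /cutoff [gapv _ _ _ _ _]mxE trap_in//.
have := c_nondecr (leq_addr k0.+1 n); move: h => /=; lra.
Qed.

Let cutoff_rare k0 : Rintegral P0 setT (fun w => cutoff (xvec k0.+1 (xi0 w))) <= rare k0.+1 (2 * A + 1).
Proof.
have mB := measurable_rare k0.+1 (2 * A + 1).
rewrite /rare -(Rintegral_indic P0 measurableT mB)//.
have icut := integ_xvec xi0_palm (@cutoff_continuous k0) (@cutoff_bounded k0).
have i0 := integ_cst measurableT (0 : R) (Pfin P0).
have iB := integ_indic measurableT mB (Pfin P0).
have h := Rintegral_dist_ae icut i0 iB.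
rewrite Rintegral_cst_prob subr0 in h.
apply: (le_trans (ler_norm _)); apply: h; first by move=> w; rewrite indicE.
(* A missing K-th point would give [xk] the default [inf set0 = 0], where the cutoff is 1; almost
   surely this does not occur. *)
apply: filterS (palm_right_infinite xi_pp xi_stat xi_simple xi_int xi0_palm) => w inf.
rewrite subr0 indicE.
have b0 : 0 <= 2 * A + 1 by rewrite addr_ge0.
have [_ _ hi] := xk_located b0 (inf k0.+1).
have [xb|bx] := ltP (xk k0.+1 (xi0 w)) (2 * A + 1).
  by rewrite mem_set ?trap_01//= ?ger0_norm//; apply: hi; rewrite lexx andbT gt_min xb.
rewrite /cutoff [xvec _ _ _ _]mxE trap_out ?normr0//.
by apply/orP; right.
Qed.

Let gap_average_near k0 e : 0 < e -> \forall T \near +oo,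
  `|T^-1 * Rintegral lam `]0, T]%classic (fun t => u (cellfam m0 (xiT c t))) - u [ffun=> 0%N]
    - Rintegral P0 setT (fun w => jbar u (xvec k0.+1 (xi0 w)))| <=
  8 * M * A * rare k0.+1 (2 * A + 1) + e.
Proof.
(* Crowding and boundary each cost 8 M A e1, the average of [jbar] costs e1. *)
move=> e0; pose e1 := e / (16 * M * A + 1).
have q0 : 0 < 16 * M * A + 1 by rewrite ltr_wpDl// !mulr_ge0.
have e10 : 0 < e1 by rewrite divr_gt0.
have Ee : e1 * (16 * M * A + 1) = e by rewrite divfK// gt_eqF.
have jc : continuous (@jbar R m0 k0.+1 u) := lipv_continuous (jumpC_ge0 _ _ M0) (jbar_lip M0 uM).
have c1 := conv (ltn0Sn k0) jc (ex_intro _ _ (jbar_bounded uM)).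
have c2 := conv (ltn0Sn k0) (@cutoff_continuous k0) (ex_intro _ _ (@cutoff_bounded k0)).
have {}c1 := @avg_nat_real _ _ c_pos c_nondecr Nc_equiv (fun n => jbar u (gapv c k0.+1 n)) _ A c1.
have {}c2 := @avg_nat_real _ _ c_pos c_nondecr Nc_equiv (fun n => cutoff (gapv c k0.+1 n)) _ A c2.
have c3 := boundary_cvg (ler0n R m0.+1).
move/cvgr_dist_le/(_ _ e10): c1 => c1; move/cvgr_dist_le/(_ _ e10): c2 => c2.
move/cvgr_dist_le/(_ _ e10): c3 => c3.
have cr := cutoff_rare k0.
near=> T.
have T0 : 0 < T by near: T; exact: near_pinfty_gt.
have n1 : `|Rintegral P0 setT (fun w => jbar u (xvec k0.+1 (xi0 w))) -
  T^-1 * \sum_(n < NC (T + A)) jbar u (gapv c k0.+1 n)| <= e1 by near: T; exact: c1.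
have n2 : `|Rintegral P0 setT (fun w => cutoff (xvec k0.+1 (xi0 w))) -
  T^-1 * \sum_(n < NC (T + A)) cutoff (gapv c k0.+1 n)| <= e1 by near: T; exact: c2.
have n3 : `|0 - T^-1 * (NC A + (NC (T + A)%R - NC (T - A)%R))%N%:R| <= e1 by near: T; exact: c3.
have h := @gap_expansion _ _ c_pos c_nondecr Nc_equiv m0 k0 _ _ M0 uM T (ltW T0).
have Ti : 0 < T^-1 by rewrite invr_gt0.
have hs : \sum_(j < NC (T + A)) crowded c m0 k0 j <= \sum_(j < NC (T + A)) cutoff (gapv c k0.+1 j).
  by apply: ler_sum => j _; exact: crowded_cutoff.
have C0 : 0 <= 8 * M * A by rewrite !mulr_ge0.
move: h hs n1 n2 n3 cr; set I := Rintegral lam _ _; set J := \sum_(j < _) jbar _ _.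
set D := \sum_(j < _) crowded _ _ _ _; set X := \sum_(j < _) cutoff _; set B := (NC A + _)%N%:R.
set E1 := Rintegral P0 _ _; set E2 := Rintegral P0 _ _ => h hs n1 n2 n3 cr.
have {}h : `|T^-1 * I - u [ffun=> 0%N] - T^-1 * J| <= 8 * M * A * (T^-1 * D) + 8 * M * A * (T^-1 * B).
  have -> : T^-1 * I - u [ffun=> 0%N] - T^-1 * J = T^-1 * (I - T * u [ffun=> 0%N] - J).
    by rewrite !mulrBr [T^-1 * (T * _)]mulrA mulVf ?mul1r// gt_eqF.
  rewrite normrM (gtr0_norm Ti); apply: le_trans (ler_wpM2l (ltW Ti) h) _.
  by rewrite mulrDr [T^-1 * (_ * D)]mulrCA [T^-1 * (_ * B)]mulrCA.
have k1 : T^-1 * D <= rare k0.+1 (2 * A + 1) + e1.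
  have := ler_wpM2l (ltW Ti) hs; move: n2; rewrite ler_norml; lra.
have k2 : T^-1 * B <= e1 by move: n3; rewrite sub0r normrN; apply: le_trans; exact: ler_norm.
have k3 := ler_wpM2l C0 k1; have k4 := ler_wpM2l C0 k2.
rewrite (le_trans (ler_distD (T^-1 * J) _ _))// [`|T^-1 * J - _|]distrC.
move: k3 k4; rewrite !mulrDr -Ee; lra.
Unshelve. all: by end_near.
Qed.

Let rare_le k (b b' : R) : b <= b' -> rare k b <= rare k b'.
Proof.
move=> bb; have m1 := measurable_rare k b; have m2 := measurable_rare k b'.
apply: fine_le; [exact: fin_num_measure|exact: fin_num_measure|].
by apply: le_measure; rewrite ?inE// => w; exact: cnt_le.
Qed.

(** [palm_expansion] and [gap_average_near] share the main term, [u] of the empty configuration plus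
    the Palm expectation of [jbar]; K is chosen to make both crowding errors small. *)
Lemma cells_average_cvg :
  T^-1 * Rintegral lam `]0, T]%classic (fun t => u (cellfam m0 (xiT c t))) @[T --> +oo]
    --> Rintegral P setT (fun w => u (cellfam m0 (xi w))).
Proof.
apply/cvgrPdist_le => e e0.
pose e1 := e / (16 * M * A + 1).
have q0 : 0 < 16 * M * A + 1 by rewrite ltr_wpDl// !mulr_ge0.
have e10 : 0 < e1 by rewrite divr_gt0.
have Ee : e1 * (16 * M * A + 1) = e by rewrite divfK// gt_eqF.
have [k0 hk] := @palm_right_finite _ _ _ _ _ xi_pp _ _ _ _ xi0_palm (2 * A + 1) _ e10.
have r1 : rare k0.+1 (2 * A + 1) <= e1.
  rewrite -lee_fin /rare fineK ?hk// fin_num_measure//; exact: measurable_rare.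
have r2 : rare k0.+1 (2 * A) <= e1 by apply: le_trans r1; apply: rare_le; lra.
have C0 : 0 <= 8 * M * A by rewrite !mulr_ge0.
have h1 := @palm_expansion _ _ _ _ _ xi_pp xi_stat xi_simple xi_int _ _ _ _ xi0_palm m0 k0 _ _ M0 uM.
have h2 := gap_average_near k0 e10.
apply: filterS h2 => T h2.
have s1 := ler_wpM2l C0 r1; have s2 := ler_wpM2l C0 r2.
move: h1 h2; rewrite -/(rare _ _) -Ee !ler_norml; lra.
Qed.

End Cells.

(** Since [Flow] lies below [F], replacing it by [F] in the time average costs nothing for any T;
    only the expectation under [P] needs the limit in n. *)
Lemma time_lower (F : {measure set R -> \bar R} -> R) (e : R) :
  vague_continuous F -> bounded_on_counting F -> 0 < e ->
  \forall T \near +oo, Rintegral P setT (fun w => F (xi w)) - e <=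
    T^-1 * Rintegral lam `]0%R, T] (fun t => F (xiT c t)).
Proof.
move=> Fc Fb e0.
have e20 : 0 < e / 2 by rewrite divr_gt0.
have [M M0 FlM] := Flow_bounded Fb.
have [M' FM'] := Fb.
have xpp := xiTpp c_pos c_nondecr Nc_equiv.
have mFl n : measurable_fun setT (fun w => Flow F (cellfam n (xi w))).
  exact: (cmeas_measurable (@Flow R F n) (cmeas_fam _ _ xi_pp)).
have cv : Rintegral P setT (fun w => Flow F (cellfam n (xi w))) @[n --> \oo] -->
    Rintegral P setT (fun w => F (xi w)).
  apply: (Rintegral_dominated_cvg measurableT mFl (measurable_vague Fc Fb xi_pp) _
    (integ_cst measurableT M (Pfin P))) => //.
  by apply: aeW => w _; apply: Flow_cvg => //; exact: xi_pp.1.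
move/cvgr_dist_le/(_ _ e20): cv => [n _ /(_ n (leqnn n))/= hn].
have := cells_average_cvg M0 (@FlM n) => /cvgr_dist_le/(_ _ e20) hT.
near=> T.
have T0 : 0 < T by near: T; exact: near_pinfty_gt.
have h1 : `|Rintegral P setT (fun w => Flow F (cellfam n (xi w))) -
  T^-1 * Rintegral lam `]0, T]%classic (fun t => Flow F (cellfam n (xiT c t)))| <= e / 2.
  by near: T; exact: hT.
have h2 : Rintegral lam `]0, T]%classic (fun t => Flow F (cellfam n (xiT c t))) <=
    Rintegral lam `]0, T]%classic (fun t => F (xiT c t)).
  apply: le_Rintegral; first exact: measurable_0T.
  - apply: (@integ_time _ _ M) => //.
    exact: (measurable_time (@Flow R F n) (cmeas_fam _ _ xpp)).
  - apply: (@integ_time _ _ M'); first exact: measurable_vague.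
    by move=> t; apply: FM'; exact: xpp.1.
  - by move=> t _; apply: Flow_le => //; exact: xpp.1.
have := ler_wpM2l (_ : 0 <= T^-1) h2 => /(_ ltac:(by rewrite invr_ge0 ltW)) h3.
move: hn h1; rewrite !ler_norml; lra.
Unshelve. all: by end_near.
Qed.

Theorem gaps_to_time (F : {measure set R -> \bar R} -> R) :
  vague_continuous F -> bounded_on_counting F ->
  T^-1 * Rintegral lam `]0%R, T] (fun t => F (xiT c t)) @[T --> +oo]
    --> Rintegral P setT (fun w => F (xi w)).
Proof.
move=> Fc Fb; have [M FM] := Fb; have xpp := xiTpp c_pos c_nondecr Nc_equiv.
pose F' nu := - F nu.
have Fc' : vague_continuous F'.
  move=> nu cn e e0; have [fs [delta [h1 h2 h3]]] := Fc nu cn e e0.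
  exists fs, delta; split => // mu cm hm; rewrite /F' -opprD normrN.
  exact: h3.
have Fb' : bounded_on_counting F' by exists M => nu cn; rewrite /F' normrN FM.
apply/cvgrPdist_le => e e0; near=> T.
have h1 : Rintegral P setT (fun w => F (xi w)) - e <=
    T^-1 * Rintegral lam `]0%R, T] (fun t => F (xiT c t)) by near: T; exact: time_lower.
have h2 : Rintegral P setT (fun w => F' (xi w)) - e <=
    T^-1 * Rintegral lam `]0%R, T] (fun t => F' (xiT c t)) by near: T; exact: time_lower.
have iF : integ P setT (fun w => F (xi w)).
  apply: (@integ_bounded _ _ _ P _ measurableT _ M); first exact: Pfin.
    exact: measurable_vague.
  by move=> w _; apply: FM; exact: xi_pp.1.
have iF' : integ lam `]0, T]%classic (fun t => F (xiT c t)).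
  apply: (@integ_time _ _ M); first exact: measurable_vague.
  by move=> t; apply: FM; exact: xpp.1.
move: h2; rewrite /F' (RintegralN measurableT iF) (RintegralN (measurable_0T T) iF') mulrN.
by move: h1; rewrite ler_norml; lra.
Unshelve. all: by end_near.
Qed.

End GapsToTime.

Unset Implicit Arguments.

Theorem mainTheorem11 (R : realType) (c : nat -> R)
  (c_pos : forall n, 0 < c n)
  (c_nondecr : forall m n, (m <= n)%N -> c m <= c n)
  (Nc_equiv : ((Ncount c T * (T^-1)%:E)%E @[T --> +oo]) --> 1%E)
  (d : measure_display) (Omega : measurableType d) (P : probability Omega R)
  (xi : Omega -> {measure set R -> \bar R})
  (xi_pp : point_process xi) (xi_stat : stationary_pp P xi)
  (xi_simple : simple_pp P xi) (xi_int : has_intensity P xi 1)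
  (d0 : measure_display) (Omega0 : measurableType d0) (P0 : probability Omega0 R)
  (xi0 : Omega0 -> {measure set R -> \bar R})
  (xi0_palm : is_palm_version P xi 1 P0 xi0) :
  (forall F : {measure set R -> \bar R} -> R,
     vague_continuous F -> bounded_on_counting F ->
     (T^-1 * Rintegral (@lebesgue_measure R) `]0%R, T] (fun t => F (xiT c t)))
       @[T --> +oo] --> Rintegral P setT (fun w => F (xi w)))
  <->
  (forall K : nat, (0 < K)%N ->
     forall g : 'rV[R]_K -> R, continuous g -> (exists M : R, forall v, `|g v| <= M) ->
       (N%:R^-1 * \sum_(n < N) g (\row_(i < K) (c (n + i.+1)%N - c n)))
         @[N --> \oo] --> Rintegral P0 setT (fun w => g (\row_(i < K) xk i.+1 (xi0 w)))).
Proof.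
split=> [conv K K0 g gc gM|conv F Fc Fb].
  exact: (time_to_gaps c_pos c_nondecr Nc_equiv xi_pp xi_stat xi_simple xi_int xi0_palm conv K0 gc gM).
exact: (gaps_to_time c_pos c_nondecr Nc_equiv xi_pp xi_stat xi_simple xi_int xi0_palm conv Fc Fb).
Qed.
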